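(* Let $(\alpha_n)$ be a Riemann sequence. For $x$ real, $x\to0^+$, we have the asymptotic expansion $$2\sum_{n=1}^\infty e^{-\alpha_n^2x}\sim\frac{1}{4\sqrt{\pi x}}\log\frac{e^{-C_0}}{16\pi^2x}+\sum_{n=0}^\infty\frac{a_{n+1}}{\Gamma(1+n/2)}x^{n/2}.$$
   Context: $C_0=0.577216\dots$ is Euler's constant. The relation $\sim$ is meant in the usual (Poincaré) sense as $x\to0^+$: for every $N\ge1$, the difference between the left-hand side and $\frac{1}{4\sqrt{\pi x}}\log\frac{e^{-C_0}}{16\pi^2x}+\sum_{n=0}^{N-1}\frac{a_{n+1}}{\Gamma(1+n/2)}x^{n/2}$ is $O(x^{N/2})$. Asymptotic notation $\simeq$: for a function $f(z)$ defined on a half-plane $\operatorname{Re}z>a$, one writes $f(z)\simeq\sum_{n=0}^\infty\frac{b_n}{z^n}$ if for each natural number $N$ and any $0<\varepsilon<\frac{\pi}{2}$ we have $\lim_{z\to\infty}\bigl(f(z)-\sum_{n=0}^N\frac{b_n}{z^n}\bigr)z^N=0$ for $|\arg z|\le\frac{\pi}{2}-\varepsilon$; and $f\simeq g+\sum_n b_nz^{-n}$ means $f-g\simeq\sum_n b_nz^{-n}$. Coefficients: $a_{2n+1}=\frac{8-E_{2n}}{2^{2n+2}}$ ($n\ge0$), $a_{2n}=\bigl(1-\frac{1}{2^{2n-1}}\bigr)\frac{B_{2n}}{4n}$ ($n\ge1$), with $\frac{2e^t}{e^{2t}+1}=\sum_{n\ge0} E_n\frac{t^n}{n!}$, $\frac{t}{e^t-1}=\sum_{n\ge0}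 B_n\frac{t^n}{n!}$. Riemann sequence: a sequence of complex numbers $(\alpha_n)_{n\ge1}$ is a Riemann sequence if: (a) $1<\operatorname{Re}\alpha_1\le\operatorname{Re}\alpha_2\le\cdots$; (b) each complex number $\alpha$ has finite multiplicity $\nu(\alpha)=\operatorname{card}\{n:\alpha_n=\alpha\}$, and $\nu(\alpha)=\nu(\overline\alpha)$ if $\alpha$ is not real; (c) there is a constant $C$ with $|\operatorname{Im}\alpha_n|<C$ for all $n$; (d) $|\arg\alpha_n|<\pi/4$, i.e. $|\operatorname{Im}\alpha_n|<\operatorname{Re}\alpha_n$, for all $n$; (e) $\sum_{k=1}^\infty\frac{2z}{z^2+\alpha_k^2}\simeq\frac12\log\frac{z}{2\pi}+\sum_{n=1}^\infty\frac{a_n}{z^n}$. *)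

(* Defs.v *)
(* Stdlib reals with Coquelicot: complex numbers, series, improper integrals. *)
From Stdlib Require Import Reals Factorial List.
From Coquelicot Require Import Coquelicot.
Open Scope R_scope.

(* Principal argument, in (-PI, PI], of a nonzero complex number. *)
Definition Carg (z : C) : R :=
  if Rle_dec 0 (Im z) then acos (Re z / Cmod z) else - acos (Re z / Cmod z).

Definition Clog (z : C) : C := (ln (Cmod z), Carg z).

Definition Cexp (z : C) : C := (exp (Re z) * cos (Im z), exp (Re z) * sin (Im z)).

(* Euler's integral; meaningful for s > 0, where it converges. *)
Definition Gamma (s : R) : R :=
  RInt_gen (fun t : R => Rpower t (s - 1) * exp (- t))
           (at_right 0) (Rbar_locally p_infty).

Definition euler_const : R :=
  real (Lim_seq (fun n => sum_n_m (fun k => / INR k) 1 n - ln (INR n))).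

(* g(t) = sum_n c_n t^n / n! near 0.  The point t = 0 is left out because g may
   have a removable singularity there; the c_n are determined all the same. *)
Definition is_egf (c : nat -> R) (g : R -> R) : Prop :=
  exists r : R, 0 < r /\
    forall t : R, 0 < Rabs t < r ->
      is_pseries (fun n => c n / INR (fact n)) t (g t).

Definition is_euler_numbers (E : nat -> R) : Prop :=
  is_egf E (fun t => 2 * exp t / (exp (2 * t) + 1)).

Definition is_bernoulli_numbers (B : nat -> R) : Prop :=
  is_egf B (fun t => t / (exp t - 1)).

(* The coefficients a_n, n >= 1.  The value at n = 0 is 0 so that
   sum_(n >= 1) a_n / z^n is the expansion with constant term b_0 = 0. *)
Definition acoef (E B : nat -> R) (n : nat) : R :=
  match n with
  | O => 0
  | S _ =>
      let m := Nat.div2 n in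
      if Nat.even n
      then (1 - 1 / 2 ^ (2 * m - 1)) * (B (2 * m)%nat / (4 * INR m))
      else (8 - E (2 * m)%nat) / 2 ^ (2 * m + 2)
  end.

Definition C_infty (P : C -> Prop) : Prop :=
  exists M : R, forall z : C, M < Cmod z -> P z.

Global Instance C_infty_filter : Filter C_infty.
Proof.
constructor.
- now exists 0.
- intros P Q [M HM] [M' HM']; exists (Rmax M M'); intros z Hz; split.
  + apply HM; apply Rle_lt_trans with (2 := Hz); apply Rmax_l.
  + apply HM'; apply Rle_lt_trans with (2 := Hz); apply Rmax_r.
- intros P Q HPQ [M HM]; exists M; intros z Hz; apply HPQ, HM, Hz.
Qed.

(* f(z) ~ sum_n b_n / z^n as z -> oo, in every closed sector
   |arg z| <= PI/2 - eps.  Such a sector lies, near infinity, in every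
   half-plane Re z > a, so only the values of f on one such half-plane matter. *)
Definition sector_expansion (f : C -> C) (b : nat -> R) : Prop :=
  forall (N : nat) (eps : R), 0 < eps < PI / 2 ->
    filterlim
      (fun z : C =>
         ((f z - sum_n (fun n => RtoC (b n) / z ^ n) N) * z ^ N)%C)
      (within (fun z : C => Rabs (Carg z) <= PI / 2 - eps) C_infty)
      (locally (RtoC 0)).

Definition is_multiplicity (alpha : nat -> C) (w : C) (m : nat) : Prop :=
  exists l : list nat,
    NoDup l /\ (forall n : nat, In n l <-> alpha n = w) /\ length l = m.

(* Indices are shifted: alpha k stands for alpha_(k+1).  The parameter a gives
   the coefficients of the expansion, with a 0 = 0. *)
Record riemann_sequence (a : nat -> R) (alpha : nat -> C) : Prop := {
  rs_first : 1 < Re (alpha 0%nat);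
  rs_mono : forall n : nat, Re (alpha n) <= Re (alpha (S n));
  rs_finite : forall w : C, exists m : nat, is_multiplicity alpha w m;
  rs_conj : forall (w : C) (m m' : nat), Im w <> 0 ->
    is_multiplicity alpha w m -> is_multiplicity alpha (Cconj w) m' -> m = m';
  rs_strip : exists K : R, forall n : nat, Rabs (Im (alpha n)) < K;
  rs_arg : forall n : nat, Rabs (Carg (alpha n)) < PI / 4;
  rs_expansion : exists (c : R) (f : C -> C),
    (forall z : C, c < Re z ->
       (forall k : nat, (z ^ 2 + alpha k ^ 2)%C <> RtoC 0) /\
       is_series (fun k => (2 * z / (z ^ 2 + alpha k ^ 2))%C) (f z)) /\
    sector_expansion
      (fun z => (f z - 1 / 2 * Clog (z / (2 * PI)))%C) a
}.

(* Main.v *)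
(* The theta series is recovered from its Laplace transform by Post-Widder
   inversion.  Put beta_k = alpha_k ^ 2 and s = m / x; as m -> oo the quantity
   sum_k (1 + beta_k / s) ^ (- (m + 1)) tends to sum_k exp (- beta_k x), and it is
   the m-th Taylor coefficient at v = 0 of sum_k 1 / (1 - v + beta_k / s), which is
   s / (2 z) times the function expanded in clause (e), taken at
   z = sqrt (s (1 - v)).  The terms of that expansion are, up to constants,
   (1 - v) ^ (- nu) and log (1 - v) (1 - v) ^ (- 1 / 2).  Their m-th
   coefficients are explicit, and converge to the terms of the theorem by Gauss's
   product for Gamma, Wallis' product and the definition of Euler's constant.
   The expansion up to order N + 2 leaves a remainder O (s / |z| ^ (N + 3)), hence
   O (x ^ ((N - 1) / 2) / (s |1 - v| ^ 2)), on the circle |v| = 1 - 1 / m, where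
   |arg z| < PI / 4 and |z| ^ 2 >= 1 / x.  As the mean of 1 / |1 - v| ^ 2 over this
   circle is 1 / (1 - |v| ^ 2) (Poisson kernel), Cauchy's estimate makes the m-th
   coefficient of the remainder O (x ^ ((N + 1) / 2)) uniformly in m. *)
Require Import Defs.
From Stdlib Require Import Reals Lra Lia Psatz Compare_dec.
From Coquelicot Require Import Coquelicot.
Open Scope R_scope.

(* Coquelicot often types an equation on [C] or [R] by a projection such as
   [AbelianMonoid.sort _], which [ring] does not recognise. *)
Ltac Cring := match goal with |- ?a = ?b => change (@eq C a b) end; ring.
Ltac Rring := match goal with |- ?a = ?b => change (@eq R a b) end; ring.
Ltac Cfield := match goal with |- ?a = ?b => change (@eq C a b) end; field.

(** * Convergence of complex sequences and series *)

(** Inversion along a vertical line would need conditionally convergent integrals over an unbounded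
    contour, since sum_k 1 / (s + beta_k) decays only like log |s| / sqrt |s|. A single coefficient
    on a compact circle replaces them. Even the integral over this circle is avoided: a coefficient
    is a limit of finite means over roots of unity, and the Poisson kernel enters only through (1 -
    |v| ^ 2) / |1 - v| ^ 2 = 2 Re (1 / (1 - v)) - 1. The radius 1 - 1 / m meets two demands: its
    m-th power stays away from 0, and s (1 - |v|) = 1 / x does not depend on m, so that one
    threshold on x serves for all m. The passage to the limit in m needs domination in k. The
    majorant is 1 / (1 + Re (beta_k x)). It is summable because the series of clause (e) converges
    at a real point, where the bounded imaginary parts of the alpha_k make the real parts of its
    terms comparable with 1 / (1 + Re beta_k). *)

Definition Clim (u : nat -> C) (l : C) : Prop :=
  is_lim_seq (fun n => Cmod (u n - l)%C) 0.

Lemma squeeze_0 (u v : nat -> R) :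
  (forall n, 0 <= u n <= v n) -> is_lim_seq v 0 -> is_lim_seq u 0.
Proof.
  intros H Hv. apply is_lim_seq_le_le with (fun _ => 0) v; auto.
  apply is_lim_seq_const.
Qed.

Lemma squeeze_0_loc (u v : nat -> R) (n0 : nat) :
  (forall n, (n0 <= n)%nat -> 0 <= u n <= v n) ->
  is_lim_seq v 0 -> is_lim_seq u 0.
Proof.
  intros H Hv. apply is_lim_seq_le_le_loc with (fun _ => 0) v; auto.
  - exists n0. exact H.
  - apply is_lim_seq_const.
Qed.

Lemma is_lim_seq_0_eps (u : nat -> R) :
  (forall n, 0 <= u n) ->
  (forall eps : R, 0 < eps -> exists n0, forall n, (n0 <= n)%nat -> u n <= eps) ->
  is_lim_seq u 0.
Proof.
  intros Hp H. apply is_lim_seq_spec. intros eps.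
  destruct (H (eps / 2)) as [n0 Hn].
  { destruct eps; simpl; lra. }
  exists n0. intros n Hle. specialize (Hn n Hle). specialize (Hp n).
  rewrite Rminus_0_r, Rabs_pos_eq by lra. destruct eps; simpl in *; lra.
Qed.

(** Coquelicot's [is_series] is a filter limit; this turns it into a real limit of moduli, to which
    squeezing applies. *)
Lemma Clim_iff (u : nat -> C) (l : C) :
  Clim u l <-> filterlim u eventually (locally l).
Proof.
  unfold Clim. split; intro H.
  - apply is_lim_seq_spec in H.
    intros P HP.
    destruct (locally_norm_le_locally (V := C_NormedModule) l P HP) as [eps He]. destruct (H eps) as [n0 Hn0].
    exists n0. intros n Hn. apply He. unfold ball_norm.
    change (Cmod (u n - l)%C < eps).
    specialize (Hn0 n Hn). rewrite Rminus_0_r, Rabs_pos_eq in Hn0; auto.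
    apply Cmod_ge_0.
  - apply is_lim_seq_spec. intros eps.
    assert (HP : locally l (fun z => Cmod (z - l)%C < eps)).
    { apply (locally_le_locally_norm (V := C_NormedModule)).
      exists eps. intros y Hy. exact Hy. }
    destruct (H _ HP) as [n0 Hn0]. exists n0. intros n Hn.
    rewrite Rminus_0_r, Rabs_pos_eq by apply Cmod_ge_0. exact (Hn0 n Hn).
Qed.

Lemma is_Cseries_iff (u : nat -> C) (l : C) :
  is_series u l <-> Clim (sum_n u) l.
Proof. symmetry. apply Clim_iff. Qed.

Lemma Clim_unique (u : nat -> C) (l l' : C) : Clim u l -> Clim u l' -> l = l'.
Proof.
  intros H H'. assert (E : Cmod (l - l')%C = 0).
  { apply Rle_antisym; [|apply Cmod_ge_0].
    assert (K : Rbar_le (Cmod (l - l')%C) (0 + 0)).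
    { apply is_lim_seq_le with (fun _ : nat => Cmod (l - l')%C)
        (fun n => Cmod (u n - l)%C + Cmod (u n - l')%C).
      - intro n. rewrite <- (Cmod_opp (u n - l)%C).
        replace (l - l')%C with (- (u n - l) + (u n - l'))%C by ring.
        apply Cmod_triangle.
      - apply is_lim_seq_const.
      - apply is_lim_seq_plus'; assumption. }
    simpl in K. lra. }
  apply Cmod_eq_0 in E. replace l with ((l - l') + l')%C by ring.
  rewrite E. ring.
Qed.

Lemma is_Cseries_unique (u : nat -> C) (l l' : C) :
  is_series u l -> is_series u l' -> l = l'.
Proof. rewrite !is_Cseries_iff. apply Clim_unique. Qed.

Lemma Clim_Cmod_le (u : nat -> C) (l : C) (M : R) (n0 : nat) :
  Clim u l -> (forall n, (n0 <= n)%nat -> Cmod (u n) <= M) -> Cmod l <= M.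
Proof.
  intros H HM.
  assert (K : Rbar_le (Cmod l) (0 + M)).
  { apply is_lim_seq_le_loc with (fun _ : nat => Cmod l)
      (fun n => Cmod (u n - l)%C + M).
    - exists n0. intros n Hn. specialize (HM n Hn).
      rewrite <- (Cmod_opp (u n - l)%C).
      apply Rle_trans with (Cmod (- (u n - l))%C + Cmod (u n)); [|lra].
      replace l with (- (u n - l) + u n)%C at 1 by ring. apply Cmod_triangle.
    - apply is_lim_seq_const.
    - apply is_lim_seq_plus'; [exact H|apply is_lim_seq_const]. }
  simpl in K. lra.
Qed.

Lemma Cmod_minus_sym (a b : C) : Cmod (a - b)%C = Cmod (b - a)%C.
Proof. rewrite <- Cmod_opp. f_equal. ring. Qed.

Lemma Clim_const (l : C) : Clim (fun _ => l) l.
Proof.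
  unfold Clim. apply is_lim_seq_ext with (fun _ => 0).
  - intro n. replace (l - l)%C with (RtoC 0) by ring. now rewrite Cmod_0.
  - apply is_lim_seq_const.
Qed.

Lemma Clim_ext (u v : nat -> C) (l : C) :
  (forall n, u n = v n) -> Clim u l -> Clim v l.
Proof.
  intros E. apply is_lim_seq_ext. intro n. now rewrite E.
Qed.

Lemma Clim_eq (u : nat -> C) (a b : C) : Clim u a -> a = b -> Clim u b.
Proof. now intros H <-. Qed.

Lemma Clim_plus (u v : nat -> C) (a b : C) :
  Clim u a -> Clim v b -> Clim (fun n => u n + v n)%C (a + b)%C.
Proof.
  intros Ha Hb. unfold Clim.
  apply squeeze_0 with (fun n => Cmod (u n - a)%C + Cmod (v n - b)%C).
  - intro n. split; [apply Cmod_ge_0|].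
    replace (u n + v n - (a + b))%C with ((u n - a) + (v n - b))%C by ring.
    apply Cmod_triangle.
  - replace 0 with (0 + 0) by ring. apply is_lim_seq_plus'; assumption.
Qed.

Lemma Clim_scal (c : C) (u : nat -> C) (a : C) :
  Clim u a -> Clim (fun n => c * u n)%C (c * a)%C.
Proof.
  intros Ha. unfold Clim.
  apply is_lim_seq_ext with (fun n => Cmod c * Cmod (u n - a)%C).
  - intro n. rewrite <- Cmod_mult. f_equal. ring.
  - replace 0 with (Cmod c * 0) by ring.
    apply is_lim_seq_mult'; [apply is_lim_seq_const|assumption].
Qed.

Lemma Clim_opp (u : nat -> C) (a : C) :
  Clim u a -> Clim (fun n => - u n)%C (- a)%C.
Proof.
  intros H. apply Clim_ext with (fun n => (- (1)) * u n)%C.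
  - intro n. ring.
  - replace (- a)%C with ((- (1)) * a)%C by ring. now apply Clim_scal.
Qed.

Lemma Clim_minus (u v : nat -> C) (a b : C) :
  Clim u a -> Clim v b -> Clim (fun n => u n - v n)%C (a - b)%C.
Proof.
  intros Ha Hb. apply (Clim_plus u (fun n => - v n)%C); auto. now apply Clim_opp.
Qed.

Lemma Clim_RtoC (u : nat -> R) (l : R) :
  is_lim_seq u l -> Clim (fun n => RtoC (u n)) (RtoC l).
Proof.
  intro H. unfold Clim.
  apply is_lim_seq_ext with (fun n => Rabs (u n - l)).
  - intro n. rewrite <- RtoC_minus, Cmod_R. reflexivity.
  - replace (Finite 0) with (Rbar_abs (l - l)).
    + apply is_lim_seq_abs.
      apply is_lim_seq_minus'; [assumption|apply is_lim_seq_const].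
    + simpl. f_equal. replace (l - l) with 0 by ring. apply Rabs_R0.
Qed.

Lemma Clim_sum_n (u : nat -> nat -> C) (l : nat -> C) (N : nat) :
  (forall k, (k <= N)%nat -> Clim (fun n => u n k) (l k)) ->
  Clim (fun n => sum_n (u n) N) (sum_n l N).
Proof.
  induction N; intro H.
  - rewrite sum_O. apply Clim_ext with (fun n => u n 0%nat).
    + intro n. now rewrite sum_O.
    + now apply H.
  - rewrite sum_Sn. apply Clim_ext with (fun n => (sum_n (u n) N + u n (S N))%C).
    + intro n. now rewrite sum_Sn.
    + apply Clim_plus; [apply IHN; intros; apply H; lia|apply H; lia].
Qed.

Lemma Cmod_sum_n (u : nat -> C) (n : nat) :
  Cmod (sum_n u n) <= sum_n (fun k => Cmod (u k)) n.
Proof.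
  induction n.
  - rewrite !sum_O. lra.
  - rewrite !sum_Sn. eapply Rle_trans; [apply Cmod_triangle|].
    apply Rplus_le_compat_r, IHn.
Qed.

Lemma Csum_n_mult_l (c : C) (u : nat -> C) (n : nat) :
  sum_n (fun k => c * u k)%C n = (c * sum_n u n)%C.
Proof. apply (sum_n_mult_l (K := C_Ring)). Qed.

Lemma is_Cseries_scal (c : C) (u : nat -> C) (l : C) :
  is_series u l -> is_series (fun k => c * u k)%C (c * l)%C.
Proof. apply (is_series_scal (V := C_NormedModule) c). Qed.

Lemma is_Cseries_plus (u v : nat -> C) (a b : C) :
  is_series u a -> is_series v b -> is_series (fun k => u k + v k)%C (a + b)%C.
Proof. apply (is_series_plus (V := C_NormedModule)). Qed.

Lemma is_Cseries_minus (u v : nat -> C) (a b : C) :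
  is_series u a -> is_series v b -> is_series (fun k => u k - v k)%C (a - b)%C.
Proof. apply (is_series_minus (V := C_NormedModule)). Qed.

Lemma is_Cseries_ext (u v : nat -> C) (a : C) :
  (forall k, u k = v k) -> is_series u a -> is_series v a.
Proof. apply (is_series_ext (V := C_NormedModule)). Qed.

Lemma is_Cseries_0 : is_series (fun _ : nat => RtoC 0) (RtoC 0).
Proof.
  apply is_Cseries_iff. apply Clim_ext with (fun _ => RtoC 0).
  - intro n. induction n; [now rewrite sum_O|].
    rewrite sum_Sn, <- IHn. change (RtoC 0 = 0 + 0)%C. ring.
  - apply Clim_const.
Qed.

Lemma is_Cseries_sum_n (u : nat -> nat -> C) (a : nat -> C) (N : nat) :
  (forall i, (i <= N)%nat -> is_series (u i) (a i)) ->
  is_series (fun k => sum_n (fun i => u i k) N) (sum_n a N).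
Proof.
  induction N; intro H.
  - rewrite sum_O. apply is_Cseries_ext with (u 0%nat).
    + intro. now rewrite sum_O.
    + now apply H.
  - rewrite sum_Sn.
    apply is_Cseries_ext with (fun k => (sum_n (fun i => u i k) N + u (S N) k)%C).
    + intro. now rewrite sum_Sn.
    + apply is_Cseries_plus; [apply IHN; intros; apply H; lia|apply H; lia].
Qed.

Lemma is_Cseries_abs (u : nat -> C) (M : nat -> R) :
  (forall k, Cmod (u k) <= M k) -> ex_series M ->
  exists l, is_series u l /\ Cmod l <= Series M.
Proof.
  intros Hu HM.
  destruct (ex_series_le (V := C_CompleteNormedModule) u M) as [l Hl]; auto.
  exists l. split; [exact Hl|].
  assert (Hl' := proj1 (is_Cseries_iff u l) Hl).
  apply Clim_Cmod_le with (sum_n u) 0%nat; auto.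
  intros n _. eapply Rle_trans; [apply Cmod_sum_n|].
  apply Rle_trans with (sum_n M n).
  - now apply sum_n_m_le.
  - apply (is_lim_seq_incr_compare (sum_n M)).
    + apply Series_correct, HM.
    + intro k. rewrite sum_Sn. unfold plus; simpl.
      generalize (Cmod_ge_0 (u (S k))) (Hu (S k)). lra.
Qed.

Lemma is_Cseries_Re (u : nat -> C) (l : C) :
  is_series u l -> is_series (fun k => Re (u k)) (Re l).
Proof.
  rewrite is_Cseries_iff. intro H.
  assert (E : forall n, sum_n (fun k => Re (u k)) n = Re (sum_n u n)).
  { intro n. induction n; [now rewrite !sum_O|].
    rewrite !sum_Sn, IHn. reflexivity. }
  apply (filterlim_ext (fun n => Re (sum_n u n))); [now intro; rewrite E|].
  change (is_lim_seq (fun n => Re (sum_n u n)) (Re l)).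
  apply is_lim_seq_spec. intro eps. apply is_lim_seq_spec in H.
  destruct (H eps) as [n0 Hn]. exists n0. intros n Hle. specialize (Hn n Hle).
  rewrite Rminus_0_r, Rabs_pos_eq in Hn by apply Cmod_ge_0.
  eapply Rle_lt_trans; [|exact Hn].
  change (Re (sum_n u n) - Re l) with (Re (sum_n u n - l)%C). apply re_le_Cmod.
Qed.

Lemma is_Cseries_incr_n (u : nat -> C) (l : C) (n : nat) :
  is_series u l ->
  is_series (fun k => u (S n + k)%nat) (l - sum_n u n)%C.
Proof.
  intro H. apply (is_series_incr_n (V := C_NormedModule)); [lia|].
  simpl pred. apply (eq_ind l (fun t => is_series u t) H).
  change (l = l - sum_n u n + sum_n u n)%C. ring.
Qed.

Lemma Series_tail_lim (M : nat -> R) :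
  ex_series M -> is_lim_seq (fun n => Series (fun k => M (S n + k)%nat)) 0.
Proof.
  intros H. apply is_lim_seq_ext with (fun n => Series M - sum_n M n).
  - intro n. rewrite (Series_incr_n M (S n)) by (auto; lia).
    simpl pred. rewrite sum_n_Reals. ring.
  - replace 0 with (Series M - Series M) by ring.
    apply is_lim_seq_minus'; [apply is_lim_seq_const|].
    apply Series_correct, H.
Qed.

Lemma tail_bound (u : nat -> C) (l : C) (M : nat -> R) (n : nat) :
  (forall k, Cmod (u k) <= M k) -> ex_series M -> is_series u l ->
  Cmod (l - sum_n u n)%C <= Series (fun k => M (S n + k)%nat).
Proof.
  intros Hu HM Hl.
  destruct (is_Cseries_abs (fun k => u (S n + k)%nat) (fun k => M (S n + k)%nat))
    as [l' [Hl' Hb]].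
  - intro k. apply Hu.
  - now apply (ex_series_incr_n M (S n)).
  - rewrite (is_Cseries_unique _ _ _ (is_Cseries_incr_n u l n Hl) Hl').
    exact Hb.
Qed.

(** Dominated convergence for series: cut where the tail of [M] falls below [eps / 4]. Both tails
    are then small for all [n >= n0] at once, and only finitely many terms have to converge. The
    start [n0] is there because the intended terms contain [u / m], for which the bound is available
    only when [m >= 1]. *)
Lemma tannery (u : nat -> nat -> C) (v : nat -> C) (U : nat -> C) (V : C)
  (M : nat -> R) (n0 : nat) :
  ex_series M ->
  (forall n k, (n0 <= n)%nat -> Cmod (u n k) <= M k) ->
  (forall k, Clim (fun n => u n k) (v k)) ->
  (forall n, (n0 <= n)%nat -> is_series (u n) (U n)) ->
  is_series v V -> Clim U V.
Proof.
  intros HM Hb Hlim HU HV.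
  assert (Hv : forall k, Cmod (v k) <= M k).
  { intro k. apply Clim_Cmod_le with (fun n => u n k) n0; auto. }
  apply is_lim_seq_0_eps; [intro; apply Cmod_ge_0|]. intros eps Heps.
  generalize (Series_tail_lim M HM). intro HT. apply is_lim_seq_spec in HT.
  assert (He : 0 < eps / 4) by lra.
  destruct (HT (mkposreal _ He)) as [N HN]. specialize (HN N (le_n N)).
  simpl in HN. rewrite Rminus_0_r in HN.
  generalize (Rle_abs (Series (fun k => M (S (N + k))))). intro HN'.
  generalize (Clim_sum_n u v N (fun k _ => Hlim k)). intro HS.
  apply is_lim_seq_spec in HS. destruct (HS (mkposreal _ He)) as [n1 Hn1].
  simpl in Hn1. exists (max n0 n1). intros n Hn.
  assert (A := tail_bound (u n) (U n) M N (fun k => Hb n k ltac:(lia)) HM (HU n ltac:(lia))).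
  assert (B := tail_bound v V M N Hv HM HV).
  specialize (Hn1 n ltac:(lia)).
  rewrite Rminus_0_r, Rabs_pos_eq in Hn1 by apply Cmod_ge_0.
  simpl in A, B.
  replace (U n - V)%C with
    ((U n - sum_n (u n) N) + ((sum_n (u n) N - sum_n v N) + - (V - sum_n v N)))%C
    by ring.
  eapply Rle_trans; [apply Cmod_triangle|].
  eapply Rle_trans; [apply Rplus_le_compat_l, Cmod_triangle|].
  rewrite Cmod_opp. lra.
Qed.

Lemma Clim_Cmod (u : nat -> C) (l : C) :
  Clim u l -> is_lim_seq (fun n => Cmod (u n)) (Cmod l).
Proof.
  intro H. apply is_lim_seq_le_le with
    (fun n => Cmod l - Cmod (u n - l)%C) (fun n => Cmod l + Cmod (u n - l)%C).
  - intro n. generalize (Cmod_triangle l (u n - l)%C) (Cmod_triangle (u n) (l - u n)%C).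
    rewrite (Cmod_minus_sym l). replace (l + (u n - l))%C with (u n) by ring.
    replace (u n + (l - u n))%C with l by ring. lra.
  - replace (Cmod l) with (Cmod l - 0) at 1 by ring.
    apply is_lim_seq_minus'; [apply is_lim_seq_const|exact H].
  - replace (Cmod l) with (Cmod l + 0) at 1 by ring.
    apply is_lim_seq_plus'; [apply is_lim_seq_const|exact H].
Qed.

Lemma Clim_Re (u : nat -> C) (l : C) :
  Clim u l -> is_lim_seq (fun n => Re (u n)) (Re l).
Proof.
  intro H. apply is_lim_seq_le_le with
    (fun n => Re l - Cmod (u n - l)%C) (fun n => Re l + Cmod (u n - l)%C).
  - intro n. generalize (re_le_Cmod (u n - l)%C). 
    change (Re (u n - l)%C) with (Re (u n) - Re l). intro K.
    apply Rabs_le_between in K. lra.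
  - replace (Re l) with (Re l - 0) at 1 by ring.
    apply is_lim_seq_minus'; [apply is_lim_seq_const|exact H].
  - replace (Re l) with (Re l + 0) at 1 by ring.
    apply is_lim_seq_plus'; [apply is_lim_seq_const|exact H].
Qed.

(** * Cauchy's estimate by means over roots of unity *)

Definition cis (t : R) : C := (cos t, sin t).

Lemma cis_plus (a b : R) : cis (a + b) = (cis a * cis b)%C.
Proof.
  unfold cis. rewrite cos_plus, sin_plus. unfold Cmult; simpl. f_equal; ring.
Qed.

Lemma cis_0 : cis 0 = 1.
Proof. unfold cis. now rewrite cos_0, sin_0. Qed.

Lemma cis_pow (t : R) (n : nat) : (cis t ^ n)%C = cis (INR n * t).
Proof.
  induction n.
  - rewrite Rmult_0_l, cis_0. reflexivity.
  - rewrite Cpow_S, IHn, <- cis_plus, S_INR. f_equal. ring.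
Qed.

Lemma Cmod_cis (t : R) : Cmod (cis t) = 1.
Proof.
  unfold Cmod, cis; simpl. rewrite !Rmult_1_r.
  generalize (sin2_cos2 t). unfold Rsqr. intro K.
  rewrite <- sqrt_1. f_equal. lra.
Qed.

Lemma cis_2PI (k : nat) : cis (2 * INR k * PI) = 1.
Proof.
  unfold cis. rewrite <- (Rplus_0_l (2 * INR k * PI)).
  rewrite cos_period, sin_period, cos_0, sin_0. reflexivity.
Qed.

Lemma cis_opp_2PI (k : nat) : cis (- (2 * INR k * PI)) = 1.
Proof.
  assert (K := cis_2PI k). unfold cis in *. rewrite cos_neg, sin_neg.
  injection K as K1 K2. rewrite K1, K2, Ropp_0. reflexivity.
Qed.

(** [1 - cos t = 2 sin (t / 2) ^ 2], and the sine is positive on [(0, PI)]. *)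
Lemma cis_neq_1 (t : R) : 0 < Rabs t < 2 * PI -> cis t <> 1.
Proof.
  intros Ht E. injection E as E _.
  replace t with (2 * (t / 2)) in E by field. rewrite cos_2a_sin in E.
  assert (S : sin (t / 2) = 0) by nra.
  assert (S' : sin (Rabs t / 2) = 0).
  { destruct (Rle_dec 0 t).
    - now rewrite Rabs_pos_eq.
    - rewrite Rabs_left by lra. replace (- t / 2) with (- (t / 2)) by field.
      rewrite sin_neg. lra. }
  assert (0 < sin (Rabs t / 2)) by (apply sin_gt_0; lra). lra.
Qed.

Lemma geom_sum (z : C) (n : nat) :
  ((1 - z) * sum_n (fun l => z ^ l) n)%C = (1 - z ^ S n)%C.
Proof.
  induction n.
  - rewrite sum_O. change ((1 - z) * 1 = 1 - z * 1)%C. ring.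
  - rewrite sum_Sn. change (plus (sum_n (fun l => z ^ l)%C n) (z ^ S n)%C)
      with (sum_n (fun l => z ^ l) n + z ^ S n)%C.
    rewrite Cmult_plus_distr_l, IHn, !Cpow_S. ring.
Qed.

Lemma Cpow_lim_0 (z : C) : Cmod z < 1 -> Clim (fun n => z ^ S n)%C 0.
Proof.
  intro Hz. unfold Clim.
  apply is_lim_seq_ext with (fun n => Cmod z ^ S n).
  - intro n. rewrite <- Cmod_pow. f_equal. ring.
  - apply is_lim_seq_incr_1 with (u := fun n => Cmod z ^ n).
    apply is_lim_seq_geom. rewrite Rabs_pos_eq; auto using Cmod_ge_0.
Qed.

Lemma one_minus_neq_0 (z : C) : Cmod z < 1 -> (1 - z)%C <> 0.
Proof.
  intros Hz E. assert (z = 1) by (replace z with (1 - (1 - z))%C by ring; rewrite E; ring).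
  subst z. rewrite Cmod_1 in Hz. lra.
Qed.

Lemma is_Cseries_geom (z : C) :
  Cmod z < 1 -> is_series (fun l => z ^ l)%C (/ (1 - z))%C.
Proof.
  intro Hz. apply is_Cseries_iff.
  assert (Hn := one_minus_neq_0 z Hz).
  apply Clim_ext with (fun n => / (1 - z) * (1 - z ^ S n))%C.
  - intro n. rewrite <- geom_sum. Cfield. exact Hn.
  - apply Clim_eq with (/ (1 - z) * (1 - 0))%C; [|field; exact Hn].
    apply Clim_scal, Clim_minus; [apply Clim_const|now apply Cpow_lim_0].
Qed.

(** Orthogonality of the characters of the cyclic group of order [L' + 1]. Both indices are at most
    [L'], so distinct ones are not congruent modulo [L' + 1], and the geometric sum has a ratio
    other than 1. *)
Lemma roots_of_unity_sum (L' l m : nat) :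
  (l <= L')%nat -> (m <= L')%nat ->
  sum_n (fun j => cis ((INR l - INR m) * (2 * INR j * PI / INR (S L')))) L'
  = if Nat.eq_dec l m then RtoC (INR (S L')) else RtoC 0.
Proof.
  intros Hl Hm. destruct (Nat.eq_dec l m) as [->|Hlm].
  - rewrite (sum_n_ext _ (fun _ => RtoC 1)).
    + clear. assert (forall n, sum_n (fun _ : nat => RtoC 1) n = RtoC (INR (S n))) as ->; auto.
      intro n. induction n; [now rewrite sum_O|].
      rewrite sum_Sn, IHn, (S_INR (S n)), RtoC_plus. reflexivity.
    + intro j. rewrite Rminus_diag, Rmult_0_l. apply cis_0.
  - assert (HL : 0 < INR (S L')) by (apply lt_0_INR; lia).
    set (z := cis ((INR l - INR m) * (2 * PI / INR (S L')))).
    rewrite (sum_n_ext _ (fun j => z ^ j)%C).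
    + assert (Hz : (1 - z)%C <> 0).
      { intro E. assert (Ez : z = 1).
        { replace z with (1 - (1 - z))%C by ring. rewrite E. ring. }
        revert Ez. apply cis_neq_1.
        assert (A : 1 <= Rabs (INR l - INR m) < INR (S L')).
        { assert (Hb : INR l <= INR L' /\ INR m <= INR L') by (split; now apply le_INR).
          rewrite S_INR. generalize (pos_INR l) (pos_INR m). intros.
          destruct (Nat.lt_total l m) as [Q|[Q|Q]]; [|lia|].
          - apply le_INR in Q. rewrite S_INR in Q. rewrite Rabs_left by lra. lra.
          - apply le_INR in Q. rewrite S_INR in Q. rewrite Rabs_pos_eq by lra. lra. }
        generalize PI_RGT_0. intro HPI.
        rewrite Rabs_mult, (Rabs_pos_eq (2 * PI / _)).
        2:{ apply Rlt_le, Rdiv_lt_0_compat; lra. }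
        assert (B : 0 < 2 * PI / INR (S L')) by (apply Rdiv_lt_0_compat; lra).
        split; [apply Rmult_lt_0_compat; lra|].
        apply Rlt_le_trans with (INR (S L') * (2 * PI / INR (S L'))).
        - apply Rmult_lt_compat_r; lra.
        - right. field. lra. }
      assert (E := geom_sum z L').
      assert (E1 : (z ^ S L')%C = 1).
      { unfold z. rewrite cis_pow.
        replace (INR (S L') * ((INR l - INR m) * (2 * PI / INR (S L'))))
          with (2 * INR l * PI + - (2 * INR m * PI)) by (field; lra).
        rewrite cis_plus, cis_2PI, cis_opp_2PI. ring. }
      rewrite E1 in E.
      replace (sum_n (fun j => z ^ j)%C L') with
        (/ (1 - z) * ((1 - z) * sum_n (fun j => z ^ j) L'))%C by (Cfield; exact Hz).
      rewrite E. Cring.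
    + intro j. unfold z. rewrite cis_pow. f_equal. field. lra.
Qed.

Definition root_pt (q : R) (L' j : nat) : C :=
  (q * cis (2 * INR j * PI / INR (S L')))%C.

Lemma Cmod_root_pt (q : R) (L' j : nat) : 0 <= q -> Cmod (root_pt q L' j) = q.
Proof.
  intro Hq. unfold root_pt. rewrite Cmod_mult, Cmod_cis, Cmod_R, Rabs_pos_eq by auto.
  ring.
Qed.

(** Riemann sum, over [L' + 1] equidistant points of the circle of radius [q], of Cauchy's integral
    for the [m]-th coefficient, scaled by [q ^ m]. *)
Definition circle_mean (H : C -> C) (q : R) (m L' : nat) : C :=
  (/ INR (S L') * sum_n (fun j => H (root_pt q L' j)
      * cis (- (INR m * (2 * INR j * PI / INR (S L'))))) L')%C.

(** Averaging term by term, orthogonality keeps the single index [m] among all [l <= L']. The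
    aliased terms that remain have [l > L'] and are bounded by the tail of an absolutely convergent
    series. *)
Lemma circle_mean_lim (H : C -> C) (h : nat -> C) (q : R) (m : nat) :
  0 <= q ->
  ex_series (fun l => Cmod (h l) * q ^ l) ->
  (forall v, Cmod v = q -> is_series (fun l => h l * v ^ l)%C (H v)) ->
  Clim (circle_mean H q m) (h m * q ^ m)%C.
Proof.
  intros Hq Hex HH.
  set (M := fun l => Cmod (h l) * q ^ l).
  apply squeeze_0_loc with (fun L' => Series (fun k => M (S L' + k)%nat)) m.
  2:{ apply Series_tail_lim, Hex. }
  intros L' HL. split; [apply Cmod_ge_0|].
  assert (HS : 0 < INR (S L')) by (apply lt_0_INR; lia).
  assert (HSC : RtoC (INR (S L')) <> 0) by (intro E0; apply RtoC_inj in E0; lra).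
  set (T := fun l => (/ INR (S L') * sum_n (fun j => h l * q ^ l
    * cis ((INR l - INR m) * (2 * INR j * PI / INR (S L')))) L')%C).
  assert (HT : is_series T (circle_mean H q m L')).
  { unfold T, circle_mean. apply is_Cseries_scal.
    apply (is_Cseries_sum_n (fun j l => h l * q ^ l
      * cis ((INR l - INR m) * (2 * INR j * PI / INR (S L'))))%C).
    intros j Hj. rewrite Cmult_comm.
    apply is_Cseries_ext with (fun l =>
      (cis (- (INR m * (2 * INR j * PI / INR (S L'))))
       * (h l * (root_pt q L' j) ^ l))%C).
    - intro l. unfold root_pt. rewrite Cpow_mult_l, cis_pow.
      replace ((INR l - INR m) * (2 * INR j * PI / INR (S L'))) with
        (INR l * (2 * INR j * PI / INR (S L')) +
         - (INR m * (2 * INR j * PI / INR (S L')))) by ring.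
      rewrite (cis_plus (INR l * _)). ring.
    - apply is_Cseries_scal. apply HH. now apply Cmod_root_pt. }
  assert (HTb : forall l, Cmod (T l) <= M l).
  { intro l. unfold T, M.
    rewrite Csum_n_mult_l, !Cmod_mult, Cmod_inv by exact HSC.
    rewrite <- RtoC_pow, !Cmod_R, (Rabs_pos_eq (INR _)), (Rabs_pos_eq (q ^ l)); try lra.
    2:{ now apply pow_le. }
    assert (A : Cmod (sum_n (fun j => cis ((INR l - INR m) *
      (2 * INR j * PI / INR (S L')))) L') <= INR (S L')).
    { eapply Rle_trans; [apply Cmod_sum_n|].
      rewrite (sum_n_ext _ (fun _ => 1)) by (intro; apply Cmod_cis).
      rewrite sum_n_const. lra. }
    apply Rle_trans with (/ INR (S L') * (Cmod (h l) * q ^ l * INR (S L'))).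
    - apply Rmult_le_compat_l; [apply Rlt_le, Rinv_0_lt_compat, HS|].
      apply Rmult_le_compat_l; [|exact A].
      apply Rmult_le_pos; [apply Cmod_ge_0|now apply pow_le].
    - right. field. lra. }
  assert (HTs : forall n, (n <= L')%nat ->
    sum_n T n = if Compare_dec.le_dec m n then (h m * q ^ m)%C else RtoC 0).
  { assert (HTl : forall l, (l <= L')%nat ->
      T l = if Nat.eq_dec l m then (h m * q ^ m)%C else RtoC 0).
    { intros l Hl. unfold T. rewrite Csum_n_mult_l.
      rewrite roots_of_unity_sum by lia.
      destruct (Nat.eq_dec l m) as [->|]; [field; exact HSC|ring]. }
    induction n; intro Hn.
    - rewrite sum_O, HTl by lia. destruct (Nat.eq_dec 0 m), (Compare_dec.le_dec m 0); try lia; auto.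
    - rewrite sum_Sn, IHn, HTl by lia.
      destruct (Compare_dec.le_dec m n), (Nat.eq_dec (S n) m), (Compare_dec.le_dec m (S n));
        try lia; [apply (Cplus_0_r (h m * q ^ m)%C)|apply (Cplus_0_l (h m * q ^ m)%C)|
        apply (Cplus_0_l 0)]. }
  rewrite Cmod_minus_sym, Cmod_minus_sym.
  specialize (HTs L' (le_n L')). destruct (Compare_dec.le_dec m L'); [|lia].
  rewrite <- HTs. apply tail_bound; auto.
Qed.

(** [2 / (1 - v) - 1 = (1 + v) / (1 - v)] has real part [(1 - |v| ^ 2) / |1 - v| ^ 2]. In this form
    the mean of the kernel is read off the constant coefficient of [1 / (1 - v)]. *)
Lemma poisson_kernel (v : C) (q : R) :
  0 <= q < 1 -> Cmod v = q ->
  / Cmod (1 - v)%C ^ 2 = (2 * Re (/ (1 - v))%C - 1) / (1 - q ^ 2).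
Proof.
  intros Hq Hv.
  assert (Hn : (1 - v)%C <> 0) by (apply one_minus_neq_0; lra).
  apply Cmod_gt_0 in Hn. rewrite <- Hv. 
  assert (Hn2 : 0 < Cmod (1 - v)%C ^ 2) by (apply pow_lt; lra).
  assert (0 < 1 - Cmod v ^ 2) by nra.
  revert Hn2 H. rewrite !Cmod2_alt. destruct v as [a b]. 
  unfold Cinv, Re, Im; simpl. intros.
  field. split; lra.
Qed.

Lemma cauchy_estimate (H : C -> C) (h : nat -> C) (q K : R) (m : nat) :
  0 < q < 1 ->
  ex_series (fun l => Cmod (h l) * q ^ l) ->
  (forall v, Cmod v = q -> is_series (fun l => h l * v ^ l)%C (H v)) ->
  (forall v, Cmod v = q -> Cmod (H v) <= K / Cmod (1 - v)%C ^ 2) ->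
  Cmod (h m) * q ^ m <= K / (1 - q ^ 2).
Proof.
  intros Hq Hex HH Hb.
  set (G := fun v : C => (/ (1 - v))%C).
  (* The constant coefficient of [G] is 1, so the means of [2 Re G - 1], the Poisson kernel, tend to
     1. *)
  assert (HG : Clim (circle_mean G q 0) (1 * q ^ 0)%C).
  { apply (circle_mean_lim G (fun _ => RtoC 1)); [lra| |].
    - apply ex_series_ext with (fun l => q ^ l).
      + intro. rewrite Cmod_1. Rring.
      + apply ex_series_geom. rewrite Rabs_pos_eq; lra.
    - intros v Hv. apply is_Cseries_ext with (fun l => v ^ l)%C.
      + intro. Cring.
      + apply is_Cseries_geom. lra. }
  assert (HM := Clim_Cmod _ _ (circle_mean_lim H h q m (Rlt_le _ _ (proj1 Hq)) Hex HH)).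
  apply Clim_Re in HG.
  assert (Q : Rbar_le (Cmod (h m * q ^ m)%C)
    (K / (1 - q ^ 2) * (2 * Re (1 * q ^ 0)%C - 1))).
  { apply is_lim_seq_le with (2 := HM)
      (v := fun L' => K / (1 - q ^ 2) * (2 * Re (circle_mean G q 0 L') - 1)).
    2:{ apply is_lim_seq_mult'; [apply is_lim_seq_const|].
        apply is_lim_seq_minus'; [|apply is_lim_seq_const].
        apply is_lim_seq_mult'; [apply is_lim_seq_const|exact HG]. }
    intro L'. unfold circle_mean.
    assert (HS : 0 < INR (S L')) by (apply lt_0_INR; lia).
    assert (HSC : RtoC (INR (S L')) <> 0) by (intro E0; apply RtoC_inj in E0; lra).
    rewrite Cmod_mult, Cmod_inv, Cmod_R, Rabs_pos_eq by (auto; lra).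
    apply Rle_trans with (/ INR (S L') * sum_n (fun j =>
      K / (1 - q ^ 2) * (2 * Re (G (root_pt q L' j)) - 1)) L').
    - apply Rmult_le_compat_l; [apply Rlt_le, Rinv_0_lt_compat, HS|].
      eapply Rle_trans; [apply Cmod_sum_n|].
      apply sum_n_m_le. intro j. rewrite Cmod_mult, Cmod_cis, Rmult_1_r.
      eapply Rle_trans; [apply Hb; apply Cmod_root_pt; lra|].
      unfold Rdiv. rewrite (poisson_kernel _ q); [|lra|apply Cmod_root_pt; lra].
      unfold G. right. field. nra.
    - right. rewrite (sum_n_mult_l (K := R_Ring)). change (@mult R_Ring) with Rmult.
      assert (E : forall f : nat -> C, forall n,
         sum_n (fun j => 2 * Re (f j) - 1) n
         = 2 * Re (sum_n (fun j => f j * cis (- (INR 0 * (2 * INR j * PI / INR (S L')))))%C n)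
           - INR (S n)).
      { intros f n.
        rewrite (sum_n_ext (fun j => f j * _)%C f).
        2:{ intro j. replace (- (INR 0 * (2 * INR j * PI / INR (S L')))) with 0 by (simpl; ring).
            rewrite cis_0. Cring. }
        induction n; [now rewrite !sum_O|].
        rewrite !sum_Sn, IHn, (S_INR (S n)).
        change (Re (plus (sum_n f n) (f (S n)))) with (Re (sum_n f n) + Re (f (S n))).
        change (@plus R_AbelianMonoid) with Rplus. Rring. }
      rewrite (E (fun j => G (root_pt q L' j))).
      set (Z := sum_n _ L').
      rewrite <- RtoC_inv by lra.
      replace (Re (RtoC (/ INR (S L')) * Z)%C) with (/ INR (S L') * Re Z).
      2:{ destruct Z as [za zb]. unfold Re, Cmult, RtoC. cbn [fst snd]. ring. }
      change (sum_n _ L') with Z.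
      field. split; [lra|nra]. }
  replace (2 * Re (1 * q ^ 0)%C - 1) with 1 in Q by (simpl; ring).
  rewrite Rmult_1_r in Q. simpl Rbar_le in Q.
  rewrite Cmod_mult, <- RtoC_pow, Cmod_R, Rabs_pos_eq in Q by (apply pow_le; lra).
  exact Q.
Qed.

(** * Binomial and logarithmic power series *)

(** Derivative in a real variable, by components. Identities between functions of [v] are proved
    along the segment [t v], [0 <= t <= 1], by showing that a derivative in [t] vanishes; real
    calculus is enough for this. *)
Definition is_Cderive (f : R -> C) (t : R) (l : C) : Prop :=
  is_derive (fun u => Re (f u)) t (Re l) /\ is_derive (fun u => Im (f u)) t (Im l).

Lemma is_derive_eq (f : R -> R) (t a b : R) : is_derive f t a -> a = b -> is_derive f t b.
Proof. now intros H <-. Qed.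

Lemma is_Cderive_eq (f : R -> C) (t : R) (a b : C) :
  is_Cderive f t a -> a = b -> is_Cderive f t b.
Proof. now intros H <-. Qed.

Lemma is_Cderive_plus (f g : R -> C) (t : R) (a b : C) :
  is_Cderive f t a -> is_Cderive g t b -> is_Cderive (fun u => f u + g u)%C t (a + b)%C.
Proof.
  intros [F1 F2] [G1 G2]; split.
  - now apply (is_derive_plus (fun u => Re (f u)) (fun u => Re (g u))).
  - now apply (is_derive_plus (fun u => Im (f u)) (fun u => Im (g u))).
Qed.

Lemma is_Cderive_mult (f g : R -> C) (t : R) (a b : C) :
  is_Cderive f t a -> is_Cderive g t b ->
  is_Cderive (fun u => f u * g u)%C t (a * g t + f t * b)%C.
Proof.
  intros [F1 F2] [G1 G2]; split.
  - apply is_derive_eq with (Re a * Re (g t) + Re (f t) * Re b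
        - (Im a * Im (g t) + Im (f t) * Im b)).
    + apply (is_derive_minus (fun u => Re (f u) * Re (g u)) (fun u => Im (f u) * Im (g u)));
        apply (is_derive_mult (K := R_AbsRing)); auto using Rmult_comm.
    + unfold Re, Im, Cmult, Cplus; cbn [fst snd]. ring.
  - apply is_derive_eq with ((Re a * Im (g t) + Re (f t) * Im b)
        + (Im a * Re (g t) + Im (f t) * Re b)).
    + apply (is_derive_plus (fun u => Re (f u) * Im (g u)) (fun u => Im (f u) * Re (g u)));
        apply (is_derive_mult (K := R_AbsRing)); auto using Rmult_comm.
    + unfold Re, Im, Cmult, Cplus; cbn [fst snd]. ring.
Qed.

Lemma is_Cderive_const (c : C) (t : R) : is_Cderive (fun _ => c) t 0.
Proof. split; [apply (is_derive_const (Re c) t)|apply (is_derive_const (Im c) t)]. Qed.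

Lemma is_Cderive_scal (c : C) (f : R -> C) (t : R) (a : C) :
  is_Cderive f t a -> is_Cderive (fun u => c * f u)%C t (c * a)%C.
Proof.
  intro H. eapply is_Cderive_eq.
  - apply (is_Cderive_mult (fun _ => c) f); [apply is_Cderive_const|exact H].
  - cbv beta. ring.
Qed.

Lemma is_Cderive_line (v : C) (t : R) : is_Cderive (fun u => 1 - RtoC u * v)%C t (- v)%C.
Proof.
  destruct v as [a b]. split; unfold Re, Im; cbn; auto_derive; auto; ring.
Qed.

Lemma Cderive_0_const (f : R -> C) (a b : R) :
  a < b -> (forall t, a <= t <= b -> is_Cderive f t 0) -> f b = f a.
Proof.
  intros Hab H.
  assert (E1 : Re (f a) = Re (f b)).
  { apply (eq_is_derive (fun u => Re (f u))); auto. intros t Ht. apply (H t Ht). }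
  assert (E2 : Im (f a) = Im (f b)).
  { apply (eq_is_derive (fun u => Im (f u))); auto. intros t Ht. apply (H t Ht). }
  destruct (f a), (f b); unfold Re, Im in *; simpl in *; subst; reflexivity.
Qed.

(* Principal logarithm on the right half-plane. *)
Definition RHlog (z : C) : C := (ln (Re z ^ 2 + Im z ^ 2) / 2, atan (Im z / Re z)).

Lemma is_derive_ln_norm (p r : R -> R) (t p' r' : R) :
  0 < p t ^ 2 + r t ^ 2 -> is_derive p t p' -> is_derive r t r' ->
  is_derive (fun u => ln (p u ^ 2 + r u ^ 2) / 2) t
    ((p t * p' + r t * r') / (p t ^ 2 + r t ^ 2)).
Proof.
  intros Hn H1 H2.
  assert (X1 : ex_derive p t) by (eexists; exact H1).
  assert (X2 : ex_derive r t) by (eexists; exact H2).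
  auto_derive; [repeat split; auto; lra|].
  rewrite (is_derive_unique (fun x : R => p x) _ _ H1), (is_derive_unique (fun x : R => r x) _ _ H2).
  field. lra.
Qed.

Lemma is_derive_atan_ratio (p r : R -> R) (t p' r' : R) :
  0 < p t -> is_derive p t p' -> is_derive r t r' ->
  is_derive (fun u => atan (r u / p u)) t
    ((r' * p t - r t * p') / (p t ^ 2 + r t ^ 2)).
Proof.
  intros Hp H1 H2.
  assert (X1 : ex_derive p t) by (eexists; exact H1).
  assert (X2 : ex_derive r t) by (eexists; exact H2).
  eapply is_derive_eq.
  - apply (is_derive_comp atan (fun u => r u / p u)); [apply is_derive_atan|].
    auto_derive; [repeat split; auto; lra|reflexivity].
  - rewrite (is_derive_unique (fun x : R => p x) _ _ H1), (is_derive_unique (fun x : R => r x) _ _ H2).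
    unfold scal; simpl. unfold mult; simpl. unfold Rsqr. field. repeat split; nra.
Qed.

Lemma is_Cderive_RHlog (g : R -> C) (t : R) (g' : C) :
  0 < Re (g t) -> is_Cderive g t g' -> is_Cderive (fun u => RHlog (g u)) t (g' / g t)%C.
Proof.
  intros Hp [H1 H2].
  assert (Hn : 0 < Re (g t) ^ 2 + Im (g t) ^ 2) by nra.
  split.
  - eapply is_derive_eq.
    + now apply (is_derive_ln_norm (fun u => Re (g u)) (fun u => Im (g u)) t (Re g') (Im g')).
    + cbv beta. destruct (g t) as [a b], g' as [c d].
      unfold Re, Im, Cdiv, Cinv, Cmult in *. cbn [fst snd] in *. field. lra.
  - eapply is_derive_eq.
    + now apply (is_derive_atan_ratio (fun u => Re (g u)) (fun u => Im (g u)) t (Re g') (Im g')).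
    + cbv beta. destruct (g t) as [a b], g' as [c d].
      unfold Re, Im, Cdiv, Cinv, Cmult in *. cbn [fst snd] in *. field. lra.
Qed.

Lemma is_Cderive_Cexp (g : R -> C) (t : R) (g' : C) :
  is_Cderive g t g' -> is_Cderive (fun u => Cexp (g u)) t (g' * Cexp (g t))%C.
Proof.
  intros [H1 H2]. set (p := fun u => Re (g u)) in *. set (r := fun u => Im (g u)) in *.
  assert (E1 := is_derive_unique (fun x : R => p x) _ _ H1).
  assert (E2 := is_derive_unique (fun x : R => r x) _ _ H2).
  assert (X1 : ex_derive p t) by (eexists; exact H1).
  assert (X2 : ex_derive r t) by (eexists; exact H2).
  split.
  - change (is_derive (fun u => exp (p u) * cos (r u)) t (Re (g' * Cexp (g t))%C)).
    auto_derive; [now auto|]. unfold p, r in *.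
    rewrite E1, E2. unfold Cexp, Re, Im, Cmult. cbn [fst snd]. ring.
  - change (is_derive (fun u => exp (p u) * sin (r u)) t (Im (g' * Cexp (g t))%C)).
    auto_derive; [now auto|]. unfold p, r in *.
    rewrite E1, E2. unfold Cexp, Re, Im, Cmult. cbn [fst snd]. ring.
Qed.

Lemma Cexp_plus (a b : C) : Cexp (a + b)%C = (Cexp a * Cexp b)%C.
Proof.
  destruct a as [a1 a2], b as [b1 b2]. unfold Cexp, Cmult, Cplus, Re, Im. cbn [fst snd].
  rewrite exp_plus, cos_plus, sin_plus. f_equal; ring.
Qed.

Lemma Cexp_0 : Cexp 0 = 1.
Proof. unfold Cexp; simpl. rewrite exp_0, cos_0, sin_0. unfold RtoC. f_equal; ring. Qed.

Lemma Cmod_Cexp (a : C) : Cmod (Cexp a) = exp (Re a).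
Proof.
  replace (Cexp a) with (RtoC (exp (Re a)) * cis (Im a))%C.
  - rewrite Cmod_mult, Cmod_cis, Cmod_R, Rabs_pos_eq; [ring|apply Rlt_le, exp_pos].
  - unfold Cexp, cis, Cmult, RtoC; cbn [fst snd]. f_equal; ring.
Qed.

Lemma Cexp_neq_0 (a : C) : Cexp a <> 0.
Proof. apply Cmod_gt_0. rewrite Cmod_Cexp. apply exp_pos. Qed.

Lemma Cexp_opp (a : C) : Cexp (- a)%C = (/ Cexp a)%C.
Proof.
  assert (E : (Cexp a * Cexp (- a))%C = 1).
  { rewrite <- Cexp_plus. replace (a + - a)%C with (RtoC 0) by ring. apply Cexp_0. }
  replace (/ Cexp a)%C with (/ Cexp a * (Cexp a * Cexp (- a)))%C by (rewrite E; ring).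
  field. apply Cexp_neq_0.
Qed.

Lemma Cexp_nat (n : nat) (a : C) : Cexp (RtoC (INR n) * a)%C = (Cexp a ^ n)%C.
Proof.
  induction n.
  - simpl INR. replace (RtoC 0 * a)%C with (RtoC 0) by ring. apply Cexp_0.
  - rewrite S_INR, Cpow_S, <- IHn, <- Cexp_plus. f_equal. rewrite RtoC_plus. ring.
Qed.

Lemma Cexp_RtoC (r : R) : Cexp (RtoC r) = RtoC (exp r).
Proof. unfold Cexp, RtoC; simpl. rewrite cos_0, sin_0. f_equal; ring. Qed.

Lemma RHlog_1 : RHlog 1 = 0.
Proof.
  unfold RHlog; simpl. replace (1 * (1 * 1) + 0 * (0 * 1)) with 1 by ring.
  rewrite ln_1. replace (0 / 1) with 0 by field. rewrite atan_0.
  unfold RtoC. f_equal; field.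
Qed.

Lemma Re_one_minus_pos (v : C) : Cmod v < 1 -> 0 < Re (1 - v)%C.
Proof.
  intro H. generalize (re_le_Cmod v). intro K. apply Rabs_le_between in K.
  change (0 < 1 - Re v). lra.
Qed.

Lemma Re_line_pos (v : C) (t : R) : Cmod v < 1 -> 0 <= t <= 1 -> 0 < Re (1 - t * v)%C.
Proof.
  intros H Ht. apply Re_one_minus_pos. rewrite Cmod_mult, Cmod_R, Rabs_pos_eq by lra.
  generalize (Cmod_ge_0 v). nra.
Qed.

Lemma Re_pos_neq_0 (z : C) : 0 < Re z -> z <> 0.
Proof. intros H E. rewrite E in H. simpl in H. lra. Qed.

(** The product [exp (- log (1 - t v)) (1 - t v)] has derivative 0 in [t] and equals 1 at
    [t = 0]. *)
Lemma Cexp_RHlog_one_minus (v : C) : Cmod v < 1 -> Cexp (RHlog (1 - v)%C) = (1 - v)%C.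
Proof.
  intro Hv.
  assert (E := Cderive_0_const
    (fun t : R => Cexp (- (1) * RHlog (1 - t * v)) * (1 - t * v))%C 0 1 Rlt_0_1).
  lapply E; clear E; [intro E|].
  2:{ intros t Ht.
    assert (Hp := Re_line_pos v t Hv Ht). eapply is_Cderive_eq.
    - apply is_Cderive_mult; [|apply is_Cderive_line].
      apply is_Cderive_Cexp, is_Cderive_scal, is_Cderive_RHlog; [exact Hp|].
      apply is_Cderive_line.
    - cbv beta. field. now apply Re_pos_neq_0. }
  cbv beta in E.
  replace (1 - RtoC 1 * v)%C with (1 - v)%C in E by ring.
  replace (1 - RtoC 0 * v)%C with (RtoC 1) in E by ring.
  rewrite RHlog_1 in E.
  replace (- (1) * 0)%C with (RtoC 0) in E by ring. rewrite Cexp_0 in E.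
  replace (- (1) * RHlog (1 - v))%C with (- RHlog (1 - v))%C in E by ring.
  rewrite Cexp_opp in E.
  assert (N := Cexp_neq_0 (RHlog (1 - v)%C)).
  replace (Cexp (RHlog (1 - v)%C)) with
    (Cexp (RHlog (1 - v)%C) * (/ Cexp (RHlog (1 - v)) * (1 - v)))%C.
  - field. exact N.
  - rewrite E. ring.
Qed.

Lemma is_Cseries_pair (u : nat -> C) (a b : R) :
  is_series (fun k => Re (u k)) a -> is_series (fun k => Im (u k)) b ->
  is_series u ((a, b) : C).
Proof.
  intros Ha Hb. apply is_Cseries_iff. unfold Clim.
  assert (E1 : forall n, Re (sum_n u n) = sum_n (fun k => Re (u k)) n).
  { intro n. induction n; [now rewrite !sum_O|]. rewrite !sum_Sn, <- IHn. reflexivity. }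
  assert (E2 : forall n, Im (sum_n u n) = sum_n (fun k => Im (u k)) n).
  { intro n. induction n; [now rewrite !sum_O|]. rewrite !sum_Sn, <- IHn. reflexivity. }
  apply squeeze_0 with (fun n => Rabs (sum_n (fun k => Re (u k)) n - a)
     + Rabs (sum_n (fun k => Im (u k)) n - b)).
  - intro n. split; [apply Cmod_ge_0|]. rewrite <- E1, <- E2.
    destruct (sum_n u n) as [c d]. unfold Re, Im; cbn [fst snd].
    replace ((c, d) - (a, b))%C with (RtoC (c - a) + RtoC (d - b) * Ci)%C.
    + eapply Rle_trans; [apply Cmod_triangle|].
      rewrite Cmod_mult, Cmod_Ci, !Cmod_R. lra.
    + unfold Cminus, RtoC, Ci, Cplus, Cmult, Copp; cbn [fst snd]. f_equal; ring.
  - assert (Q : forall (f : nat -> R) (l : R), is_lim_seq f l -> is_lim_seq (fun n => Rabs (f n - l)) 0).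
    { intros f l Hf. replace (Finite 0) with (Rbar_abs (l - l)).
      - apply is_lim_seq_abs, is_lim_seq_minus'; [exact Hf|apply is_lim_seq_const].
      - simpl. f_equal. rewrite Rminus_diag. apply Rabs_R0. }
    replace 0 with (0 + 0) by ring.
    apply is_lim_seq_plus'; apply Q; assumption.
Qed.

(* [binom_coef nu l] is [(nu)_l / l!], the coefficient of [v ^ l] in
   [(1 - v) ^ (- nu)]. *)
Fixpoint binom_coef (nu : R) (l : nat) : R :=
  match l with
  | O => 1
  | S l' => binom_coef nu l' * ((nu + INR l') / INR (S l'))
  end.

(** The logarithmic derivative of [binom_coef nu l] with respect to [nu]. *)
Fixpoint shifted_harmonic (nu : R) (l : nat) : R :=
  match l with
  | O => 0
  | S l' => shifted_harmonic nu l' + / (nu + INR l')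
  end.

Lemma binom_coef_pos (nu : R) (l : nat) : 0 < nu -> 0 < binom_coef nu l.
Proof.
  intro H. induction l; cbn [binom_coef]; [lra|].
  apply Rmult_lt_0_compat; auto. apply Rdiv_lt_0_compat.
  - generalize (pos_INR l). lra.
  - apply lt_0_INR. lia.
Qed.

Lemma is_lim_seq_shift_ratio (a b : R) :
  is_lim_seq (fun n => (a + INR n) / (b + INR n)) 1.
Proof.
  apply is_lim_seq_ext_loc with (fun n => 1 + (a - b) * / (b + INR n)).
  - assert (H : is_lim_seq (fun n => b + INR n) p_infty).
    { apply is_lim_seq_plus with (Finite b) p_infty;
        [apply is_lim_seq_const|apply is_lim_seq_INR|reflexivity]. }
    apply is_lim_seq_spec in H. destruct (H 0) as [N HN]. exists N.
    intros n Hn. specialize (HN n Hn). field. lra.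
  - replace (Finite 1) with (Finite (1 + (a - b) * 0)) by (f_equal; ring).
    apply is_lim_seq_plus'; [apply is_lim_seq_const|].
    apply is_lim_seq_mult'; [apply is_lim_seq_const|].
    replace (Finite 0) with (Rbar_inv p_infty) by reflexivity.
    apply is_lim_seq_inv; [|discriminate].
    apply is_lim_seq_plus with (Finite b) p_infty;
        [apply is_lim_seq_const|apply is_lim_seq_INR|reflexivity].
Qed.

Lemma ex_series_binom (nu q : R) :
  0 < nu -> 0 < q < 1 -> ex_series (fun l => binom_coef nu l * q ^ l).
Proof.
  intros Hn Hq.
  assert (Hpos : forall l, 0 < binom_coef nu l * q ^ l).
  { intro l. apply Rmult_lt_0_compat; [now apply binom_coef_pos|apply pow_lt; lra]. }
  apply ex_series_ext with (fun l => Rabs (binom_coef nu l * q ^ l)).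
  { intro l. apply Rabs_pos_eq, Rlt_le, Hpos. }
  apply ex_series_DAlembert with q; [lra| |].
  - intro l. specialize (Hpos l). lra.
  - apply is_lim_seq_ext with (fun n => q * ((nu + INR n) / (1 + INR n))).
    + intro n. generalize (pos_INR n) (binom_coef_pos nu n Hn) (pow_lt q n (proj1 Hq)).
      intros A B D. rewrite Rabs_pos_eq.
      * cbn [binom_coef pow]. rewrite S_INR. field. repeat split; lra.
      * apply Rlt_le, Rdiv_lt_0_compat; apply Hpos.
    + replace (Finite q) with (Finite (q * 1)) by (f_equal; ring).
      apply is_lim_seq_mult'; [apply is_lim_seq_const|apply is_lim_seq_shift_ratio].
Qed.

(** The radius has to exceed 1 strictly, so that term-by-term differentiation is available up to the
    endpoint [t = 1] of the segment. *)
Lemma CV_radius_gt_1 (c : nat -> R) (nu q : R) :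
  0 < nu -> 0 < q < 1 -> (forall l, Rabs (c l) <= binom_coef nu l * q ^ l) ->
  Rbar_lt 1 (CV_radius c).
Proof.
  intros Hn Hq Hc.
  (* Any [r > 1] with [q r < 1] would do: the coefficients times [r ^ l] are then bounded, so the
     radius is at least [r]. *)
  set (r := 2 / (1 + q)).
  assert (Hr : 1 < r).
  { unfold r. apply Rmult_lt_reg_r with (1 + q); [lra|]. unfold Rdiv.
    rewrite Rmult_assoc, Rinv_l by lra. lra. }
  assert (Hqr : 0 < q * r < 1).
  { split; [apply Rmult_lt_0_compat; lra|]. unfold r.
    apply Rmult_lt_reg_r with (1 + q); [lra|]. unfold Rdiv.
    rewrite !Rmult_assoc, Rinv_l by lra. lra. }
  apply Rbar_lt_le_trans with r; [exact Hr|].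
  apply (proj1 (CV_radius_bounded c)).
  destruct (filterlim_bounded (V := R_NormedModule) (fun l => binom_coef nu l * (q * r) ^ l)) as [M HM].
  { exists 0. apply (ex_series_lim_0 (fun l => binom_coef nu l * (q * r) ^ l)).
    now apply ex_series_binom. }
  exists M. intro l. eapply Rle_trans; [|exact (HM l)].
  change (norm ?x) with (Rabs x). rewrite !Rabs_mult.
  rewrite Rpow_mult_distr, Rabs_mult, (Rabs_pos_eq (binom_coef nu l)) by (apply Rlt_le, binom_coef_pos, Hn).
  rewrite (Rabs_pos_eq (q ^ l)) by (apply pow_le; lra). rewrite <- Rmult_assoc.
  apply Rmult_le_compat_r; [apply Rabs_pos|apply Hc].
Qed.

(** Along the ray the complex series is a pair of real power series in [t], which are differentiated
    term by term. A bound of this shape covers both the binomial and the logarithmic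
    coefficients. *)
Lemma Cseries_ray_derive (c : nat -> C) (nu q : R) :
  0 < nu -> 0 < q < 1 -> (forall l, Cmod (c l) <= binom_coef nu l * q ^ l) ->
  exists U U' : R -> C, forall t, 0 <= t <= 1 ->
    is_series (fun l => c l * t ^ l)%C (U t) /\
    is_series (fun l => INR (S l) * c (S l) * t ^ l)%C (U' t) /\
    is_Cderive U t (U' t).
Proof.
  intros Hn Hq Hc.
  assert (R1 : Rbar_lt 1 (CV_radius (fun l => Re (c l)))).
  { apply CV_radius_gt_1 with nu q; auto. intro l.
    eapply Rle_trans; [apply re_le_Cmod|apply Hc]. }
  assert (R2 : Rbar_lt 1 (CV_radius (fun l => Im (c l)))).
  { apply CV_radius_gt_1 with nu q; auto. intro l.
    eapply Rle_trans; [|apply Hc]. eapply Rle_trans; [apply Rmax_r|apply Rmax_Cmod]. }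
  exists (fun t => (PSeries (fun l => Re (c l)) t, PSeries (fun l => Im (c l)) t)).
  exists (fun t => (PSeries (PS_derive (fun l => Re (c l))) t,
                    PSeries (PS_derive (fun l => Im (c l))) t)).
  intros t Ht.
  assert (Q1 : Rbar_lt (Rabs t) (CV_radius (fun l => Re (c l)))).
  { apply Rbar_le_lt_trans with 1; auto. simpl. rewrite Rabs_pos_eq; lra. }
  assert (Q2 : Rbar_lt (Rabs t) (CV_radius (fun l => Im (c l)))).
  { apply Rbar_le_lt_trans with 1; auto. simpl. rewrite Rabs_pos_eq; lra. }
  assert (EP : forall (z : C) (l : nat), (z * t ^ l)%C = (Re z * t ^ l, Im z * t ^ l)).
  { intros [a b] l. rewrite <- RtoC_pow. unfold Cmult, RtoC, Re, Im; cbn [fst snd]. f_equal; ring. }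
  assert (EQ : forall (z : C) (l : nat), (INR (S l) * z * t ^ l)%C
     = (INR (S l) * Re z * t ^ l, INR (S l) * Im z * t ^ l)).
  { intros [a b] l. rewrite <- RtoC_pow. unfold Cmult, RtoC, Re, Im; cbn [fst snd]. f_equal; ring. }
  split; [|split; [|split]].
  - apply is_Cseries_pair; (eapply is_series_ext; [intro l; rewrite EP; reflexivity|]).
    + apply is_pseries_R, PSeries_correct, CV_radius_inside, Q1.
    + apply is_pseries_R, PSeries_correct, CV_radius_inside, Q2.
  - apply is_Cseries_pair; (eapply is_series_ext; [intro l; rewrite EQ; reflexivity|]).
    + apply (is_pseries_R (PS_derive (fun l => Re (c l)))).
      apply PSeries_correct, ex_pseries_derive, Q1.
    + apply (is_pseries_R (PS_derive (fun l => Im (c l)))).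
      apply PSeries_correct, ex_pseries_derive, Q2.
  - apply (is_derive_PSeries (fun l => Re (c l))), Q1.
  - apply (is_derive_PSeries (fun l => Im (c l))), Q2.
Qed.

(** The operator [t d/dt] multiplies the [l]-th term by [l]; the added term of index 0 is zero. *)
Lemma is_Cseries_INR_mult (c : nat -> C) (t : R) (U' : C) :
  is_series (fun l => INR (S l) * c (S l) * t ^ l)%C U' ->
  is_series (fun l => INR l * c l * t ^ l)%C (t * U')%C.
Proof.
  intro H. apply (is_series_decr_1 (V := C_NormedModule)).
  apply (eq_ind (t * U')%C (fun x => is_series (fun k => INR (S k) * c (S k) * t ^ S k)%C x)).
  - apply is_Cseries_ext with (fun l => t * (INR (S l) * c (S l) * t ^ l))%C.
    + intro l. rewrite Cpow_S. Cring.
    + now apply is_Cseries_scal.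
  - change (t * U' = t * U' + - (RtoC 0 * c 0%nat * t ^ 0))%C. ring.
Qed.

Lemma binom_coef_S (nu : R) (l : nat) :
  INR (S l) * binom_coef nu (S l) = (nu + INR l) * binom_coef nu l.
Proof. cbn [binom_coef]. field. apply not_0_INR. lia. Qed.

Lemma mid_bounds (v : C) : Cmod v < 1 -> 0 < (1 + Cmod v) / 2 < 1 /\ Cmod v <= (1 + Cmod v) / 2.
Proof. generalize (Cmod_ge_0 v). lra. Qed.

(** By the recurrence [binom_coef_S], the sum [U] along the ray satisfies [(1 - t v) U' = nu v U];
    hence [U (1 - t v) ^ nu] keeps the value 1 that it has at [t = 0]. *)
Lemma binomial_series (nu : R) (v : C) :
  0 < nu -> Cmod v < 1 ->
  is_series (fun l => binom_coef nu l * v ^ l)%C (Cexp (- nu * RHlog (1 - v))%C).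
Proof.
  intros Hn Hv. destruct (mid_bounds v Hv) as [Hq Hvq].
  destruct (Cseries_ray_derive (fun l => binom_coef nu l * v ^ l)%C nu _ Hn Hq)
    as [U [U' HU]].
  { intro l. rewrite Cmod_mult, Cmod_R, Cmod_pow, Rabs_pos_eq by (apply Rlt_le, binom_coef_pos, Hn).
    apply Rmult_le_compat_l; [apply Rlt_le, binom_coef_pos, Hn|].
    apply pow_incr. split; [apply Cmod_ge_0|exact Hvq]. }
  assert (ODE : forall t, 0 <= t <= 1 -> U' t = (v * (nu * U t + t * U' t))%C).
  { intros t Ht. destruct (HU t Ht) as [H1 [H2 _]].
    apply (is_Cseries_unique _ _ _ H2).
    apply is_Cseries_ext with (fun l => v * (nu * (binom_coef nu l * v ^ l * t ^ l)
       + INR l * (binom_coef nu l * v ^ l) * t ^ l))%C.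
    - intro l. symmetry. rewrite (Cmult_assoc (INR (S l))).
      replace (INR (S l) * binom_coef nu (S l))%C with
        ((nu + INR l) * binom_coef nu l)%C
        by (rewrite <- RtoC_plus, <- !RtoC_mult, binom_coef_S; reflexivity).
      rewrite Cpow_S. Cring.
    - apply is_Cseries_scal, is_Cseries_plus; [now apply is_Cseries_scal|].
      now apply (is_Cseries_INR_mult (fun l => binom_coef nu l * v ^ l)%C). }
  assert (E := Cderive_0_const
    (fun t : R => U t * Cexp (nu * RHlog (1 - t * v)))%C 0 1 Rlt_0_1).
  lapply E; clear E; [intro E|].
  2:{ intros t Ht.
    assert (Hp := Re_line_pos v t Hv Ht). eapply is_Cderive_eq.
    - apply is_Cderive_mult; [apply (HU t Ht)|].
      apply is_Cderive_Cexp, is_Cderive_scal, is_Cderive_RHlog; [exact Hp|].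
      apply is_Cderive_line.
    - assert (N := Re_pos_neq_0 _ Hp).
      replace (U' t) with (/ (1 - t * v) * (U' t - v * (t * U' t)))%C by (field; exact N).
      rewrite (ODE t Ht) at 1. field. exact N. }
  cbv beta in E.
  replace (1 - RtoC 1 * v)%C with (1 - v)%C in E by ring.
  replace (1 - RtoC 0 * v)%C with (RtoC 1) in E by ring.
  rewrite RHlog_1 in E.
  replace (nu * 0)%C with (RtoC 0) in E by ring. rewrite Cexp_0 in E.
  assert (U0 : U 0 = 1).
  { destruct (HU 0 ltac:(lra)) as [H0 _]. apply (is_Cseries_unique _ _ _ H0).
    apply (is_series_decr_1 (V := C_NormedModule)).
    apply (eq_ind (RtoC 0) (fun x => is_series (fun k => binom_coef nu (S k) * v ^ S k * 0 ^ S k)%C x)).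
    - apply is_Cseries_ext with (fun _ => RtoC 0); [|apply is_Cseries_0].
      intro k. rewrite (Cpow_S 0). Cring.
    - change (RtoC 0 = 1 + - (1 * 1 * 1))%C. ring. }
  rewrite U0 in E.
  destruct (HU 1 ltac:(lra)) as [H1 _].
  apply is_Cseries_ext with (fun l => binom_coef nu l * v ^ l * RtoC 1 ^ l)%C.
  { intro l. rewrite Cpow_1_l. Cring. }
  apply (eq_ind (U 1) (fun x => is_series (fun l => binom_coef nu l * v ^ l * RtoC 1 ^ l)%C x) H1).
  replace (- nu * RHlog (1 - v))%C with (- (nu * RHlog (1 - v)))%C by ring.
  rewrite Cexp_opp.
  replace (U 1) with ((U 1 * Cexp (nu * RHlog (1 - v))) * / Cexp (nu * RHlog (1 - v)))%C
    by (field; apply Cexp_neq_0).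
  rewrite E. ring.
Qed.

Lemma binom_coef_succ (nu : R) (l : nat) :
  0 < nu -> binom_coef (nu + 1) l = binom_coef nu l * ((nu + INR l) / nu).
Proof.
  intro H. induction l.
  - simpl. field. lra.
  - cbn [binom_coef]. rewrite IHl, S_INR. generalize (pos_INR l). intro. field. lra.
Qed.

Lemma shifted_harmonic_bounds (nu : R) (l : nat) :
  0 < nu -> 0 <= shifted_harmonic nu l <= INR l / nu.
Proof.
  intro H. induction l.
  - simpl. split; [lra|]. right. field. lra.
  - cbn [shifted_harmonic]. rewrite S_INR. generalize (pos_INR l). intro K.
    assert (0 < / (nu + INR l)) by (apply Rinv_0_lt_compat; lra).
    assert (/ (nu + INR l) <= / nu) by (apply Rinv_le_contravar; lra).
    replace ((INR l + 1) / nu) with (INR l / nu + / nu) by (field; lra). lra.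
Qed.

(** The derivative of [binom_coef nu l] in [nu], hence the coefficient of [v ^ l] in
    [- log (1 - v) (1 - v) ^ (- nu)]. *)
Definition log_binom_coef (nu : R) (l : nat) : R := binom_coef nu l * shifted_harmonic nu l.

(** The harmonic factor is at most [l / nu], and this is absorbed by raising the exponent by 1. The
    logarithmic series thus inherits its convergence from a binomial one. *)
Lemma log_binom_coef_bounds (nu : R) (l : nat) :
  0 < nu -> 0 <= log_binom_coef nu l <= binom_coef (nu + 1) l.
Proof.
  intro H. unfold log_binom_coef. rewrite binom_coef_succ by auto.
  destruct (shifted_harmonic_bounds nu l H) as [A B].
  assert (P := binom_coef_pos nu l H). split; [apply Rmult_le_pos; lra|].
  apply Rmult_le_compat_l; [lra|]. eapply Rle_trans; [exact B|].
  unfold Rdiv. apply Rmult_le_compat_r; [apply Rlt_le, Rinv_0_lt_compat, H|lra].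
Qed.

Lemma log_binom_coef_S (nu : R) (l : nat) : 0 < nu ->
  INR (S l) * log_binom_coef nu (S l) = (nu + INR l) * log_binom_coef nu l + binom_coef nu l.
Proof.
  intro H. unfold log_binom_coef. rewrite <- Rmult_assoc, binom_coef_S.
  cbn [shifted_harmonic]. generalize (pos_INR l). intro. field. lra.
Qed.

(** The differential equation of the binomial series acquires the source term [v D], with
    [D = (1 - t v) ^ (- nu)]. The derivative of [U (1 - t v) ^ nu] is then [v / (1 - t v)], so that
    [U (1 - t v) ^ nu + log (1 - t v)] keeps its value 0 at [t = 0]. *)
Lemma log_binomial_series (nu : R) (v : C) :
  0 < nu -> Cmod v < 1 ->
  is_series (fun l => log_binom_coef nu l * v ^ l)%C
    (- RHlog (1 - v) * Cexp (- nu * RHlog (1 - v)))%C.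
Proof.
  intros Hn Hv. destruct (mid_bounds v Hv) as [Hq Hvq].
  destruct (Cseries_ray_derive (fun l => log_binom_coef nu l * v ^ l)%C (nu + 1) _ ltac:(lra) Hq)
    as [U [U' HU]].
  { intro l. destruct (log_binom_coef_bounds nu l Hn) as [A B].
    rewrite Cmod_mult, Cmod_R, Cmod_pow, Rabs_pos_eq by exact A.
    apply Rmult_le_compat; [exact A|apply pow_le, Cmod_ge_0|exact B|].
    apply pow_incr. split; [apply Cmod_ge_0|exact Hvq]. }
  set (D := fun t : R => Cexp (- nu * RHlog (1 - t * v))%C).
  assert (HD : forall t : R, 0 <= t <= 1 ->
    is_series (fun l => binom_coef nu l * v ^ l * t ^ l)%C (D t)).
  { intros t Ht. apply is_Cseries_ext with (fun l => binom_coef nu l * (t * v) ^ l)%C.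
    - intro l. rewrite Cpow_mult_l. Cring.
    - apply binomial_series; auto. rewrite Cmod_mult, Cmod_R, Rabs_pos_eq by lra.
      generalize (Cmod_ge_0 v). nra. }
  assert (ODE : forall t, 0 <= t <= 1 -> U' t = (v * (nu * U t + t * U' t) + v * D t)%C).
  { intros t Ht. destruct (HU t Ht) as [H1 [H2 _]].
    apply (is_Cseries_unique _ _ _ H2).
    apply is_Cseries_ext with (fun l => v * (nu * (log_binom_coef nu l * v ^ l * t ^ l)
       + INR l * (log_binom_coef nu l * v ^ l) * t ^ l) + v * (binom_coef nu l * v ^ l * t ^ l))%C.
    - intro l. symmetry. rewrite (Cmult_assoc (INR (S l))).
      replace (INR (S l) * log_binom_coef nu (S l))%C with
        ((nu + INR l) * log_binom_coef nu l + binom_coef nu l)%C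
        by (rewrite <- RtoC_plus, <- !RtoC_mult, <- RtoC_plus, log_binom_coef_S; auto).
      rewrite Cpow_S. Cring.
    - apply is_Cseries_plus; [|now apply is_Cseries_scal, HD].
      apply is_Cseries_scal, is_Cseries_plus; [now apply is_Cseries_scal|].
      now apply (is_Cseries_INR_mult (fun l => log_binom_coef nu l * v ^ l)%C). }
  assert (E := Cderive_0_const
    (fun t : R => U t * Cexp (nu * RHlog (1 - t * v)) + RHlog (1 - t * v))%C 0 1 Rlt_0_1).
  lapply E; clear E; [intro E|].
  2:{ intros t Ht.
    assert (Hp := Re_line_pos v t Hv Ht). eapply is_Cderive_eq.
    - apply is_Cderive_plus.
      + apply is_Cderive_mult; [apply (HU t Ht)|].
        apply is_Cderive_Cexp, is_Cderive_scal, is_Cderive_RHlog; [exact Hp|].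
        apply is_Cderive_line.
      + apply is_Cderive_RHlog; [exact Hp|]. apply is_Cderive_line.
    - assert (N := Re_pos_neq_0 _ Hp).
      replace (U' t) with (/ (1 - t * v) * (U' t - v * (t * U' t)))%C by (field; exact N).
      rewrite (ODE t Ht) at 1. unfold D.
      replace (- nu * RHlog (1 - t * v))%C with (- (nu * RHlog (1 - t * v)))%C by ring.
      rewrite Cexp_opp. cbv beta. field. split; [exact N|apply Cexp_neq_0]. }
  cbv beta in E.
  replace (1 - RtoC 1 * v)%C with (1 - v)%C in E by ring.
  replace (1 - RtoC 0 * v)%C with (RtoC 1) in E by ring.
  rewrite RHlog_1 in E.
  replace (nu * 0)%C with (RtoC 0) in E by ring. rewrite Cexp_0 in E.
  assert (U0 : U 0 = 0).
  { destruct (HU 0 ltac:(lra)) as [H0 _]. apply (is_Cseries_unique _ _ _ H0).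
    apply is_Cseries_ext with (fun _ => RtoC 0); [|apply is_Cseries_0].
    intros [|k].
    - unfold log_binom_coef. cbn [shifted_harmonic]. rewrite Rmult_0_r. Cring.
    - rewrite (Cpow_S 0). Cring. }
  rewrite U0 in E.
  destruct (HU 1 ltac:(lra)) as [H1 _].
  apply is_Cseries_ext with (fun l => log_binom_coef nu l * v ^ l * RtoC 1 ^ l)%C.
  { intro l. rewrite Cpow_1_l. Cring. }
  apply (eq_ind (U 1) (fun x => is_series (fun l => log_binom_coef nu l * v ^ l * RtoC 1 ^ l)%C x) H1).
  replace (- nu * RHlog (1 - v))%C with (- (nu * RHlog (1 - v)))%C by ring.
  rewrite Cexp_opp.
  replace (U 1) with (((U 1 * Cexp (nu * RHlog (1 - v)) + RHlog (1 - v)) - RHlog (1 - v))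
     * / Cexp (nu * RHlog (1 - v)))%C
    by (field; apply Cexp_neq_0).
  rewrite E. ring.
Qed.

(** * The Gamma function at half-integers *)

Lemma exp_le_compat (a b : R) : a <= b -> exp a <= exp b.
Proof. intros [H| ->]; [now apply Rlt_le, exp_increasing|apply Rle_refl]. Qed.

Definition gamma_integrand (s t : R) : R := Rpower t (s - 1) * exp (- t).

(** A relation rather than a value: [Gamma] is defined by [RInt_gen], which says nothing until
    convergence is known. *)
Definition is_Gamma (s l : R) : Prop :=
  is_RInt_gen (gamma_integrand s) (at_right 0) (Rbar_locally p_infty) l.

Lemma is_Gamma_unique (s l : R) : is_Gamma s l -> Gamma s = l.
Proof. intro H. now apply is_RInt_gen_unique. Qed.

Lemma filter_prod_pos_lt :
  filter_prod (at_right 0) (Rbar_locally p_infty) (fun ab => 0 < fst ab < snd ab).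
Proof.
  exists (fun a => 0 < a < 1) (fun b => 1 < b).
  - exists (mkposreal 1 Rlt_0_1). intros y Hy Hy0. simpl in Hy.
    unfold ball in Hy; simpl in Hy. unfold AbsRing_ball, abs, minus, plus, opp in Hy. simpl in Hy.
    apply Rabs_lt_between in Hy. lra.
  - now exists 1.
  - simpl. intros. lra.
Qed.

Lemma is_RInt_gen_FTC (F f : R -> R) (la lb : R) :
  (forall t, 0 < t -> is_derive F t (f t)) ->
  (forall t, 0 < t -> continuous f t) ->
  filterlim F (at_right 0) (locally la) ->
  filterlim F (Rbar_locally p_infty) (locally lb) ->
  is_RInt_gen f (at_right 0) (Rbar_locally p_infty) (lb - la).
Proof.
  intros HF Hf Ha Hb P HP.
  assert (L : filterlim (fun ab : R * R => minus (F (snd ab)) (F (fst ab)))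
    (filter_prod (at_right 0) (Rbar_locally p_infty)) (locally (lb - la))).
  { apply (filterlim_comp_2 (fun ab : R * R => F (snd ab)) (fun ab : R * R => opp (F (fst ab))) plus
      (G := locally lb) (H := locally (opp la))).
    - apply filterlim_comp with (2 := Hb). apply filterlim_snd.
    - apply (filterlim_comp _ _ _ (fun ab : R * R => F (fst ab)) opp _ (locally la)).
      + apply filterlim_comp with (2 := Ha). apply filterlim_fst.
      + apply (filterlim_opp (V := R_NormedModule)).
    - apply (filterlim_plus (V := R_NormedModule)). }
  unfold filtermapi.
  apply (filter_imp (fun ab : R * R => 0 < fst ab < snd ab /\ P (minus (F (snd ab)) (F (fst ab))))).
  2:{ apply filter_and; [exact filter_prod_pos_lt|exact (L P HP)]. }
  intros [a b] [Hab HPab]. cbn [fst snd] in *. eexists. split; [|exact HPab].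
  apply (is_RInt_derive F f); intros t Ht; rewrite Rmin_left, Rmax_right in Ht by lra;
    [apply HF|apply Hf]; lra.
Qed.

(** Integration by parts in differential form: it yields the functional equation once the primitive
    is shown to vanish at 0 and at infinity. *)
Lemma gamma_integrand_derive (s t : R) : 0 < t ->
  is_derive (fun u => - (Rpower u s * exp (- u))) t
    (gamma_integrand (s + 1) t - s * gamma_integrand s t).
Proof.
  intro Ht. unfold gamma_integrand, Rpower.
  replace (s + 1 - 1) with s by ring.
  auto_derive; [auto|].
  replace (exp ((s - 1) * ln t)) with (exp (s * ln t) * / t).
  - field. lra.
  - rewrite <- (exp_ln t Ht) at 2. rewrite <- exp_Ropp, <- exp_plus. f_equal. ring.
Qed.

Lemma gamma_integrand_continuous (s t : R) : 0 < t -> continuous (gamma_integrand s) t.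
Proof.
  intro Ht. apply (ex_derive_continuous (gamma_integrand s)).
  unfold gamma_integrand, Rpower. auto_derive. auto.
Qed.

Lemma gamma_integrand_pos (s t : R) : 0 < gamma_integrand s t.
Proof. apply Rmult_lt_0_compat; apply exp_pos. Qed.

Lemma filterlim_0_le {T : Type} (F : (T -> Prop) -> Prop) (FF : Filter F) (f : T -> R) :
  (forall eps : R, 0 < eps -> F (fun t => Rabs (f t) < eps)) -> filterlim f F (locally 0).
Proof.
  intros H P [eps HP]. unfold filtermap. generalize (H eps (cond_pos eps)).
  apply filter_imp. intros t Ht. apply HP.
  unfold ball; simpl. unfold AbsRing_ball, abs, minus, plus, opp; simpl.
  now rewrite Ropp_0, Rplus_0_r.
Qed.

Lemma gamma_primitive_at_0 (s : R) : 1 <= s ->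
  filterlim (fun u => - (Rpower u s * exp (- u))) (at_right 0) (locally 0).
Proof.
  intro Hs. apply filterlim_0_le; [typeclasses eauto|]. intros eps Heps.
  assert (Hm : 0 < Rmin eps 1) by (apply Rmin_pos; lra).
  exists (mkposreal _ Hm). intros t Ht Ht0.
  unfold ball in Ht; simpl in Ht. unfold AbsRing_ball, abs, minus, plus, opp in Ht; simpl in Ht.
  rewrite Ropp_0, Rplus_0_r, Rabs_pos_eq in Ht by lra.
  assert (t < eps /\ t < 1) as [T1 T2].
  { generalize (Rmin_l eps 1) (Rmin_r eps 1). lra. }
  assert (P1 : 0 < Rpower t s) by apply exp_pos.
  assert (P2 : 0 < exp (- t)) by apply exp_pos.
  rewrite Rabs_Ropp, Rabs_pos_eq by nra.
  assert (Q1 : Rpower t s <= t).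
  { rewrite <- (exp_ln t) at 2 by auto. unfold Rpower.
    assert (ln t < 0) by (rewrite <- ln_1; now apply ln_increasing).
    apply exp_le_compat. nra. }
  assert (Q2 : exp (- t) <= 1) by (rewrite <- exp_0; apply exp_le_compat; lra).
  nra.
Qed.

Lemma gamma_primitive_at_infty (s : R) : 0 < s ->
  filterlim (fun u => - (Rpower u s * exp (- u))) (Rbar_locally p_infty) (locally 0).
Proof.
  intro Hs. apply filterlim_0_le; [typeclasses eauto|]. intros eps Heps.
  (* [t ^ s exp (- t / 2) <= (2 s) ^ s], from [ln y <= y] at [y = t / (2 s)]. The other half of the
     exponential provides the decay. *)
  set (A := exp (s * ln (2 * s))). assert (HA : 0 < A) by apply exp_pos.
  exists (2 * A / eps). intros t Ht.
  assert (H0 : 0 < 2 * A / eps) by (apply Rdiv_lt_0_compat; lra).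
  assert (P1 : 0 < Rpower t s) by apply exp_pos.
  assert (P2 : 0 < exp (- t)) by apply exp_pos.
  rewrite Rabs_Ropp, Rabs_pos_eq by nra.
  assert (B : Rpower t s * exp (- t) <= A * exp (- (t / 2))).
  { unfold Rpower, A. rewrite <- !exp_plus. apply exp_le_compat.
    assert (Hl : ln (t / (2 * s)) <= t / (2 * s)).
    { assert (Hp : 0 < t / (2 * s)) by (apply Rdiv_lt_0_compat; lra).
      generalize (exp_ineq1_le (ln (t / (2 * s)))). rewrite exp_ln by exact Hp. lra. }
    rewrite ln_div in Hl by lra.
    apply (Rmult_le_compat_l s) in Hl; [|lra].
    replace (s * (t / (2 * s))) with (t / 2) in Hl by (field; lra). lra. }
  eapply Rle_lt_trans; [exact B|].
  rewrite exp_Ropp. apply Rlt_le_trans with (A * / (t / 2)).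
  - apply Rmult_lt_compat_l; [exact HA|]. apply Rinv_lt_contravar.
    + apply Rmult_lt_0_compat; [lra|apply exp_pos].
    + generalize (exp_ineq1_le (t / 2)). lra.
  - apply Rmult_le_reg_r with (t / 2); [lra|]. rewrite Rmult_assoc, Rinv_l, Rmult_1_r by lra.
    apply Rmult_le_reg_r with (2 / eps); [apply Rdiv_lt_0_compat; lra|].
    replace (eps * (t / 2) * (2 / eps)) with t by (field; lra).
    replace (A * (2 / eps)) with (2 * A / eps) by (field; lra). lra.
Qed.

Lemma is_Gamma_1 : is_Gamma 1 1.
Proof.
  unfold is_Gamma. replace 1 with (0 - (- (1))) at 2 by ring.
  apply (is_RInt_gen_FTC (fun t => - exp (- t))).
  - intros t Ht. unfold gamma_integrand, Rpower. auto_derive; auto.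
    replace ((1 - 1) * ln t) with 0 by ring. rewrite exp_0. ring.
  - intros t Ht. now apply gamma_integrand_continuous.
  - apply (filterlim_filter_le_1 (F := locally 0)).
    { intros P [eps HP]. exists eps. auto. }
    replace (- (1)) with (- exp (- 0)) by (rewrite Ropp_0, exp_0; ring).
    apply (ex_derive_continuous (fun t => - exp (- t))). auto_derive. auto.
  - apply filterlim_0_le; [typeclasses eauto|]. intros eps Heps.
    exists (/ eps). intros t Ht. assert (0 < / eps) by now apply Rinv_0_lt_compat.
    rewrite Rabs_Ropp, Rabs_pos_eq by apply Rlt_le, exp_pos.
    rewrite exp_Ropp. rewrite <- (Rinv_inv eps). apply Rinv_lt_contravar.
    + apply Rmult_lt_0_compat; [auto|apply exp_pos].
    + generalize (exp_ineq1_le t). lra.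
Qed.

Lemma is_Gamma_succ (s l : R) : 1 <= s -> is_Gamma s l -> is_Gamma (s + 1) (s * l).
Proof.
  intros Hs H. unfold is_Gamma in *.
  replace (s * l) with (plus (scal s l) (0 - 0)) by (unfold plus, scal; simpl; unfold mult; simpl; ring).
  apply (is_RInt_gen_ext (fun t => plus (scal s (gamma_integrand s t))
     (gamma_integrand (s + 1) t - s * gamma_integrand s t))).
  - apply filter_forall. intros ab t _. unfold plus, scal; simpl; unfold mult; simpl. ring.
  - apply (is_RInt_gen_plus (V := R_NormedModule) (fun t => scal s (gamma_integrand s t))
      (fun t => gamma_integrand (s + 1) t - s * gamma_integrand s t)).
    + now apply (is_RInt_gen_scal (V := R_NormedModule) (gamma_integrand s)).
    + apply (is_RInt_gen_FTC (fun u => - (Rpower u s * exp (- u)))).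
      * intros t Ht. now apply gamma_integrand_derive.
      * intros t Ht. apply (continuous_minus (V := R_NormedModule) (gamma_integrand (s + 1))).
        -- now apply gamma_integrand_continuous.
        -- apply (continuous_mult (K := R_AbsRing) (fun _ => s)).
           ++ apply continuous_const.
           ++ now apply gamma_integrand_continuous.
      * now apply gamma_primitive_at_0.
      * apply gamma_primitive_at_infty. lra.
Qed.

(** For a nonnegative integrand the integral grows with the interval, so its limit is the supremum
    of the integrals over compact intervals. *)
Lemma ex_RInt_gen_bounded (f : R -> R) (M : R) :
  (forall t, 0 < t -> continuous f t) -> (forall t, 0 < t -> 0 <= f t) ->
  (forall a b, 0 < a < b -> RInt f a b <= M) ->
  ex_RInt_gen f (at_right 0) (Rbar_locally p_infty).
Proof.
  intros Hc Hp HM.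
  assert (HI : forall a b, 0 < a <= b -> ex_RInt f a b).
  { intros a b Hab. apply (ex_RInt_continuous (V := R_CompleteNormedModule)).
    intros t Ht. rewrite Rmin_left in Ht by lra. apply Hc. lra. }
  destruct (completeness (fun y => exists a b, 0 < a < b /\ y = RInt f a b)) as [l [Hub Hlub]].
  - exists M. intros y [a [b [Hab ->]]]. now apply HM.
  - exists (RInt f 1 2), 1, 2. split; [lra|reflexivity].
  - exists l. intros P [eps HP].
    assert (Hex : exists a b, 0 < a < b /\ l - eps < RInt f a b).
    { apply Classical_Prop.NNPP. intro N.
      assert (l <= l - eps).
      { apply Hlub. intros y [a [b [Hab ->]]]. apply Rnot_lt_le. intro K.
        apply N. now exists a, b. }
      destruct eps as [e he]; simpl in *. lra. }
    destruct Hex as [a0 [b0 [Hab0 Hl]]].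
    exists (fun a => 0 < a < a0) (fun b => b0 < b).
    + assert (Ha0 : 0 < a0) by lra. exists (mkposreal _ Ha0).
      intros y Hy Hy0. unfold ball in Hy; simpl in Hy.
      unfold AbsRing_ball, abs, minus, plus, opp in Hy; simpl in Hy.
      rewrite Ropp_0, Rplus_0_r, Rabs_pos_eq in Hy; lra.
    + now exists b0.
    + intros a b Ha Hb. cbn [fst snd]. exists (RInt f a b). split.
      * apply (RInt_correct (V := R_CompleteNormedModule)). apply HI. lra.
      * apply HP.
        assert (U : RInt f a b <= l) by (apply Hub; exists a, b; split; [lra|reflexivity]).
        assert (C1 : RInt f a b = RInt f a a0 + RInt f a0 b0 + RInt f b0 b).
        { rewrite <- (RInt_Chasles f a b0 b) by (apply HI; lra).
          rewrite <- (RInt_Chasles f a a0 b0) by (apply HI; lra). reflexivity. }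
        assert (0 <= RInt f a a0).
        { apply RInt_ge_0; [lra|apply HI; lra|intros; apply Hp; lra]. }
        assert (0 <= RInt f b0 b).
        { apply RInt_ge_0; [lra|apply HI; lra|intros; apply Hp; lra]. }
        unfold ball; simpl. unfold AbsRing_ball, abs, minus, plus, opp; simpl.
        apply Rabs_lt_between. lra.
Qed.

(* AM-GM applied to [t ^ (s - 1)] and [t ^ s]. *)
Lemma gamma_integrand_AMGM (s t lam : R) : 0 < t -> 0 < lam ->
  gamma_integrand (s + / 2) t <=
  / 2 * (lam * gamma_integrand s t + / lam * gamma_integrand (s + 1) t).
Proof.
  intros Ht Hl. unfold gamma_integrand.
  replace (s + / 2 - 1) with ((s - 1) + / 2) by ring.
  replace (s + 1 - 1) with ((s - 1) + 1) by ring.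
  rewrite !Rpower_plus, Rpower_1, Rpower_sqrt by auto.
  assert (P : 0 < Rpower t (s - 1) * exp (- t)) by apply gamma_integrand_pos.
  set (p := Rpower t (s - 1)) in *. set (e := exp (- t)) in *.
  replace (/ 2 * (lam * (p * e) + / lam * (p * t * e))) with
    ((p * e) * (/ 2 * (lam + t / lam))) by (field; lra).
  replace (p * sqrt t * e) with ((p * e) * sqrt t) by ring.
  apply Rmult_le_compat_l; [lra|].
  apply Rmult_le_reg_r with (2 * lam); [lra|].
  replace (/ 2 * (lam + t / lam) * (2 * lam)) with (lam ^ 2 + t) by (field; lra).
  generalize (sqrt_sqrt t (Rlt_le _ _ Ht)). intro E.
  assert (0 <= (lam - sqrt t) ^ 2) by apply pow2_ge_0. nra.
Qed.

Lemma is_Gamma_32_ex : exists l, is_Gamma (3 / 2) l.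
Proof.
  apply (ex_RInt_gen_bounded (gamma_integrand (3 / 2)) 1).
  - intros t Ht. now apply gamma_integrand_continuous.
  - intros t _. apply Rlt_le, gamma_integrand_pos.
  - intros a b Hab.
    (* This majorant is AM-GM with [lam = 1] between the integrands at 1 and 2. Its primitive is
       [- (2 + t) exp (- t) / 2], whence the bound 1. *)
    set (h := fun t => / 2 * (1 + t) * exp (- t)).
    assert (HI : is_RInt h a b (minus (- (/ 2 * (2 + b) * exp (- b))) (- (/ 2 * (2 + a) * exp (- a))))).
    { apply (is_RInt_derive (fun t => - (/ 2 * (2 + t) * exp (- t)))).
      - intros t _. unfold h. auto_derive; auto. field.
      - intros t _. apply (ex_derive_continuous h). unfold h. auto_derive. auto. }
    apply Rle_trans with (RInt h a b).
    + apply RInt_le; [lra| |now exists (minus (- (/ 2 * (2 + b) * exp (- b))) (- (/ 2 * (2 + a) * exp (- a))))|].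
      * apply (ex_RInt_continuous (V := R_CompleteNormedModule)).
        intros t Ht. rewrite Rmin_left in Ht by lra. apply gamma_integrand_continuous. lra.
      * intros t Ht. replace (3 / 2) with (1 + / 2) by field.
        eapply Rle_trans; [apply (gamma_integrand_AMGM 1 t 1); lra|].
        unfold gamma_integrand, h. replace (1 + 1 - 1) with 1 by ring.
        rewrite Rpower_1, Rminus_diag, Rpower_O by lra. right. field.
    + rewrite (is_RInt_unique _ _ _ _ HI). unfold minus, plus, opp; simpl.
      assert (A : exp (- a) * (1 + a) <= 1).
      { apply Rle_trans with (exp (- a) * exp a).
        - apply Rmult_le_compat_l; [apply Rlt_le, exp_pos|apply exp_ineq1_le].
        - rewrite <- exp_plus. replace (- a + a) with 0 by ring. rewrite exp_0. lra. }
      assert (0 < exp (- b)) by apply exp_pos. assert (0 < exp (- a)) by apply exp_pos. nra.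
Qed.

(** The expansion evaluates [Gamma] at the points [1 + n / 2]; two base values and the unit step
    reach all of them. *)
Lemma half_step_ind (P : R -> Prop) :
  P 1 -> P (3 / 2) -> (forall s, 1 <= s -> P s -> P (s + 1)) ->
  forall k : nat, P (1 + INR k / 2).
Proof.
  intros H1 H2 HS.
  assert (A : forall k : nat, P (1 + INR k / 2) /\ P (1 + INR (S k) / 2)).
  { induction k as [|k [I1 I2]].
    - split; simpl INR.
      + replace (1 + 0 / 2) with 1 by field. exact H1.
      + replace (1 + 1 / 2) with (3 / 2) by field. exact H2.
    - split; [exact I2|].
      replace (1 + INR (S (S k)) / 2) with ((1 + INR k / 2) + 1) by (rewrite !S_INR; field).
      apply HS; [generalize (pos_INR k); lra|exact I1]. }
  intro k. apply A.
Qed.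

Lemma Gamma_correct (k : nat) : is_Gamma (1 + INR k / 2) (Gamma (1 + INR k / 2)).
Proof.
  apply (half_step_ind (fun s => is_Gamma s (Gamma s))).
  - rewrite (is_Gamma_unique _ _ is_Gamma_1). apply is_Gamma_1.
  - destruct is_Gamma_32_ex as [l Hl]. now rewrite (is_Gamma_unique _ _ Hl).
  - intros s Hs H. assert (K := is_Gamma_succ _ _ Hs H).
    now rewrite (is_Gamma_unique _ _ K).
Qed.

Lemma Gamma_1 : Gamma 1 = 1.
Proof. exact (is_Gamma_unique _ _ is_Gamma_1). Qed.

Lemma Gamma_succ (k : nat) :
  Gamma (1 + INR k / 2 + 1) = (1 + INR k / 2) * Gamma (1 + INR k / 2).
Proof.
  apply is_Gamma_unique, is_Gamma_succ; [generalize (pos_INR k); lra|apply Gamma_correct].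
Qed.

(** Log-convexity of [Gamma] at the midpoint of [s] and [s + 1]: AM-GM under the integral, with
    [lam = sqrt s] so that its two terms have equal integrals. *)
Lemma Gamma_half_le (k : nat) :
  Gamma (1 + INR k / 2 + / 2) <= sqrt (1 + INR k / 2) * Gamma (1 + INR k / 2).
Proof.
  set (s := 1 + INR k / 2).
  assert (Hs : 0 < s) by (unfold s; generalize (pos_INR k); lra).
  assert (Hq : 0 < sqrt s) by now apply sqrt_lt_R0.
  assert (A : is_Gamma (s + / 2) (Gamma (s + / 2))).
  { replace (s + / 2) with (1 + INR (S k) / 2) by (unfold s; rewrite S_INR; field).
    apply Gamma_correct. }
  assert (B : is_Gamma (s + 1) (s * Gamma s)).
  { apply is_Gamma_succ; [unfold s; generalize (pos_INR k); lra|apply Gamma_correct]. }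
  assert (E : Rabs (Gamma (s + / 2)) <=
     / 2 * (sqrt s * Gamma s + / sqrt s * (s * Gamma s))).
  { apply (RInt_gen_norm (V := R_CompleteNormedModule) (Fa := at_right 0) (Fb := Rbar_locally p_infty)
      (gamma_integrand (s + / 2))
      (fun t => / 2 * (sqrt s * gamma_integrand s t + / sqrt s * gamma_integrand (s + 1) t))).
    - generalize filter_prod_pos_lt. apply filter_imp. intros; lra.
    - generalize filter_prod_pos_lt. apply filter_imp. intros ab Hab t Ht.
      change (norm ?x) with (Rabs x).
      rewrite Rabs_pos_eq by (apply Rlt_le, gamma_integrand_pos).
      apply gamma_integrand_AMGM; lra.
    - exact A.
    - apply (is_RInt_gen_scal (V := R_NormedModule)
        (fun t => sqrt s * gamma_integrand s t + / sqrt s * gamma_integrand (s + 1) t) (/ 2)).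
      apply (is_RInt_gen_plus (V := R_NormedModule)
        (fun t => sqrt s * gamma_integrand s t) (fun t => / sqrt s * gamma_integrand (s + 1) t)).
      + apply (is_RInt_gen_scal (V := R_NormedModule) (gamma_integrand s)), Gamma_correct.
      + apply (is_RInt_gen_scal (V := R_NormedModule) (gamma_integrand (s + 1))), B. }
  eapply Rle_trans; [apply Rle_abs|]. eapply Rle_trans; [exact E|].
  assert (Es := sqrt_sqrt s (Rlt_le _ _ Hs)).
  assert (Er : / sqrt s * s = sqrt s).
  { apply Rmult_eq_reg_l with (sqrt s); [|lra]. rewrite Es. field. lra. }
  rewrite <- Rmult_assoc, Er. right. field.
Qed.

(** At [3 / 2] positivity comes from [1 = Gamma 2 <= sqrt (3 / 2) Gamma (3 / 2)]; the functional
    equation carries it on. *)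
Lemma Gamma_pos (k : nat) : 0 < Gamma (1 + INR k / 2).
Proof.
  apply (half_step_ind (fun s => 0 < Gamma s /\ is_Gamma s (Gamma s))).
  - rewrite Gamma_1. split; [lra|apply is_Gamma_1].
  - assert (H := Gamma_half_le 1). assert (K := Gamma_succ 0).
    assert (G := Gamma_correct 1). simpl INR in *.
    replace (1 + 0 / 2) with 1 in K by field. rewrite Gamma_1 in K.
    replace (1 + 1 / 2 + / 2) with (1 + 1) in H by field. rewrite K in H.
    replace (1 + 1 / 2) with (3 / 2) in * by field. split; [|exact G].
    assert (0 < sqrt (3 / 2)) by (apply sqrt_lt_R0; lra). nra.
  - intros s Hs [H HG]. assert (K := is_Gamma_succ _ _ Hs HG).
    rewrite (is_Gamma_unique _ _ K). split; [apply Rmult_lt_0_compat; lra|exact K].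
Qed.

(** * Gauss's product for [1 / Gamma] at half-integers *)

Definition gauss_coef (nu : R) (m : nat) : R := binom_coef nu m * Rpower (INR m) (1 - nu).

Lemma gauss_coef_succ (nu : R) (m : nat) : 0 < nu -> (0 < m)%nat ->
  gauss_coef (nu + 1) m = gauss_coef nu m * ((nu + INR m) / (0 + INR m)) * / nu.
Proof.
  intros Hn Hm. unfold gauss_coef. rewrite binom_coef_succ by auto.
  apply lt_0_INR in Hm.
  replace (1 - (nu + 1)) with ((1 - nu) + - (1)) by ring.
  rewrite Rpower_plus, Rpower_Ropp, Rpower_1 by auto. field. lra.
Qed.

Lemma binom_coef_1 (m : nat) : binom_coef 1 m = 1.
Proof.
  induction m; [reflexivity|]. cbn [binom_coef]. rewrite IHm, S_INR.
  generalize (pos_INR m). intro. field. lra.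
Qed.

(** Recasts the coefficient as a ratio of values of [Gamma], which the half-step inequality can
    bound. *)
Lemma binom_coef_32_Gamma (m : nat) :
  binom_coef (3 / 2) m * (Gamma (3 / 2) * Gamma (1 + INR m)) = Gamma (3 / 2 + INR m).
Proof.
  induction m.
  - simpl. rewrite !Rplus_0_r, Gamma_1. ring.
  - rewrite S_INR.
    assert (A := Gamma_succ (2 * m)). rewrite mult_INR in A. simpl (INR 2) in A.
    replace (1 + (1 + 1) * INR m / 2) with (1 + INR m) in A by field.
    assert (B := Gamma_succ (2 * m + 1)). rewrite plus_INR, mult_INR in B.
    simpl (INR 2) in B. simpl (INR 1) in B.
    replace (1 + ((1 + 1) * INR m + 1) / 2) with (3 / 2 + INR m) in B by field.
    replace (1 + (INR m + 1)) with (1 + INR m + 1) by ring.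
    replace (3 / 2 + (INR m + 1)) with (3 / 2 + INR m + 1) by ring.
    rewrite A, B, <- IHm. cbn [binom_coef]. rewrite S_INR.
    generalize (pos_INR m). intro. field. lra.
Qed.

(** Both bounds are the half-step inequality, at [1 + m] for the upper one and at [m + 1 / 2] for
    the lower one, the latter combined with [Gamma (m + 3 / 2) = (m + 1 / 2) Gamma (m + 1 / 2)]. The
    case [m = 0] is apart, since [1 / 2] is not of the form [1 + k / 2]. *)
Lemma Gamma_ratio_bounds (m : nat) :
  sqrt (INR m + / 2) * Gamma (1 + INR m) <= Gamma (3 / 2 + INR m)
  <= sqrt (1 + INR m) * Gamma (1 + INR m).
Proof.
  split.
  - destruct m as [|m].
    + assert (H := Gamma_half_le 1). assert (K := Gamma_succ 0). simpl INR in *.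
      assert (P := Gamma_pos 1). simpl INR in P.
      replace (1 + 0 / 2) with 1 in K by field. rewrite Gamma_1 in K.
      replace (1 + 1 / 2 + / 2) with (1 + 1) in H by field. rewrite K in H.
      replace (1 + 1 / 2) with (3 / 2) in * by field.
      replace (0 + / 2) with (/ 2) by ring.
      replace (1 + 0) with 1 by ring. replace (3 / 2 + 0) with (3 / 2) by ring.
      rewrite Gamma_1, Rmult_1_r.
      assert (E : sqrt (3 / 2) * sqrt (/ 2) <= 1).
      { rewrite <- sqrt_mult by lra. rewrite <- sqrt_1. apply sqrt_le_1; lra. }
      assert (Q : 0 < sqrt (/ 2)) by (apply sqrt_lt_R0; lra). nra.
    + assert (H := Gamma_half_le (2 * m + 1)). rewrite plus_INR, mult_INR in H.
      simpl (INR 2) in H. simpl (INR 1) in H.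
      replace (1 + ((1 + 1) * INR m + 1) / 2) with (INR m + 3 / 2) in H by field.
      assert (B := Gamma_succ (2 * m + 1)). rewrite plus_INR, mult_INR in B.
      simpl (INR 2) in B. simpl (INR 1) in B.
      replace (1 + ((1 + 1) * INR m + 1) / 2) with (INR m + 3 / 2) in B by field.
      assert (P := Gamma_pos (2 * m + 1)). rewrite plus_INR, mult_INR in P.
      simpl (INR 2) in P. simpl (INR 1) in P.
      replace (1 + ((1 + 1) * INR m + 1) / 2) with (INR m + 3 / 2) in P by field.
      rewrite S_INR.
      replace (3 / 2 + (INR m + 1)) with (INR m + 3 / 2 + 1) by ring.
      replace (INR m + 1 + / 2) with (INR m + 3 / 2) by field.
      replace (1 + (INR m + 1)) with (INR m + 3 / 2 + / 2) by field.
      rewrite B. generalize (pos_INR m). intro Hm.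
      assert (E := sqrt_sqrt (INR m + 3 / 2) ltac:(lra)).
      rewrite <- E at 3. rewrite Rmult_assoc. apply Rmult_le_compat_l; [apply sqrt_pos|exact H].
  - assert (H := Gamma_half_le (2 * m)). rewrite mult_INR in H. simpl (INR 2) in H.
    replace (1 + (1 + 1) * INR m / 2) with (1 + INR m) in H by field.
    replace (3 / 2 + INR m) with (1 + INR m + / 2) by field. exact H.
Qed.

Lemma is_lim_seq_sqrt_ratio (a : R) : 0 <= a ->
  is_lim_seq (fun m => sqrt (a + INR m) / sqrt (INR m)) 1.
Proof.
  intro Ha.
  apply is_lim_seq_ext_loc with (fun m => sqrt ((a + INR m) / (0 + INR m))).
  - exists 1%nat. intros n Hn. apply le_INR in Hn. simpl in Hn.
    rewrite Rplus_0_l, sqrt_div_alt by lra. reflexivity.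
  - replace (Finite 1) with (Finite (sqrt 1)) by (now rewrite sqrt_1).
    apply is_lim_seq_continuous.
    + apply continuity_pt_sqrt. lra.
    + apply is_lim_seq_shift_ratio.
Qed.

Lemma gauss_coef_32_lim : is_lim_seq (gauss_coef (3 / 2)) (/ Gamma (3 / 2)).
Proof.
  assert (G32 : 0 < Gamma (3 / 2)).
  { replace (3 / 2) with (1 + INR 1 / 2) by (simpl; field). apply Gamma_pos. }
  apply is_lim_seq_le_le_loc with
    (fun m => sqrt (/ 2 + INR m) / sqrt (INR m) * / Gamma (3 / 2))
    (fun m => sqrt (1 + INR m) / sqrt (INR m) * / Gamma (3 / 2)).
  - exists 1%nat. intros m Hm. apply le_INR in Hm. simpl in Hm.
    assert (Hs : 0 < sqrt (INR m)) by (apply sqrt_lt_R0; lra).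
    assert (HG : 0 < Gamma (1 + INR m)).
    { replace (1 + INR m) with (1 + INR (2 * m) / 2) by (rewrite mult_INR; simpl (INR 2); field).
      apply Gamma_pos. }
    destruct (Gamma_ratio_bounds m) as [A B].
    rewrite (Rplus_comm (INR m)) in A.
    rewrite <- binom_coef_32_Gamma in A, B.
    replace (gauss_coef (3 / 2) m) with (binom_coef (3 / 2) m * / sqrt (INR m)).
    2:{ unfold gauss_coef. f_equal. replace (1 - 3 / 2) with (- / 2) by field.
        rewrite Rpower_Ropp, Rpower_sqrt by lra. reflexivity. }
    assert (P : 0 < sqrt (INR m) * Gamma (3 / 2) * Gamma (1 + INR m)).
    { repeat apply Rmult_lt_0_compat; auto. }
    split.
    + apply Rmult_le_reg_r with (1 := P).
      match goal with |- ?l <= ?r => replace l with (sqrt (/ 2 + INR m) * Gamma (1 + INR m)) by (field; lra) end.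
      eapply Rle_trans; [exact A|]. right. field. lra.
    + apply Rmult_le_reg_r with (1 := P).
      match goal with |- ?l <= ?r => replace r with (sqrt (1 + INR m) * Gamma (1 + INR m)) by (field; lra) end.
      eapply Rle_trans; [|exact B]. right. field. lra.
  - replace (Finite (/ Gamma (3 / 2))) with (Finite (1 * / Gamma (3 / 2))) by (f_equal; ring).
    apply is_lim_seq_mult'; [apply is_lim_seq_sqrt_ratio; lra|apply is_lim_seq_const].
  - replace (Finite (/ Gamma (3 / 2))) with (Finite (1 * / Gamma (3 / 2))) by (f_equal; ring).
    apply is_lim_seq_mult'; [apply is_lim_seq_sqrt_ratio; lra|apply is_lim_seq_const].
Qed.

(** From [s] to [s + 1] the sequence is multiplied by [(s + m) / (m s)], which tends to [1 / s] in
    accordance with the functional equation. Only [s = 1] and [s = 3 / 2] need a direct argument. *)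
Lemma gauss_coef_lim (k : nat) :
  is_lim_seq (gauss_coef (1 + INR k / 2)) (/ Gamma (1 + INR k / 2)).
Proof.
  apply (half_step_ind (fun s => (is_Gamma s (Gamma s) /\ 0 < Gamma s)
     /\ is_lim_seq (gauss_coef s) (/ Gamma s))).
  - rewrite Gamma_1. split; [split; [apply is_Gamma_1|lra]|].
    rewrite Rinv_1. apply is_lim_seq_ext with (fun _ => 1); [|apply is_lim_seq_const].
    intro m. unfold gauss_coef, Rpower. rewrite binom_coef_1, Rminus_diag, Rmult_0_l, exp_0. ring.
  - split; [|apply gauss_coef_32_lim].
    replace (3 / 2) with (1 + INR 1 / 2) by (simpl; field).
    split; [apply Gamma_correct|apply Gamma_pos].
  - intros s Hs [[HG Hp] HL]. assert (K := is_Gamma_succ _ _ Hs HG).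
    rewrite (is_Gamma_unique _ _ K). split; [split; [exact K|apply Rmult_lt_0_compat; lra]|].
    apply is_lim_seq_ext_loc with (fun m => gauss_coef s m * ((s + INR m) / (0 + INR m)) * / s).
    + exists 1%nat. intros m Hm. rewrite gauss_coef_succ by (lra || lia). reflexivity.
    + replace (Finite (/ (s * Gamma s))) with (Finite (/ Gamma s * 1 * / s)) by (f_equal; field; lra).
      apply is_lim_seq_mult'; [|apply is_lim_seq_const].
      apply is_lim_seq_mult'; [exact HL|apply is_lim_seq_shift_ratio].
Qed.

(** * Wallis' product *)

Definition wallis (n : nat) : R := RInt (fun t => sin t ^ n) 0 (PI / 2).

Lemma continuous_sin_pow (n : nat) (t : R) : continuous (fun u => sin u ^ n) t.
Proof. apply (ex_derive_continuous (fun u => sin u ^ n)). auto_derive. auto. Qed.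

Lemma ex_RInt_sin_pow (n : nat) : ex_RInt (fun t => sin t ^ n) 0 (PI / 2).
Proof.
  apply (ex_RInt_continuous (V := R_CompleteNormedModule)).
  intros t _. apply continuous_sin_pow.
Qed.

(** Integrate the derivative of [sin ^ (n + 1) cos], a function that vanishes at both ends of the
    interval. *)
Lemma wallis_rec (n : nat) : INR (n + 2) * wallis (n + 2) = INR (n + 1) * wallis n.
Proof.
  assert (A : is_RInt (fun t => INR (n + 1) * sin t ^ n - INR (n + 2) * sin t ^ (n + 2)) 0 (PI / 2)
    (minus (sin (PI / 2) ^ (n + 1) * cos (PI / 2)) (sin 0 ^ (n + 1) * cos 0))).
  { apply (is_RInt_derive (fun t => sin t ^ (n + 1) * cos t)).
    - intros t _. auto_derive; auto.
      replace (Init.Nat.pred (n + 1)) with n by lia.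
      rewrite !pow_add, !plus_INR, pow_1. simpl (INR 1). simpl (INR 2).
      generalize (sin2_cos2 t). unfold Rsqr. intro E.
      replace (1 * cos t * ((INR n + 1) * sin t ^ n) * cos t)
        with ((INR n + 1) * sin t ^ n * (cos t * cos t)) by ring.
      replace (cos t * cos t) with (1 - sin t * sin t) by lra. Rring.
    - intros t _.
      apply (ex_derive_continuous (fun u => INR (n + 1) * sin u ^ n - INR (n + 2) * sin u ^ (n + 2))).
      auto_derive. auto. }
  assert (B : is_RInt (fun t => INR (n + 1) * sin t ^ n - INR (n + 2) * sin t ^ (n + 2)) 0 (PI / 2)
     (INR (n + 1) * wallis n - INR (n + 2) * wallis (n + 2))).
  { apply (is_RInt_minus (V := R_NormedModule) (fun t => INR (n + 1) * sin t ^ n)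
      (fun t => INR (n + 2) * sin t ^ (n + 2)));
    apply (is_RInt_scal (V := R_NormedModule) (fun t => sin t ^ _));
    apply (RInt_correct (V := R_CompleteNormedModule)), ex_RInt_sin_pow. }
  assert (E := is_RInt_unique _ _ _ _ A). rewrite (is_RInt_unique _ _ _ _ B) in E.
  rewrite sin_0, cos_PI2 in E. unfold minus, plus, opp in E; simpl in E.
  rewrite (pow_i (n + 1)) in E by lia. lra.
Qed.

Lemma wallis_0 : wallis 0 = PI / 2.
Proof.
  unfold wallis. rewrite (RInt_ext _ (fun _ => 1)) by (intros; reflexivity).
  rewrite RInt_const. unfold scal; simpl; unfold mult; simpl. ring.
Qed.

Lemma wallis_1 : wallis 1 = 1.
Proof.
  assert (E : minus (- cos (PI / 2)) (- cos 0) = 1).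
  { rewrite cos_PI2, cos_0. unfold minus, plus, opp; simpl. ring. }
  unfold wallis. rewrite <- E. apply is_RInt_unique.
  apply (is_RInt_derive (fun t => - cos t)).
  - intros t _. auto_derive; auto. simpl. ring.
  - intros t _. apply continuous_sin_pow.
Qed.

Lemma wallis_decr (n : nat) : wallis (S n) <= wallis n.
Proof.
  assert (HP := PI_RGT_0).
  apply RInt_le; [lra|apply ex_RInt_sin_pow|apply ex_RInt_sin_pow|].
  intros t Ht. assert (0 <= sin t) by (apply sin_ge_0; lra).
  generalize (SIN_bound t) (pow_le (sin t) n H). simpl. nra.
Qed.

Lemma wallis_even (m : nat) : wallis (2 * m) = binom_coef (/ 2) m * (PI / 2).
Proof.
  induction m.
  - simpl. rewrite wallis_0. ring.
  - assert (H := wallis_rec (2 * m)). replace (2 * m + 2)%nat with (2 * S m)%nat in H by lia.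
    rewrite IHm in H. cbn [binom_coef].
    rewrite plus_INR, !mult_INR, !S_INR in H. rewrite S_INR. simpl (INR 0) in H.
    generalize (pos_INR m). intro.
    apply Rmult_eq_reg_l with (2 * (INR m + 1)); [|lra].
    replace (2 * (INR m + 1)) with ((0 + 1 + 1) * (INR m + 1)) at 1 by ring.
    rewrite H. field. lra.
Qed.

(** The odd integrals carry the inverse of the coefficient found in the even ones; the product form
    avoids a division. *)
Lemma wallis_odd (m : nat) : wallis (2 * m + 1) * (binom_coef (/ 2) m * (2 * INR m + 1)) = 1.
Proof.
  induction m.
  - simpl. rewrite wallis_1. ring.
  - assert (H := wallis_rec (2 * m + 1)). replace (2 * m + 1 + 2)%nat with (2 * S m + 1)%nat in H by lia.
    cbn [binom_coef].
    rewrite !plus_INR, !mult_INR, S_INR in H. rewrite S_INR. simpl (INR 1) in H. simpl (INR 2) in H.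
    generalize (pos_INR m). intro.
    apply eq_trans with (2 := IHm).
    assert (P : 0 < 2 * INR m + 3) by lra.
    replace (wallis (2 * S m + 1)) with ((2 * INR m + 2) / (2 * INR m + 3) * wallis (2 * m + 1)).
    + field. lra.
    + apply Rmult_eq_reg_l with (2 * INR m + 3); [|lra].
      replace ((2 * INR m + 3) * ((2 * INR m + 2) / (2 * INR m + 3) * wallis (2 * m + 1)))
        with ((2 * INR m + 2) * wallis (2 * m + 1)) by (field; lra).
      rewrite S_INR in H. lra.
Qed.

(** The exponent [1 / 2] belongs to the leading term and lies below the half-integers reached so
    far. The Wallis integrals [W] decrease, [W (2 m + 1) <= W (2 m) <= W (2 m - 1)], and inserting
    their values encloses [m binom_coef (1 / 2) m ^ 2] between [m / (m + 1 / 2) / PI] and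
    [1 / PI]. *)
Lemma gauss_coef_half_lim : is_lim_seq (gauss_coef (/ 2)) (/ sqrt PI).
Proof.
  assert (HP := PI_RGT_0).
  assert (Hsq : is_lim_seq (fun m => gauss_coef (/ 2) m ^ 2) (/ PI)).
  { apply is_lim_seq_le_le_loc with
      (fun m => / PI * ((0 + INR m) / (/ 2 + INR m))) (fun _ => / PI).
    - exists 1%nat. intros m Hm.
      assert (Hm' := le_INR _ _ Hm). simpl (INR 1) in Hm'.
      unfold gauss_coef. replace (1 - / 2) with (/ 2) by field.
      rewrite Rpower_sqrt by lra. rewrite Rpow_mult_distr, pow2_sqrt by lra.
      assert (Ha : 0 < binom_coef (/ 2) m) by (apply binom_coef_pos; lra).
      assert (E1 := wallis_even m). assert (O1 := wallis_odd m).
      assert (D1 := wallis_decr (2 * m)). replace (S (2 * m)) with (2 * m + 1)%nat in D1 by lia.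
      destruct m as [|p]; [lia|].
      assert (D2 := wallis_decr (2 * p + 1)). replace (S (2 * p + 1)) with (2 * S p)%nat in D2 by lia.
      assert (O2 := wallis_odd p).
      (* With [m = p + 1], this expresses the integral of index [2 m - 1] by the coefficient of
         index [m]. *)
      assert (Hap : binom_coef (/ 2) (S p) * (2 * INR (S p)) = binom_coef (/ 2) p * (2 * INR p + 1)).
      { cbn [binom_coef]. rewrite S_INR. generalize (pos_INR p). intro. field. lra. }
      rewrite <- Hap in O2. set (a := binom_coef (/ 2) (S p)) in *.
      set (M := INR (S p)) in *. rewrite E1 in D1, D2.
      assert (P1 : 0 < a * (2 * M + 1)) by (apply Rmult_lt_0_compat; lra).
      assert (P2 : 0 < a * (2 * M)) by (apply Rmult_lt_0_compat; lra).
      assert (Q1 : 1 <= a * (PI / 2) * (a * (2 * M + 1))).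
      { apply Rle_trans with (1 := Req_le _ _ (eq_sym O1)). apply Rmult_le_compat_r; lra. }
      assert (Q2 : a * (PI / 2) * (a * (2 * M)) <= 1).
      { apply Rle_trans with (2 := Req_le _ _ O2). apply Rmult_le_compat_r; lra. }
      split.
      + apply Rmult_le_reg_r with (PI * (2 * M + 1)); [apply Rmult_lt_0_compat; lra|].
        replace (/ PI * ((0 + M) / (/ 2 + M)) * (PI * (2 * M + 1))) with (2 * M * 1) by (field; lra).
        apply Rle_trans with (2 * M * (a * (PI / 2) * (a * (2 * M + 1)))).
        * apply Rmult_le_compat_l; lra.
        * right. field.
      + apply Rmult_le_reg_r with PI; [lra|]. rewrite Rinv_l by lra.
        eapply Rle_trans; [|exact Q2]. right. field.
    - replace (Finite (/ PI)) with (Finite (/ PI * 1)) by (f_equal; ring).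
      apply is_lim_seq_mult'; [apply is_lim_seq_const|apply is_lim_seq_shift_ratio].
    - apply is_lim_seq_const. }
  rewrite <- sqrt_inv.
  apply is_lim_seq_ext with (fun m => sqrt (gauss_coef (/ 2) m ^ 2)).
  - intro m. apply sqrt_pow2. apply Rlt_le, Rmult_lt_0_compat; [apply binom_coef_pos; lra|apply exp_pos].
  - apply is_lim_seq_continuous; [|exact Hsq].
    apply continuity_pt_sqrt. apply Rlt_le, Rinv_0_lt_compat, HP.
Qed.

(** * Euler's constant *)

Definition harmonic (n : nat) : R := sum_n_m (fun k => / INR k) 1 n.

Lemma harmonic_S (n : nat) : harmonic (S n) = harmonic n + / INR (S n).
Proof. unfold harmonic. now rewrite sum_n_Sm by lia. Qed.

Lemma harmonic_0 : harmonic 0 = 0.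
Proof. unfold harmonic. now rewrite sum_n_m_zero by lia. Qed.

Lemma ln_le_minus_1 (y : R) : 0 < y -> ln y <= y - 1.
Proof.
  intro H. generalize (exp_ineq1_le (ln y)). rewrite exp_ln by exact H. lra.
Qed.

Lemma euler_const_lim : is_lim_seq (fun n => harmonic n - ln (INR n)) euler_const.
Proof.
  apply Lim_seq_correct'.
  (* The shift by one matters: with [ln 0 = 0] the sequence is 0 at index 0 and 1 at index 1, so it
     decreases only from index 1 on. *)
  assert (K : ex_finite_lim_seq (fun n => harmonic (S n) - ln (INR (S n)))).
  { apply ex_finite_lim_seq_decr with 0.
    - intro n. rewrite (harmonic_S (S n)).
      assert (P1 : 0 < INR (S n)) by (apply lt_0_INR; lia).
      assert (P2 : 0 < INR (S (S n))) by (apply lt_0_INR; lia).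
      assert (L := ln_le_minus_1 (INR (S n) / INR (S (S n))) ltac:(now apply Rdiv_lt_0_compat)).
      rewrite ln_div in L by auto.
      replace (INR (S n) / INR (S (S n)) - 1) with (- / INR (S (S n))) in L
        by (rewrite (S_INR (S n)); field; rewrite S_INR in P2; lra).
      lra.
    - intro n.
      assert (A : forall k, ln (INR (S k)) <= harmonic k).
      { induction k.
        - rewrite harmonic_0. simpl. rewrite ln_1. lra.
        - rewrite harmonic_S.
          assert (P1 : 0 < INR (S k)) by (apply lt_0_INR; lia).
          assert (P2 : 0 < INR (S (S k))) by (apply lt_0_INR; lia).
          assert (L := ln_le_minus_1 (INR (S (S k)) / INR (S k)) ltac:(now apply Rdiv_lt_0_compat)).
          rewrite ln_div in L by auto.
          replace (INR (S (S k)) / INR (S k) - 1) with (/ INR (S k)) in L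
            by (rewrite (S_INR (S k)); field; lra).
          lra. }
      specialize (A n). rewrite harmonic_S.
      assert (0 < / INR (S n)) by (apply Rinv_0_lt_compat, lt_0_INR; lia). lra. }
  destruct K as [l Hl]. exists l.
  now apply (is_lim_seq_incr_1 (fun n => harmonic n - ln (INR n))).
Qed.

(** [1 / (1 / 2 + j) = 2 / (2 j + 1)], and the reciprocals of the odd numbers below [2 m] sum to
    [H (2 m) - H (m) / 2], where [H] is [harmonic]. *)
Lemma shifted_harmonic_half (m : nat) :
  shifted_harmonic (/ 2) m = 2 * harmonic (2 * m) - harmonic m.
Proof.
  induction m.
  - simpl. rewrite harmonic_0. ring.
  - replace (2 * S m)%nat with (S (S (2 * m))) by lia.
    rewrite !harmonic_S. cbn [shifted_harmonic]. rewrite IHm, !S_INR, mult_INR.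
    simpl (INR 2). generalize (pos_INR m). intro. field. lra.
Qed.

(** The constant [2 ln 2] is [2 ln (2 m) - 2 ln m]. *)
Lemma shifted_harmonic_half_lim :
  is_lim_seq (fun m => shifted_harmonic (/ 2) m - ln (INR m)) (euler_const + 2 * ln 2).
Proof.
  apply is_lim_seq_ext_loc with (fun m =>
    2 * (harmonic (2 * m) - ln (INR (2 * m))) - (harmonic m - ln (INR m)) + 2 * ln 2).
  - exists 1%nat. intros m Hm. apply le_INR in Hm. simpl in Hm.
    rewrite shifted_harmonic_half, mult_INR, ln_mult by (simpl; lra).
    simpl (INR 2). replace (1 + 1) with 2 by ring. ring.
  - replace (euler_const + 2 * ln 2) with (2 * euler_const - euler_const + 2 * ln 2) by ring.
    apply is_lim_seq_plus'; [|apply is_lim_seq_const].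
    apply is_lim_seq_minus'; [|apply euler_const_lim].
    apply is_lim_seq_mult'; [apply is_lim_seq_const|].
    apply (is_lim_seq_subseq (fun n => harmonic n - ln (INR n)) _ (fun m => 2 * m)%nat).
    + apply eventually_subseq. intro; lia.
    + apply euler_const_lim.
Qed.

(** * Elementary bounds *)

Lemma Rinv_le_1 (y : R) : 1 <= y -> / y <= 1.
Proof. intro H. rewrite <- Rinv_1. apply Rinv_le_contravar; lra. Qed.

Lemma pow_le_1 (y : R) (n : nat) : 0 <= y <= 1 -> y ^ n <= 1.
Proof. intro H. rewrite <- (pow1 n). now apply pow_incr. Qed.

Lemma im_le_Cmod (z : C) : Rabs (Im z) <= Cmod z.
Proof. eapply Rle_trans; [apply Rmax_r|apply Rmax_Cmod]. Qed.

Lemma Cmod_le_Re_Im (z : C) : Cmod z <= Rabs (Re z) + Rabs (Im z).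
Proof.
  replace z with (RtoC (Re z) + RtoC (Im z) * Ci)%C at 1.
  - eapply Rle_trans; [apply Cmod_triangle|]. rewrite Cmod_mult, Cmod_Ci, !Cmod_R. lra.
  - destruct z as [a b]. unfold RtoC, Ci, Cplus, Cmult, Re, Im; cbn [fst snd]. f_equal; ring.
Qed.

(** * Exponentials and resolvents *)

(** Mean value inequality by components; the factor 2 comes from bounding a modulus by the sum of
    the absolute values of its two parts. *)
Lemma Cderive_increment (f : R -> C) (f' : R -> C) (M : R) :
  (forall t, 0 <= t <= 1 -> is_Cderive f t (f' t)) ->
  (forall t, 0 <= t <= 1 -> Cmod (f' t) <= M) ->
  Cmod (f 1 - f 0)%C <= 2 * M.
Proof.
  intros Hd HM.
  assert (A : forall (g g' : R -> R), (forall t, 0 <= t <= 1 -> is_derive g t (g' t)) ->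
    (forall t, 0 <= t <= 1 -> Rabs (g' t) <= M) -> Rabs (g 1 - g 0) <= M).
  { intros g g' Hg Hg'. destruct (MVT_gen g 0 1 g') as [t [Ht E]].
    - rewrite Rmin_left, Rmax_right by lra. intros t Ht. apply Hg. lra.
    - rewrite Rmin_left, Rmax_right by lra. intros t Ht.
      apply continuity_pt_filterlim. apply (ex_derive_continuous g). eexists. apply Hg. lra.
    - rewrite Rmin_left, Rmax_right in Ht by lra. rewrite E.
      replace (g' t * (1 - 0)) with (g' t) by ring. now apply Hg'. }
  eapply Rle_trans; [apply Cmod_le_Re_Im|].
  assert (A1 := A (fun u => Re (f u)) (fun u => Re (f' u))
    (fun t Ht => proj1 (Hd t Ht)) (fun t Ht => Rle_trans _ _ _ (re_le_Cmod _) (HM t Ht))).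
  assert (A2 := A (fun u => Im (f u)) (fun u => Im (f' u))
    (fun t Ht => proj2 (Hd t Ht)) (fun t Ht => Rle_trans _ _ _ (im_le_Cmod _) (HM t Ht))).
  cbv beta in A1, A2.
  change (Re (f 1 - f 0)%C) with (Re (f 1) - Re (f 0)).
  change (Im (f 1 - f 0)%C) with (Im (f 1) - Im (f 0)). lra.
Qed.

Lemma Cmod_one_plus_ge (v : C) : 0 <= Re v -> 1 + Re v <= Cmod (1 + v)%C.
Proof.
  intro H. eapply Rle_trans; [|apply re_le_Cmod]. change (Re (1 + v)%C) with (1 + Re v).
  rewrite Rabs_pos_eq; lra.
Qed.

(** The product [exp (- t v) (1 + t v)] has derivative [- t v ^ 2 exp (- t v)], of modulus at most
    [|v| ^ 2] on [[0, 1]]. Its increment is then divided by [1 + v], whose modulus is at least 1. *)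
Lemma Cexp_first_order (v : C) : 0 <= Re v ->
  Cmod (/ (1 + v) - Cexp (- v))%C <= 2 * Cmod v ^ 2.
Proof.
  intro Hv.
  assert (H1 := Cmod_one_plus_ge v Hv).
  assert (N : (1 + v)%C <> 0) by (apply Cmod_gt_0; lra).
  assert (B := Cderive_increment (fun t : R => Cexp (- v * t) * (1 + t * v))%C
    (fun t : R => - (t * v ^ 2) * Cexp (- v * t))%C (Cmod v ^ 2)).
  lapply B; clear B; [intro B; lapply B; clear B; [intro B|]|].
  - cbv beta in B.
    replace (Cexp (- v * 1) * (1 + 1 * v) - Cexp (- v * 0) * (1 + 0 * v))%C
      with ((1 + v) * - (/ (1 + v) - Cexp (- v)))%C in B.
    + rewrite Cmod_mult, Cmod_opp in B.
      assert (0 <= Cmod (/ (1 + v) - Cexp (- v))%C) by apply Cmod_ge_0. nra.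
    + replace (- v * 0)%C with (RtoC 0) by ring. replace (- v * 1)%C with (- v)%C by ring.
      rewrite Cexp_0. field. exact N.
  - intros t Ht. rewrite !Cmod_mult, Cmod_opp, Cmod_mult, Cmod_pow, Cmod_R, Cmod_Cexp.
    rewrite Rabs_pos_eq by lra.
    assert (E : exp (Re (- v * t)%C) <= 1).
    { rewrite <- exp_0. apply exp_le_compat. destruct v as [a b].
      unfold Re, Cmult, Copp, RtoC in *; cbn [fst snd] in *. nra. }
    assert (0 < exp (Re (- v * t)%C)) by apply exp_pos.
    assert (0 <= Cmod v ^ 2) by (apply pow_le, Cmod_ge_0).
    assert (t * Cmod v ^ 2 <= Cmod v ^ 2) by nra.
    assert (0 <= t * Cmod v ^ 2) by nra. nra.
  - intros t Ht.
    assert (L : is_Cderive (fun u : R => - v * u)%C t (- v)%C).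
    { destruct v as [a b]; split; unfold Re, Im; cbn; auto_derive; auto; ring. }
    assert (L' : is_Cderive (fun u : R => 1 + u * v)%C t v).
    { destruct v as [a b]; split; unfold Re, Im; cbn; auto_derive; auto; ring. }
    eapply is_Cderive_eq.
    + apply is_Cderive_mult; [apply is_Cderive_Cexp, L|apply L'].
    + cbv beta. ring.
Qed.

Lemma Cpow_diff (a b : C) (n : nat) :
  Cmod a <= 1 -> Cmod b <= 1 -> Cmod (a ^ n - b ^ n)%C <= INR n * Cmod (a - b)%C.
Proof.
  intros Ha Hb. induction n.
  - simpl. replace (1 - 1)%C with (RtoC 0) by ring. rewrite Cmod_0. lra.
  - rewrite S_INR, !Cpow_S.
    replace (a * a ^ n - b * b ^ n)%C with (a * (a ^ n - b ^ n) + (a - b) * b ^ n)%C by ring.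
    eapply Rle_trans; [apply Cmod_triangle|]. rewrite !Cmod_mult, Cmod_pow.
    assert (P1 : Cmod b ^ n <= 1) by (apply pow_le_1; split; [apply Cmod_ge_0|exact Hb]).
    assert (P2 : 0 <= Cmod b ^ n) by (apply pow_le, Cmod_ge_0).
    generalize (Cmod_ge_0 a) (Cmod_ge_0 (a - b)%C) (Cmod_ge_0 (a ^ n - b ^ n)%C). intros. nra.
Qed.

(** With [v = u / m], the factors [1 / (1 + v)] and [exp (- v)] lie in the unit disc and differ by
    [O (1 / m ^ 2)], so their [m]-th powers differ by [O (1 / m)]. The one extra factor in the
    exponent [m + 1] costs another [O (1 / m)]. *)
Lemma Cexp_euler_limit (u : C) : 0 <= Re u ->
  Clim (fun m => (/ (1 + u / INR m)) ^ S m)%C (Cexp (- u)).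
Proof.
  intro Hu.
  apply squeeze_0_loc with (fun m => (Cmod u + 2 * Cmod u ^ 2) * / INR m) 1%nat.
  - intros m Hm. split; [apply Cmod_ge_0|].
    apply le_INR in Hm. simpl (INR 1) in Hm.
    assert (NC : RtoC (INR m) <> 0) by (intro E; apply RtoC_inj in E; lra).
    set (v := (u / INR m)%C).
    assert (Ev : (RtoC (INR m) * v)%C = u) by (unfold v; field; exact NC).
    assert (Hv : 0 <= Re v).
    { rewrite <- Ev in Hu. destruct v as [a b]. unfold Re, Cmult, RtoC in *; cbn [fst snd] in *.
      apply Rmult_le_reg_l with (INR m); lra. }
    assert (Mv : Cmod v = Cmod u * / INR m).
    { rewrite <- Ev, Cmod_mult, Cmod_R, Rabs_pos_eq by lra. field. lra. }
    assert (H1 := Cmod_one_plus_ge v Hv).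
    assert (N : (1 + v)%C <> 0) by (apply Cmod_gt_0; lra).
    set (a := (/ (1 + v))%C). set (b := Cexp (- v)).
    assert (Ha : Cmod a <= 1).
    { unfold a. rewrite Cmod_inv by exact N. apply Rinv_le_1; lra. }
    assert (Hb : Cmod b <= 1).
    { unfold b. rewrite Cmod_Cexp, <- exp_0. apply exp_le_compat.
      change (Re (- v)%C) with (- Re v). lra. }
    assert (Eb : Cexp (- u) = (b ^ m)%C).
    { unfold b. rewrite <- Cexp_nat, <- Ev. f_equal. ring. }
    rewrite Eb, Cpow_S.
    replace (a * a ^ m - b ^ m)%C with ((a - 1) * a ^ m + (a ^ m - b ^ m))%C by ring.
    eapply Rle_trans; [apply Cmod_triangle|]. rewrite Cmod_mult, Cmod_pow.
    assert (A1 : Cmod (a - 1)%C <= Cmod v).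
    { replace (a - 1)%C with (- v * a)%C by (unfold a; field; exact N).
      rewrite Cmod_mult, Cmod_opp. generalize (Cmod_ge_0 v) (Cmod_ge_0 a). nra. }
    assert (A2 := Cpow_diff a b m Ha Hb).
    assert (A3 : Cmod (a - b)%C <= 2 * Cmod v ^ 2) by now apply Cexp_first_order.
    assert (P1 : Cmod a ^ m <= 1) by (apply pow_le_1; split; [apply Cmod_ge_0|exact Ha]).
    assert (P2 : 0 <= Cmod a ^ m) by (apply pow_le, Cmod_ge_0).
    assert (A4 : INR m * Cmod (a - b)%C <= 2 * Cmod u ^ 2 * / INR m).
    { apply Rle_trans with (INR m * (2 * Cmod v ^ 2)).
      - apply Rmult_le_compat_l; lra.
      - rewrite Mv. right. field. lra. }
    assert (A5 : Cmod (a - 1)%C * Cmod a ^ m <= Cmod u * / INR m).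
    { rewrite <- Mv. generalize (Cmod_ge_0 (a - 1)%C) (Cmod_ge_0 v). nra. }
    lra.
  - replace (Finite 0) with (Finite ((Cmod u + 2 * Cmod u ^ 2) * 0)) by (f_equal; ring).
    apply is_lim_seq_mult'; [apply is_lim_seq_const|].
    replace (Finite 0) with (Rbar_inv p_infty) by reflexivity.
    apply is_lim_seq_inv; [apply is_lim_seq_INR|discriminate].
Qed.

(** * Series of resolvents *)

Definition Cseries (u : nat -> C) : C :=
  (Series (fun k => Re (u k)), Series (fun k => Im (u k))).

Lemma Cseries_correct (u : nat -> C) (M : nat -> R) :
  (forall k, Cmod (u k) <= M k) -> ex_series M ->
  is_series u (Cseries u) /\ Cmod (Cseries u) <= Series M.
Proof.
  intros Hu HM.
  assert (S : is_series u (Cseries u)).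
  { apply is_Cseries_pair; apply Series_correct;
      apply (ex_series_le (V := R_CompleteNormedModule) _ M); auto; intro k;
      change (norm ?x) with (Rabs x); eapply Rle_trans; [|apply Hu| |apply Hu].
    - apply re_le_Cmod.
    - apply im_le_Cmod. }
  split; [exact S|]. destruct (is_Cseries_abs u M Hu HM) as [l [Hl Hb]].
  now rewrite (is_Cseries_unique _ _ _ S Hl).
Qed.

(** The product form separates [b] from [v]: up to the factor [1 / (1 - |v|)], the resolvents are
    dominated by [1 / (1 + Re b)], which is summable over the sequence. *)
Lemma Cmod_resolvent_ge (b v : C) : 0 < Re b -> Cmod v < 1 ->
  (1 - Cmod v) * (1 + Re b) <= Cmod (1 + b - v)%C.
Proof.
  intros Hb Hv. eapply Rle_trans; [|apply re_le_Cmod].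
  change (Re (1 + b - v)%C) with (1 + Re b - Re v).
  generalize (re_le_Cmod v) (Cmod_ge_0 v). intros K K'. apply Rabs_le_between in K.
  rewrite Rabs_pos_eq; nra.
Qed.

Lemma resolvent_geom (b v : C) (n : nat) : (1 + b)%C <> 0 -> (1 + b - v)%C <> 0 ->
  (/ (1 + b - v) - sum_n (fun l => (/ (1 + b)) ^ S l * v ^ l) n)%C
  = ((v / (1 + b)) ^ S n * / (1 + b - v))%C.
Proof.
  intros N1 N2.
  assert (E := geom_sum (v / (1 + b)) n).
  assert (E2 : sum_n (fun l => (/ (1 + b)) ^ S l * v ^ l)%C n
     = (/ (1 + b) * sum_n (fun l => (v / (1 + b)) ^ l) n)%C).
  { rewrite <- Csum_n_mult_l. apply sum_n_ext. intro l. unfold Cdiv.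
    rewrite Cpow_mult_l, Cpow_S. Cring. }
  rewrite E2.
  replace (/ (1 + b) * sum_n (fun l => (v / (1 + b)) ^ l) n)%C with
    (/ (1 + b - v) * ((1 - v / (1 + b)) * sum_n (fun l => (v / (1 + b)) ^ l) n))%C.
  - rewrite E. ring.
  - Cfield. split; [exact N1|exact N2].
Qed.

Lemma resolvent_bound (b : C) (l : nat) : 0 < Re b ->
  Cmod ((/ (1 + b)) ^ S l)%C <= / (1 + Re b).
Proof.
  intro Hb. assert (H := Cmod_one_plus_ge b (Rlt_le _ _ Hb)).
  assert (N : (1 + b)%C <> 0) by (apply Cmod_gt_0; lra).
  rewrite Cmod_pow, Cmod_inv by exact N.
  assert (I : / Cmod (1 + b)%C <= / (1 + Re b)) by (apply Rinv_le_contravar; lra).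
  assert (P : 0 < / Cmod (1 + b)%C) by (apply Rinv_0_lt_compat; lra).
  assert (Q : / Cmod (1 + b)%C <= 1) by (apply Rinv_le_1; lra).
  cbn [pow]. assert ((/ Cmod (1 + b)%C) ^ l <= 1).
  { apply pow_le_1. lra. }
  assert (0 <= (/ Cmod (1 + b)%C) ^ l) by (apply pow_le; lra). nra.
Qed.

(** The sums over [k] and [l] are interchanged through the exact remainder of the geometric series:
    after the terms up to [n], the error is at most [|v| ^ (n + 1)] times a convergent sum over
    [k]. *)
Lemma resolvent_series (b : nat -> C) (v F : C) :
  (forall k, 0 < Re (b k)) -> ex_series (fun k => / (1 + Re (b k))) -> Cmod v < 1 ->
  is_series (fun k => / (1 + b k - v))%C F ->
  is_series (fun l => Cseries (fun k => (/ (1 + b k)) ^ S l) * v ^ l)%C F.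
Proof.
  intros Hb Hs Hv HF.
  assert (N1 : forall k, (1 + b k)%C <> 0).
  { intro k. apply Cmod_gt_0. generalize (Cmod_one_plus_ge (b k) (Rlt_le _ _ (Hb k))) (Hb k). lra. }
  assert (HB : forall k, 0 < (1 - Cmod v) * (1 + Re (b k))).
  { intro k. specialize (Hb k). apply Rmult_lt_0_compat; lra. }
  assert (N2 : forall k, (1 + b k - v)%C <> 0).
  { intro k. apply Cmod_gt_0. generalize (Cmod_resolvent_ge (b k) v (Hb k) Hv) (HB k). lra. }
  set (M := fun k => / (1 + Re (b k)) * / (1 - Cmod v)).
  assert (HM : ex_series M) by now apply ex_series_scal_r.
  apply is_Cseries_iff. unfold Clim.
  apply squeeze_0 with (fun n => Cmod v ^ S n * Series M).
  - intro n. split; [apply Cmod_ge_0|]. rewrite Cmod_minus_sym.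
    set (c := fun l => Cseries (fun k => (/ (1 + b k)) ^ S l)%C).
    assert (Hc : forall l, is_series (fun k => (/ (1 + b k)) ^ S l)%C (c l)).
    { intro l. apply (Cseries_correct _ (fun k => / (1 + Re (b k)))); auto.
      intro k. now apply resolvent_bound. }
    assert (HS : is_series (fun k => / (1 + b k - v)
        - sum_n (fun l => (/ (1 + b k)) ^ S l * v ^ l) n)%C
        (F - sum_n (fun l => c l * v ^ l) n)%C).
    { apply is_Cseries_minus; [exact HF|].
      apply (is_Cseries_sum_n (fun l k => (/ (1 + b k)) ^ S l * v ^ l)%C (fun l => c l * v ^ l)%C).
      intros l _. rewrite Cmult_comm.
      apply is_Cseries_ext with (fun k => v ^ l * (/ (1 + b k)) ^ S l)%C.
      - intro k. Cring.
      - apply is_Cseries_scal, Hc. }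
    destruct (is_Cseries_abs (fun k => / (1 + b k - v)
        - sum_n (fun l => (/ (1 + b k)) ^ S l * v ^ l) n)%C
        (fun k => Cmod v ^ S n * M k)) as [G [HG HGb]].
    + intro k. rewrite resolvent_geom by auto.
      rewrite Cmod_mult, Cmod_pow, Cmod_inv by auto. unfold Cdiv. rewrite Cmod_mult, Cmod_inv by auto.
      assert (A1 := Cmod_one_plus_ge (b k) (Rlt_le _ _ (Hb k))).
      assert (A2 := Cmod_resolvent_ge (b k) v (Hb k) Hv).
      specialize (Hb k). specialize (HB k).
      apply Rmult_le_compat.
      * apply pow_le, Rmult_le_pos; [apply Cmod_ge_0|apply Rlt_le, Rinv_0_lt_compat; lra].
      * apply Rlt_le, Rinv_0_lt_compat. lra.
      * apply pow_incr. split.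
        -- apply Rmult_le_pos; [apply Cmod_ge_0|apply Rlt_le, Rinv_0_lt_compat; lra].
        -- assert (/ Cmod (1 + b k)%C <= 1) by (apply Rinv_le_1; lra).
           generalize (Cmod_ge_0 v). nra.
      * unfold M. rewrite <- Rinv_mult, (Rmult_comm (1 + Re (b k))).
        apply Rinv_le_contravar; [exact HB|exact A2].
    + now apply (ex_series_scal_l (V := R_NormedModule)).
    + assert (E := is_Cseries_unique _ _ _ HS HG). unfold c in E. rewrite E.
      eapply Rle_trans; [exact HGb|]. rewrite Series_scal_l. apply Rle_refl.
  - replace (Finite 0) with (Finite (0 * Series M)) by (f_equal; ring).
    apply is_lim_seq_mult'; [|apply is_lim_seq_const].
    apply (is_lim_seq_incr_1 (fun n => Cmod v ^ n)). apply is_lim_seq_geom.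
    rewrite Rabs_pos_eq; auto using Cmod_ge_0.
Qed.

(** * Principal logarithm, and power series on a circle *)

Lemma Clog_Cexp (u : C) : - PI < Im u < PI -> Clog (Cexp u) = u.
Proof.
  intro H. unfold Clog. rewrite Cmod_Cexp, ln_exp.
  assert (E : Carg (Cexp u) = Im u).
  { unfold Carg. rewrite Cmod_Cexp.
    assert (P := exp_pos (Re u)).
    replace (Re (Cexp u) / exp (Re u)) with (cos (Im u)).
    2:{ unfold Cexp; cbn. field. lra. }
    destruct (Rle_dec 0 (Im (Cexp u))) as [Hi|Hi]; unfold Cexp in Hi; cbn in Hi.
    - apply acos_cos. split; [|lra]. apply Rnot_lt_le. intro K.
      assert (0 < sin (- Im u)) by (apply sin_gt_0; lra). rewrite sin_neg in *. nra.
    - rewrite <- (cos_neg (Im u)), acos_cos; [ring|].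
      split; [|lra]. apply Rnot_lt_le. intro K.
      assert (0 < sin (Im u)) by (apply sin_gt_0; lra). nra. }
  rewrite E. destruct u; reflexivity.
Qed.

Lemma Carg_Cexp (u : C) : - PI < Im u < PI -> Carg (Cexp u) = Im u.
Proof. intro H. exact (f_equal snd (Clog_Cexp u H)). Qed.

(** One circle is enough, the one on which Cauchy's estimate is taken; absolute summability is
    included because the means over roots of unity rest on it. *)
Definition has_power_series (q : R) (H : C -> C) (h : nat -> C) : Prop :=
  ex_series (fun l => Cmod (h l) * q ^ l) /\
  forall v, Cmod v = q -> is_series (fun l => h l * v ^ l)%C (H v).

Lemma has_power_series_plus (q : R) (H G : C -> C) (h g : nat -> C) : 0 <= q ->
  has_power_series q H h -> has_power_series q G g ->
  has_power_series q (fun v => H v + G v)%C (fun l => h l + g l)%C.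
Proof.
  intros Hq [H1 H2] [G1 G2]. split.
  - apply (ex_series_le (V := R_CompleteNormedModule) _
      (fun l => Cmod (h l) * q ^ l + Cmod (g l) * q ^ l)).
    + intro l. change (norm ?x) with (Rabs x).
      assert (0 <= q ^ l) by now apply pow_le.
      rewrite Rabs_pos_eq by (apply Rmult_le_pos; [apply Cmod_ge_0|auto]).
      rewrite <- Rmult_plus_distr_r. apply Rmult_le_compat_r; [auto|apply Cmod_triangle].
    + now apply (ex_series_plus (V := R_NormedModule)).
  - intros v Hv. apply is_Cseries_ext with (fun l => h l * v ^ l + g l * v ^ l)%C.
    + intro. Cring.
    + apply is_Cseries_plus; auto.
Qed.

Lemma has_power_series_scal (q : R) (c : C) (H : C -> C) (h : nat -> C) :
  has_power_series q H h ->
  has_power_series q (fun v => c * H v)%C (fun l => c * h l)%C.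
Proof.
  intros [H1 H2]. split.
  - apply ex_series_ext with (fun l => Cmod c * (Cmod (h l) * q ^ l)).
    + intro l. rewrite Cmod_mult. Rring.
    + now apply (ex_series_scal_l (V := R_NormedModule)).
  - intros v Hv. apply is_Cseries_ext with (fun l => c * (h l * v ^ l))%C.
    + intro. Cring.
    + apply is_Cseries_scal; auto.
Qed.

Lemma has_power_series_minus (q : R) (H G : C -> C) (h g : nat -> C) : 0 <= q ->
  has_power_series q H h -> has_power_series q G g ->
  has_power_series q (fun v => H v - G v)%C (fun l => h l - g l)%C.
Proof.
  intros Hq HH HG.
  destruct (has_power_series_plus q H _ h _ Hq HH (has_power_series_scal q (- (1))%C G g HG)) as [A B].
  split.
  - eapply ex_series_ext; [|exact A]. intro l. cbv beta.
    now replace (h l - g l)%C with (h l + - (1) * g l)%C by ring.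
  - intros v Hv. specialize (B v Hv).
    replace (H v - G v)%C with (H v + - (1) * G v)%C by ring.
    eapply is_Cseries_ext; [|exact B]. intro l. cbv beta. Cring.
Qed.

Lemma has_power_series_sum_n (q : R) (H : nat -> C -> C) (h : nat -> nat -> C) (N : nat) :
  0 <= q -> (forall n, (n <= N)%nat -> has_power_series q (H n) (h n)) ->
  has_power_series q (fun v => sum_n (fun n => H n v) N) (fun l => sum_n (fun n => h n l) N).
Proof.
  intros Hq. induction N; intro HH.
  - destruct (HH 0%nat (le_n _)) as [A B]. split.
    + eapply ex_series_ext; [|exact A]. intro l. cbv beta. now rewrite sum_O.
    + intros v Hv. specialize (B v Hv). rewrite sum_O.
      eapply is_Cseries_ext; [|exact B]. intro l. cbv beta. now rewrite sum_O.
  - assert (IH := IHN ltac:(intros; apply HH; lia)).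
    destruct (has_power_series_plus q _ _ _ _ Hq IH (HH (S N) (le_n _))) as [A B]. split.
    + eapply ex_series_ext; [|exact A]. intro l. cbv beta. now rewrite sum_Sn.
    + intros v Hv. specialize (B v Hv). rewrite sum_Sn.
      eapply is_Cseries_ext; [|exact B]. intro l. cbv beta. now rewrite sum_Sn.
Qed.

Lemma binomial_has_power_series (nu q : R) : 0 < nu -> 0 < q < 1 ->
  has_power_series q (fun v => Cexp (- nu * RHlog (1 - v))%C) (fun l => RtoC (binom_coef nu l)).
Proof.
  intros Hn Hq. split.
  - eapply ex_series_ext; [|apply (ex_series_binom nu q Hn Hq)].
    intro l. cbv beta. rewrite Cmod_R, Rabs_pos_eq; [reflexivity|apply Rlt_le, binom_coef_pos, Hn].
  - intros v Hv. apply binomial_series; [auto|lra].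
Qed.

Lemma log_binomial_has_power_series (nu q : R) : 0 < nu -> 0 < q < 1 ->
  has_power_series q (fun v => - RHlog (1 - v) * Cexp (- nu * RHlog (1 - v)))%C
    (fun l => RtoC (log_binom_coef nu l)).
Proof.
  intros Hn Hq. split.
  - apply (ex_series_le (V := R_CompleteNormedModule) _ (fun l => binom_coef (nu + 1) l * q ^ l)).
    + intro l. change (norm ?x) with (Rabs x).
      destruct (log_binom_coef_bounds nu l Hn) as [A B].
      rewrite Cmod_R, (Rabs_pos_eq (log_binom_coef nu l)) by exact A.
      assert (0 <= q ^ l) by (apply pow_le; lra).
      rewrite Rabs_pos_eq by now apply Rmult_le_pos. now apply Rmult_le_compat_r.
    + apply ex_series_binom; lra.
  - intros v Hv. apply log_binomial_series; [auto|lra].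
Qed.

Lemma resolvent_has_power_series (q : R) (b : nat -> C) (F : C -> C) : 0 < q < 1 ->
  (forall k, 0 < Re (b k)) -> ex_series (fun k => / (1 + Re (b k))) ->
  (forall v, Cmod v = q -> is_series (fun k => / (1 + b k - v))%C (F v)) ->
  has_power_series q F (fun l => Cseries (fun k => (/ (1 + b k)) ^ S l)%C).
Proof.
  intros Hq Hb Hs HF. split.
  - apply (ex_series_le (V := R_CompleteNormedModule) _
      (fun l => Series (fun k => / (1 + Re (b k))) * q ^ l)).
    + intro l. change (norm ?x) with (Rabs x).
      assert (0 <= q ^ l) by (apply pow_le; lra).
      rewrite Rabs_pos_eq by (apply Rmult_le_pos; [apply Cmod_ge_0|auto]).
      apply Rmult_le_compat_r; [auto|].
      apply (Cseries_correct _ (fun k => / (1 + Re (b k)))); auto.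
      intro k. now apply resolvent_bound.
    + apply (ex_series_scal_l (V := R_NormedModule)). apply ex_series_geom.
      rewrite Rabs_pos_eq; lra.
  - intros v Hv. apply resolvent_series; auto. lra.
Qed.

(** * The square root of s (1 - v) *)

(** Defined through the logarithm, so that [Clog], [Carg] and all powers of the point are read off
    the exponent. *)
Definition sqrt_pt (s : R) (v : C) : C := Cexp (RtoC (/ 2) * (RtoC (ln s) + RHlog (1 - v)))%C.

Lemma sqrt_pt_sq (s : R) (v : C) : 0 < s -> Cmod v < 1 ->
  (sqrt_pt s v ^ 2)%C = (s * (1 - v))%C.
Proof.
  intros Hs Hv. unfold sqrt_pt. rewrite <- Cexp_nat.
  replace (INR 2 * (RtoC (/ 2) * (ln s + RHlog (1 - v))))%C with (ln s + RHlog (1 - v))%C.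
  - rewrite Cexp_plus, Cexp_RtoC, exp_ln by auto. now rewrite Cexp_RHlog_one_minus.
  - rewrite Cmult_assoc, <- RtoC_mult.
    replace (INR 2 * / 2) with 1 by (simpl; field). ring.
Qed.

Lemma Im_sqrt_pt (s : R) (v : C) :
  Rabs (Im (RtoC (/ 2) * (RtoC (ln s) + RHlog (1 - v)))%C) < PI / 4.
Proof.
  unfold RHlog. set (t := Im (1 - v)%C / Re (1 - v)%C).
  replace (Im _) with (/ 2 * atan t).
  2:{ unfold RtoC, Im, Cmult, Cplus; cbn [fst snd]. ring. }
  generalize (atan_bound t). intro K. apply Rabs_def1; lra.
Qed.

(** No multiple of [2 PI] intervenes, since half the argument of a point of the right half-plane is
    below [PI / 4] in absolute value. *)
Lemma Clog_sqrt_pt (s : R) (v : C) :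
  Clog (sqrt_pt s v / (2 * PI))%C
  = (RtoC (/ 2) * (RtoC (ln s) + RHlog (1 - v)) - ln (2 * PI))%C.
Proof.
  assert (HP := PI_RGT_0).
  assert (B := Im_sqrt_pt s v). apply Rabs_def2 in B.
  rewrite <- Clog_Cexp.
  - f_equal. unfold sqrt_pt, Cminus. rewrite Cexp_plus, Cexp_opp, Cexp_RtoC, exp_ln by lra.
    rewrite RtoC_mult. reflexivity.
  - set (w := (_ * _)%C) in *. change (Im (w - ln (2 * PI))%C) with (Im w - 0). lra.
Qed.

(** Written as [PI / 2 - eps] with [eps = PI / 4], the sector in which the expansion is invoked. *)
Lemma Carg_sqrt_pt (s : R) (v : C) : Rabs (Carg (sqrt_pt s v)) <= PI / 2 - PI / 4.
Proof.
  assert (HP := PI_RGT_0). assert (B := Im_sqrt_pt s v). unfold sqrt_pt.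
  rewrite Carg_Cexp; [lra|]. apply Rabs_def2 in B. lra.
Qed.

(** [z ^ 2 = s (1 - v)] has positive real part, so [(Im z) ^ 2 < (Re z) ^ 2]. This converts a lower
    bound for [|z|] into one for [Re z], as the half-plane [Re z > c] demands. *)
Lemma Re_sqrt_pt (s : R) (v : C) : 0 < s -> Cmod v < 1 ->
  0 < Re (sqrt_pt s v) /\ Cmod (sqrt_pt s v) ^ 2 <= 2 * Re (sqrt_pt s v) ^ 2.
Proof.
  intros Hs Hv. split.
  - assert (HP := PI_RGT_0). assert (B := Im_sqrt_pt s v). apply Rabs_def2 in B.
    unfold sqrt_pt. set (w := (_ * _)%C) in *.
    change (Re (Cexp w)) with (exp (Re w) * cos (Im w)).
    apply Rmult_lt_0_compat; [apply exp_pos|apply cos_gt_0; lra].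
  - assert (E := sqrt_pt_sq s v Hs Hv). rewrite Cmod2_alt.
    assert (P := Re_one_minus_pos v Hv). set (z := sqrt_pt s v) in *. clearbody z.
    assert (E' : Re (z ^ 2)%C = s * Re (1 - v)%C).
    { rewrite E. unfold Re, Cmult, RtoC; cbn [fst snd]. ring. }
    replace (Re (z ^ 2)%C) with (Re z ^ 2 - Im z ^ 2) in E'.
    + nra.
    + destruct z as [c d]. unfold Re, Im; cbn. ring.
Qed.

Lemma Cmod_sqrt_pt (s : R) (v : C) : 0 < s -> Cmod v < 1 ->
  Cmod (sqrt_pt s v) ^ 2 = s * Cmod (1 - v)%C.
Proof.
  intros Hs Hv. rewrite <- Cmod_pow, sqrt_pt_sq by auto.
  rewrite Cmod_mult, Cmod_R, Rabs_pos_eq; lra.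
Qed.

Lemma sqrt_pt_inv_pow (s : R) (v : C) (n : nat) : 0 < s ->
  (/ sqrt_pt s v ^ S n)%C =
  (RtoC (Rpower s (- ((INR n + 1) / 2))) * Cexp (- RtoC ((INR n + 1) / 2) * RHlog (1 - v)))%C.
Proof.
  intro Hs. unfold sqrt_pt, Rpower.
  rewrite <- Cexp_nat, <- Cexp_opp, <- Cexp_RtoC, <- Cexp_plus. f_equal.
  rewrite S_INR. unfold Rdiv. rewrite !RtoC_mult, !RtoC_opp, !RtoC_mult, !RtoC_plus. ring.
Qed.

(* The [m]-th coefficient, in powers of [v], of [s / z] times
   [1 / 2 log (z / (2 PI)) + sum_(n <= M) a_n / z ^ n], [z ^ 2 = s (1 - v)]. *)
Definition model_coef (a : nat -> R) (M : nat) (s : R) (m : nat) : R :=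
  Rpower s (/ 2) * binom_coef (/ 2) m * (ln s / 4 - ln (2 * PI) / 2 - shifted_harmonic (/ 2) m / 4)
  + sum_n (fun n => a n * (Rpower s (1 - (INR n + 1) / 2) * binom_coef ((INR n + 1) / 2) m)) M.

Lemma RtoC_sum_n (u : nat -> R) (n : nat) : RtoC (sum_n u n) = sum_n (fun k => RtoC (u k)) n.
Proof.
  induction n; [now rewrite !sum_O|]. rewrite !sum_Sn, <- IHn. apply RtoC_plus.
Qed.

Lemma Rpower_half_split (s : R) (n : nat) : 0 < s ->
  Rpower s (1 - (INR n + 1) / 2) = s * Rpower s (- ((INR n + 1) / 2)).
Proof.
  intro Hs. rewrite <- (Rpower_1 s Hs) at 2. rewrite <- Rpower_plus. reflexivity.
Qed.

Lemma model_power_series (a : nat -> R) (M : nat) (s q : R) : 0 < s -> 0 < q < 1 ->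
  has_power_series q
    (fun v => s / sqrt_pt s v * (RtoC (1 / 2) * Clog (sqrt_pt s v / (2 * PI))
        + sum_n (fun n => a n / sqrt_pt s v ^ n) M))%C
    (fun l => RtoC (model_coef a M s l)).
Proof.
  intros Hs Hq.
  (* As [s / z = s ^ (1 / 2) (1 - v) ^ (- 1 / 2)] and [log z = (ln s + log (1 - v)) / 2], the
     logarithmic term splits into a multiple [cA] of the binomial series and [- cB] times the series
     of [- log (1 - v) (1 - v) ^ (- 1 / 2)]. *)
  set (cA := Rpower s (/ 2) * (ln s / 4 - ln (2 * PI) / 2)).
  set (cB := Rpower s (/ 2) / 4).
  set (c := fun n => a n * Rpower s (1 - (INR n + 1) / 2)).
  assert (Hnu : forall n, 0 < (INR n + 1) / 2) by (intro n; generalize (pos_INR n); lra).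
  assert (P := has_power_series_plus q _ _ _ _ (Rlt_le _ _ (proj1 Hq))
    (has_power_series_minus q _ _ _ _ (Rlt_le _ _ (proj1 Hq))
      (has_power_series_scal q cA _ _ (binomial_has_power_series (/ 2) q ltac:(lra) Hq))
      (has_power_series_scal q cB _ _ (log_binomial_has_power_series (/ 2) q ltac:(lra) Hq)))
    (has_power_series_sum_n q _ _ M (Rlt_le _ _ (proj1 Hq)) (fun n _ =>
      has_power_series_scal q (c n) _ _ (binomial_has_power_series ((INR n + 1) / 2) q (Hnu n) Hq)))).
  destruct P as [P1 P2].
  assert (Ec : forall l, (cA * binom_coef (/ 2) l - cB * log_binom_coef (/ 2) l
     + sum_n (fun n => c n * binom_coef ((INR n + 1) / 2) l) M)%C = RtoC (model_coef a M s l)).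
  { intro l. unfold model_coef. rewrite RtoC_plus. f_equal.
    - unfold cA, cB, log_binom_coef. rewrite <- !RtoC_mult, <- RtoC_minus. f_equal. field.
    - rewrite RtoC_sum_n. apply sum_n_ext. intro n. unfold c. rewrite <- RtoC_mult. f_equal. ring. }
  split.
  - eapply ex_series_ext; [|exact P1]. intro l. cbv beta. rewrite Ec. reflexivity.
  - intros v Hv. specialize (P2 v Hv).
    assert (N : sqrt_pt s v <> 0) by apply Cexp_neq_0.
    assert (I : forall n, (s / sqrt_pt s v * (a n / sqrt_pt s v ^ n))%C
      = (c n * Cexp (- RtoC ((INR n + 1) / 2) * RHlog (1 - v)))%C).
    { intro n. unfold c. rewrite RtoC_mult, Rpower_half_split, RtoC_mult by auto.
      replace (a n * (s * Rpower s (- ((INR n + 1) / 2))) * Cexp (- RtoC ((INR n + 1) / 2) * RHlog (1 - v)))%C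
        with (a n * s * (Rpower s (- ((INR n + 1) / 2)) * Cexp (- RtoC ((INR n + 1) / 2) * RHlog (1 - v))))%C by ring.
      rewrite <- sqrt_pt_inv_pow by auto. rewrite Cpow_S. field.
      split; [now apply Cpow_nz|exact N]. }
    assert (J : (s / sqrt_pt s v)%C = (Rpower s (/ 2) * Cexp (- RtoC (/ 2) * RHlog (1 - v)))%C).
    { assert (K := sqrt_pt_inv_pow s v 0 Hs).
      replace (sqrt_pt s v ^ 1)%C with (sqrt_pt s v) in K by (simpl; ring).
      unfold Cdiv. rewrite K. simpl INR. replace ((0 + 1) / 2) with (/ 2) by field.
      replace (Rpower s (/ 2)) with (s * Rpower s (- / 2)).
      - rewrite RtoC_mult. ring.
      - rewrite <- (Rpower_1 s Hs) at 1. rewrite <- Rpower_plus. f_equal. field. }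
    match type of P2 with is_series ?u _ => apply is_Cseries_ext with u end;
      [intro l; cbv beta; now rewrite Ec|].
    match type of P2 with is_series _ ?L => match goal with |- is_series _ ?L' => replace L' with L end end.
    + exact P2.
    + rewrite Cmult_plus_distr_l. f_equal.
      * rewrite Clog_sqrt_pt.
        replace (s / sqrt_pt s v)%C with (Rpower s (/ 2) * Cexp (- RtoC (/ 2) * RHlog (1 - v)))%C by (now rewrite J).
        unfold cA, cB. set (D := Cexp _). set (L := RHlog _).
        rewrite RtoC_mult, RtoC_minus. unfold Rdiv. rewrite !RtoC_mult.
        rewrite !RtoC_inv by lra. field.
      * rewrite <- Csum_n_mult_l. apply sum_n_ext. intro n. symmetry. apply I.
Qed.

(** * Uniform bound for the coefficients *)

Lemma pow_ratio_le_6 (m : nat) : (2 <= m)%nat -> / ((INR m - 1) / INR m) ^ m <= 6.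
Proof.
  intro Hm. destruct m as [|[|p]]; try lia.
  assert (Hp : 1 <= INR (S p)) by (rewrite S_INR; generalize (pos_INR p); lra).
  rewrite (S_INR (S p)). replace (INR (S p) + 1 - 1) with (INR (S p)) by ring.
  rewrite <- pow_inv. replace (/ (INR (S p) / (INR (S p) + 1))) with (1 + / INR (S p)) by (field; lra).
  set (y := / INR (S p)).
  assert (Hy : 0 < y <= 1).
  { split; [apply Rinv_0_lt_compat; lra|apply Rinv_le_1; lra]. }
  (* The quantity is [(1 + 1 / (m - 1)) ^ m]: [m - 1] factors give at most [e], hence 3, and the
     last one is at most 2. *)
  assert (E : (1 + y) ^ S p <= 3).
  { apply Rle_trans with (exp y ^ S p).
    - apply pow_incr. split; [lra|apply exp_ineq1_le].
    - rewrite <- Rpower_pow by apply exp_pos. unfold Rpower. rewrite ln_exp. replace (INR (S p) * y) with 1 by (unfold y; field; lra). apply exp_le_3. }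
  change ((1 + y) * (1 + y) ^ S p <= 6).
  assert (0 <= (1 + y) ^ S p) by (apply pow_le; lra). nra.
Qed.

Lemma ex_series_inv_scaled (r : nat -> R) (x : R) :
  0 < x -> (forall k, 0 < r k) -> ex_series (fun k => / (1 + r k)) ->
  ex_series (fun k => / (1 + r k * x)).
Proof.
  intros Hx Hr Hs.
  apply (ex_series_le (V := R_CompleteNormedModule) _ (fun k => (1 + / x) * / (1 + r k))).
  - intro k. change (norm ?y) with (Rabs y). specialize (Hr k).
    assert (P : 0 < r k * x) by now apply Rmult_lt_0_compat.
    assert (Q : 0 < / x) by now apply Rinv_0_lt_compat.
    rewrite Rabs_pos_eq by (apply Rlt_le, Rinv_0_lt_compat; lra).
    apply Rmult_le_reg_r with ((1 + r k * x) * (1 + r k)); [apply Rmult_lt_0_compat; lra|].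
    replace (/ (1 + r k * x) * ((1 + r k * x) * (1 + r k))) with (1 + r k) by (field; lra).
    replace ((1 + / x) * / (1 + r k) * ((1 + r k * x) * (1 + r k)))
      with (1 + r k * x + / x + r k) by (field; lra). lra.
  - now apply (ex_series_scal_l (V := R_NormedModule)).
Qed.

(** The constant 12 is 2 from the remainder times 6 from dividing by [q ^ m]. The two upper
    conditions on [x] place the image of the whole circle where the expansion holds, [|z| > M0], and
    where the series converges, [Re z > c], whatever [m] is. *)
Lemma coef_bound (a : nat -> R) (beta : nat -> C) (f : C -> C) (c M0 x : R) (N m : nat) :
  (forall k, 0 < Re (beta k)) -> ex_series (fun k => / (1 + Re (beta k))) ->
  (forall z, c < Re z -> is_series (fun k => 2 * z / (z ^ 2 + beta k))%C (f z)) ->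
  (forall z, M0 < Cmod z -> Rabs (Carg z) <= PI / 2 - PI / 4 ->
     Cmod (f z - RtoC (1 / 2) * Clog (z / (2 * PI)) - sum_n (fun n => a n / z ^ n) (N + 2))%C
       <= 2 / Cmod z ^ (N + 2)) ->
  (1 <= N)%nat -> (2 <= m)%nat -> 0 < x -> 0 <= c -> 0 <= M0 ->
  M0 ^ 2 < / x -> 2 * c ^ 2 < / x ->
  Cmod (2 * Cseries (fun k => (/ (1 + beta k * x / INR m)) ^ S m)
     - model_coef a (N + 2) (INR m / x) m)%C <= 12 * sqrt x ^ (N + 1).
Proof.
  intros Hb Hs Hf Hexp HN Hm Hx Hc HM0 HxM Hxc.
  assert (Hm' : 2 <= INR m) by (apply (le_INR 2 m) in Hm; simpl in Hm; lra).
  set (s := INR m / x). set (q := (INR m - 1) / INR m).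
  assert (Hsp : 0 < s) by (apply Rdiv_lt_0_compat; lra).
  assert (Hq : 0 < q < 1).
  { unfold q. split; [apply Rdiv_lt_0_compat; lra|].
    apply Rmult_lt_reg_r with (INR m); [lra|]. unfold Rdiv. rewrite Rmult_assoc, Rinv_l; lra. }
  assert (Hsq : s * (1 - q) = / x) by (unfold s, q; field; lra).
  set (b := fun k => (beta k * x / INR m)%C).
  assert (NCm : RtoC (INR m) <> 0) by (intro E0; apply RtoC_inj in E0; lra).
  assert (NCx : RtoC x <> 0) by (intro E0; apply RtoC_inj in E0; lra).
  assert (NCs : RtoC s <> 0) by (intro E0; apply RtoC_inj in E0; lra).
  assert (Es : RtoC s = (INR m / x)%C).
  { unfold s. unfold Rdiv. rewrite RtoC_mult, RtoC_inv by lra. reflexivity. }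
  assert (Eb : forall k, b k = (beta k / s)%C).
  { intro k. unfold b. rewrite Es. field. split; auto. }
  assert (Rb : forall k, Re (b k) = Re (beta k) * / s).
  { intro k. rewrite Eb. unfold Cdiv. rewrite <- RtoC_inv by lra.
    unfold Re, Cmult, RtoC; cbn [fst snd]. ring. }
  assert (Hbp : forall k, 0 < Re (b k)).
  { intro k. rewrite Rb. apply Rmult_lt_0_compat; [apply Hb|now apply Rinv_0_lt_compat]. }
  assert (Hbs : ex_series (fun k => / (1 + Re (b k)))).
  { apply ex_series_ext with (fun k => / (1 + Re (beta k) * / s)).
    - intro k. now rewrite Rb.
    - apply (ex_series_inv_scaled (fun k => Re (beta k))); auto. now apply Rinv_0_lt_compat. }
  (* As [|1 - v| >= 1 - q], [|z| ^ 2 >= s (1 - q) = 1 / x]; the half-plane condition then follows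
     from [|z| ^ 2 <= 2 (Re z) ^ 2]. *)
  assert (Zfacts : forall v, Cmod v = q ->
    0 < Cmod (1 - v)%C /\ / x <= s * Cmod (1 - v)%C /\ M0 < Cmod (sqrt_pt s v)
    /\ c < Re (sqrt_pt s v)).
  { intros v Hv.
    assert (Hv1 : Cmod v < 1) by lra.
    assert (L : 1 - q <= Cmod (1 - v)%C).
    { rewrite <- Hv. generalize (Cmod_triangle (1 - v)%C v).
      replace (1 - v + v)%C with (RtoC 1) by ring. rewrite Cmod_1. lra. }
    assert (L2 : / x <= s * Cmod (1 - v)%C) by (rewrite <- Hsq; apply Rmult_le_compat_l; lra).
    assert (Z := Cmod_sqrt_pt s v Hsp Hv1).
    destruct (Re_sqrt_pt s v Hsp Hv1) as [R1 R2].
    generalize (Cmod_ge_0 (sqrt_pt s v)). intro Z0.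
    split; [lra|]. split; [exact L2|]. split; nra. }
  assert (HA : has_power_series q (fun v => s / (2 * sqrt_pt s v) * f (sqrt_pt s v))%C
     (fun l => Cseries (fun k => (/ (1 + b k)) ^ S l)%C)).
  { apply resolvent_has_power_series; auto.
    intros v Hv. destruct (Zfacts v Hv) as [F1 [F2 [F3 F4]]].
    assert (Hv1 : Cmod v < 1) by lra.
    assert (Nz : sqrt_pt s v <> 0) by apply Cexp_neq_0.
    apply is_Cseries_ext with (fun k => s / (2 * sqrt_pt s v) *
      (2 * sqrt_pt s v / (sqrt_pt s v ^ 2 + beta k)))%C.
    - intro k. rewrite sqrt_pt_sq by auto. rewrite Eb.
      assert (Nk : (1 + b k - v)%C <> 0).
      { apply Cmod_gt_0. generalize (Cmod_resolvent_ge (b k) v (Hbp k) Hv1) (Hbp k). nra. }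
      rewrite Eb in Nk.
      assert (Nk' : (s * (1 - v) + beta k)%C <> 0).
      { intro E0. apply Nk.
        replace (1 + beta k / s - v)%C with ((s * (1 - v) + beta k) / s)%C by (field; auto).
        rewrite E0. field. exact NCs. }
      Cfield. split; [exact NCs|split; [|exact Nz]].
      intro E0. apply Nk'. rewrite <- E0. ring.
    - apply is_Cseries_scal, Hf, F4. }
  assert (HH := has_power_series_minus q _ _ _ _ (Rlt_le _ _ (proj1 Hq))
     (has_power_series_scal q 2 _ _ HA) (model_power_series a (N + 2) s q Hsp Hq)).
  destruct HH as [H1 H2].
  (* The constant is what bounds [2 s / |z| ^ (N + 3)] once [|1 - v| ^ (- 2)] is split off;
     [1 - q ^ 2 >= 1 - q] then turns its [1 / s] into [x]. *)
  assert (CE := cauchy_estimate _ _ q (2 * / s * sqrt x ^ (N - 1)) m Hq H1 H2).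
  assert (sx : 0 < sqrt x) by now apply sqrt_lt_R0.
  lapply CE; clear CE; [intro CE|].
  - cbv beta in CE.
    set (X := Cmod _) in *. change (X <= 12 * sqrt x ^ (N + 1)).
    assert (Hqm : 0 < q ^ m) by (apply pow_lt; lra).
    assert (X0 : 0 <= X) by apply Cmod_ge_0.
    assert (B : 2 * / s * sqrt x ^ (N - 1) / (1 - q ^ 2) <= 2 * sqrt x ^ (N + 1)).
    { replace (N + 1)%nat with (N - 1 + 2)%nat by lia. rewrite pow_add.
      rewrite pow2_sqrt by lra.
      assert (Y : 0 <= sqrt x ^ (N - 1)) by (apply pow_le; lra).
      replace (2 * / s * sqrt x ^ (N - 1) / (1 - q ^ 2)) with
        (2 * (sqrt x ^ (N - 1) * (/ (s * (1 - q)) * / (1 + q)))) by (field; repeat split; nra).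
      rewrite Hsq, Rinv_inv.
      apply Rmult_le_compat_l; [lra|]. apply Rmult_le_compat_l; [exact Y|].
      assert (/ (1 + q) <= 1) by (apply Rinv_le_1; lra). nra. }
    assert (R6 := pow_ratio_le_6 m Hm). fold q in R6.
    replace X with (X * q ^ m * / q ^ m) by (field; lra).
    assert (0 < / q ^ m) by now apply Rinv_0_lt_compat.
    assert (0 <= X * q ^ m) by (apply Rmult_le_pos; lra).
    apply Rle_trans with (2 * sqrt x ^ (N + 1) * 6); [|lra].
    apply Rmult_le_compat; lra.
  - intros v Hv. destruct (Zfacts v Hv) as [F1 [F2 [F3 F4]]].
    assert (Hv1 : Cmod v < 1) by lra.
    assert (Nz : sqrt_pt s v <> 0) by apply Cexp_neq_0.
    assert (EZ := Hexp _ F3 (Carg_sqrt_pt s v)).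
    assert (Z := Cmod_sqrt_pt s v Hsp Hv1).
    set (z := sqrt_pt s v) in *.
    replace (2 * (s / (2 * z) * f z) - s / z * (RtoC (1 / 2) * Clog (z / (2 * PI))
       + sum_n (fun n => a n / z ^ n) (N + 2)))%C with
      (s / z * (f z - RtoC (1 / 2) * Clog (z / (2 * PI)) - sum_n (fun n => a n / z ^ n) (N + 2)))%C.
    2:{ set (Y := sum_n _ _). clearbody Y. change C in Y. field.
        exact Nz. }
    rewrite Cmod_mult, Cmod_div, Cmod_R, Rabs_pos_eq by (auto; lra).
    assert (Z0 : 0 < Cmod z) by now apply Cmod_gt_0.
    assert (Zx : / sqrt x <= Cmod z).
    { apply Rsqr_incr_0; [|apply Rlt_le, Rinv_0_lt_compat, sx|lra].
      unfold Rsqr. rewrite <- Rinv_mult, sqrt_sqrt by lra. nra. }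
    apply Rle_trans with (s / Cmod z * (2 / Cmod z ^ (N + 2))).
    { apply Rmult_le_compat_l; [|exact EZ]. apply Rlt_le, Rdiv_lt_0_compat; lra. }
    assert (W : / Cmod z ^ (N - 1) <= sqrt x ^ (N - 1)).
    { rewrite <- pow_inv. apply pow_incr. split; [apply Rlt_le, Rinv_0_lt_compat, Z0|].
      rewrite <- (Rinv_inv (sqrt x)). apply Rinv_le_contravar; [now apply Rinv_0_lt_compat|exact Zx]. }
    (* Of the [N + 3] factors [1 / |z|], four become [(s |1 - v|) ^ (- 2)] for the Poisson kernel,
       and the other [N - 1] are bounded by [sqrt x] each. *)
    apply Rle_trans with (2 * s / (Cmod z ^ 2) ^ 2 * / Cmod z ^ (N - 1)).
    { right. replace (N + 2)%nat with (3 + (N - 1))%nat by lia. rewrite pow_add.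
      assert (Cmod z ^ (N - 1) <> 0) by (apply pow_nonzero; lra). field. split; lra. }
    rewrite Z.
    apply Rle_trans with (2 * s / (s * Cmod (1 - v)%C) ^ 2 * sqrt x ^ (N - 1)).
    { apply Rmult_le_compat_l; [|exact W]. apply Rlt_le, Rdiv_lt_0_compat; [lra|].
      apply pow_lt, Rmult_lt_0_compat; lra. }
    right. field. split; lra.
Qed.

(** The power of [m] contained in that of [s = m / x] is exactly Gauss's normalisation; a pure power
    of [x] is left. *)
Lemma gauss_coef_rescale (nu x : R) (m : nat) : 0 < x -> (0 < m)%nat ->
  Rpower (INR m / x) (1 - nu) * binom_coef nu m = gauss_coef nu m * Rpower x (nu - 1).
Proof.
  intros Hx Hm. apply lt_0_INR in Hm. unfold gauss_coef, Rpower.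
  rewrite ln_div by auto.
  replace ((1 - nu) * (ln (INR m) - ln x)) with ((1 - nu) * ln (INR m) + (nu - 1) * ln x) by ring.
  rewrite exp_plus. ring.
Qed.

(** * Passage to the limit *)

Definition expansion_term (a : nat -> R) (x : R) (n : nat) : R :=
  a (n + 1)%nat / Gamma (1 + INR n / 2) * Rpower x (INR n / 2).

Definition leading_term (x : R) : R :=
  1 / (4 * sqrt (PI * x)) * ln (exp (- euler_const) / (16 * PI ^ 2 * x)).

(** The [ln m] of [ln s] cancels against that of the harmonic sum, and [gauss_coef (1 / 2)] supplies
    the factor [1 / sqrt PI]. *)
Lemma leading_term_lim (x : R) : 0 < x ->
  is_lim_seq (fun m => Rpower (INR m / x) (/ 2) * binom_coef (/ 2) m *
     (ln (INR m / x) / 4 - ln (2 * PI) / 2 - shifted_harmonic (/ 2) m / 4)) (leading_term x).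
Proof.
  intro Hx. assert (HP := PI_RGT_0).
  apply is_lim_seq_ext_loc with (fun m => gauss_coef (/ 2) m * Rpower x (- / 2) *
    (- (1 / 4) * (shifted_harmonic (/ 2) m - ln (INR m)) + (- (ln x / 4) - ln (2 * PI) / 2))).
  - exists 1%nat. intros m Hm. assert (Hm' := lt_0_INR m Hm).
    replace (- / 2) with (/ 2 - 1) by field.
    rewrite <- gauss_coef_rescale by (auto; lia). replace (1 - / 2) with (/ 2) by field.
    rewrite (ln_div (INR m) x) by auto. field.
  (* [16 PI ^ 2 = 2 ^ 2 (2 PI) ^ 2]: one factor stems from the [2 ln 2] of the harmonic limit, the
     other from [ln (2 PI) / 2]. *)
  - assert (E : leading_term x = / sqrt PI * Rpower x (- / 2) *
      (- (1 / 4) * (euler_const + 2 * ln 2) + (- (ln x / 4) - ln (2 * PI) / 2))).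
    { unfold leading_term. rewrite Rpower_Ropp, Rpower_sqrt by auto.
      assert (HP2 : 0 < PI ^ 2) by (apply pow_lt; lra).
      rewrite ln_div by (try apply exp_pos; apply Rmult_lt_0_compat; lra).
      rewrite ln_exp, !ln_mult by lra.
      replace 16 with (2 ^ 4) by ring. rewrite !ln_pow by lra.
      rewrite sqrt_mult by lra.
      assert (0 < sqrt PI) by now apply sqrt_lt_R0.
      assert (0 < sqrt x) by now apply sqrt_lt_R0.
      replace (INR 4) with 4 by (simpl; ring). replace (INR 2) with 2 by (simpl; ring).
      field. lra. }
    rewrite E. apply is_lim_seq_mult'.
    + apply is_lim_seq_mult'; [apply gauss_coef_half_lim|apply is_lim_seq_const].
    + apply is_lim_seq_plus'; [|apply is_lim_seq_const].
      apply is_lim_seq_mult'; [apply is_lim_seq_const|apply shifted_harmonic_half_lim].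
Qed.

Lemma is_lim_seq_sum_n (u : nat -> nat -> R) (l : nat -> R) (N : nat) :
  (forall n, (n <= N)%nat -> is_lim_seq (fun m => u m n) (l n)) ->
  is_lim_seq (fun m => sum_n (u m) N) (sum_n l N).
Proof.
  induction N; intro H.
  - rewrite sum_O. apply is_lim_seq_ext with (fun m => u m 0%nat).
    + intro m. now rewrite sum_O.
    + now apply H.
  - rewrite sum_Sn. apply is_lim_seq_ext with (fun m => sum_n (u m) N + u m (S N)).
    + intro m. now rewrite sum_Sn.
    + apply is_lim_seq_plus'; [apply IHN; intros; apply H; lia|apply H; lia].
Qed.

Lemma sum_n_shift (u : nat -> R) (N : nat) :
  u 0%nat = 0 -> sum_n u (S N) = sum_n (fun n => u (S n)) N.
Proof.
  intro H. induction N.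
  - rewrite sum_Sn, !sum_O, H. apply Rplus_0_l.
  - rewrite sum_Sn, IHN, sum_Sn. reflexivity.
Qed.

Lemma model_coef_lim (a : nat -> R) (M : nat) (x : R) : 0 < x -> a 0%nat = 0 ->
  is_lim_seq (fun m => model_coef a (S M) (INR m / x) m)
    (leading_term x + sum_n (expansion_term a x) M).
Proof.
  intros Hx Ha. unfold model_coef. apply is_lim_seq_plus'; [now apply leading_term_lim|].
  apply is_lim_seq_ext with (fun m => sum_n (fun n => a (n + 1)%nat *
    (Rpower (INR m / x) (1 - (1 + INR n / 2)) * binom_coef (1 + INR n / 2) m)) M).
  (* [a 0 = 0] removes the constant term, and the index shift turns [(n + 1) / 2] into [1 + n / 2],
     the arguments of [Gamma] in the theorem. *)
  - intro m. rewrite sum_n_shift by (rewrite Ha; ring).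
    apply sum_n_ext. intro n. rewrite Nat.add_1_r, S_INR.
    replace ((INR n + 1 + 1) / 2) with (1 + INR n / 2) by field. reflexivity.
  - apply (is_lim_seq_sum_n (fun m n => a (n + 1)%nat *
      (Rpower (INR m / x) (1 - (1 + INR n / 2)) * binom_coef (1 + INR n / 2) m))).
    intros n _. apply is_lim_seq_ext_loc with
      (fun m => a (n + 1)%nat * (gauss_coef (1 + INR n / 2) m * Rpower x (INR n / 2))).
    + exists 1%nat. intros m Hm. rewrite gauss_coef_rescale by (auto; lia).
      replace (1 + INR n / 2 - 1) with (INR n / 2) by ring. reflexivity.
    + replace (expansion_term a x n) with
        (a (n + 1)%nat * (/ Gamma (1 + INR n / 2) * Rpower x (INR n / 2)))
        by (unfold expansion_term, Rdiv; ring).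
      apply is_lim_seq_mult'; [apply is_lim_seq_const|].
      apply is_lim_seq_mult'; [apply gauss_coef_lim|apply is_lim_seq_const].
Qed.

(** Bernoulli's inequality gives [(1 + Re u / m) ^ (m + 1) >= 1 + Re u], hence a majorant free of
    [m] for the passage to the limit. *)
Lemma euler_product_bound (u : C) (m : nat) : (1 <= m)%nat -> 0 <= Re u ->
  Cmod ((/ (1 + u / INR m)) ^ S m)%C <= / (1 + Re u).
Proof.
  intros Hm Hu. apply lt_0_INR in Hm.
  assert (E : Re (u / INR m)%C = Re u * / INR m).
  { unfold Cdiv. rewrite <- RtoC_inv by lra. unfold Re, Cmult, RtoC; cbn [fst snd]. ring. }
  assert (P : 0 <= Re u * / INR m) by (apply Rmult_le_pos; [exact Hu|apply Rlt_le, Rinv_0_lt_compat, Hm]).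
  assert (H := Cmod_one_plus_ge (u / INR m)%C ltac:(lra)). rewrite E in H.
  rewrite Cmod_pow, Cmod_inv by (apply Cmod_gt_0; lra).
  rewrite pow_inv. apply Rinv_le_contravar; [lra|].
  apply Rle_trans with ((1 + Re u * / INR m) ^ S m); [|apply pow_incr; lra].
  (* [poly] asks for a strictly positive increment. *)
  destruct (Req_dec (Re u) 0) as [->|Nz].
  - rewrite Rmult_0_l, Rplus_0_r, pow1. lra.
  - assert (Q : 0 < Re u * / INR m) by (apply Rmult_lt_0_compat; [lra|apply Rinv_0_lt_compat, Hm]).
    assert (B := poly (S m) _ Q). rewrite S_INR in B.
    replace ((INR m + 1) * (Re u * / INR m)) with (Re u + Re u * / INR m) in B by (field; lra). lra.
Qed.

Lemma Cmod_Cexp_opp_le (u : C) : 0 <= Re u -> Cmod (Cexp (- u)) <= / (1 + Re u).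
Proof.
  intro H. rewrite Cmod_Cexp. change (Re (- u)%C) with (- Re u). rewrite exp_Ropp.
  apply Rinv_le_contravar; [lra|apply exp_ineq1_le].
Qed.

(** The bound of [coef_bound] does not depend on [m], so it survives [m -> oo]: the exponentials are
    reached by dominated convergence, the model coefficients by their explicit limits. *)
Lemma theta_expansion (a : nat -> R) (beta : nat -> C) (f : C -> C) (c M0 x : R) (N : nat) :
  (forall k, 0 < Re (beta k)) -> ex_series (fun k => / (1 + Re (beta k))) ->
  (forall z, c < Re z -> is_series (fun k => 2 * z / (z ^ 2 + beta k))%C (f z)) ->
  (forall z, M0 < Cmod z -> Rabs (Carg z) <= PI / 2 - PI / 4 ->
     Cmod (f z - RtoC (1 / 2) * Clog (z / (2 * PI)) - sum_n (fun n => a n / z ^ n) (N + 2))%C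
       <= 2 / Cmod z ^ (N + 2)) ->
  a 0%nat = 0 -> (1 <= N)%nat -> 0 < x -> 0 <= c -> 0 <= M0 ->
  M0 ^ 2 < / x -> 2 * c ^ 2 < / x ->
  Cmod (2 * Cseries (fun k => Cexp (- beta k * x))
     - RtoC (leading_term x + sum_n (expansion_term a x) (N + 1)))%C <= 12 * sqrt x ^ (N + 1).
Proof.
  intros Hb Hs Hf Hexp Ha HN Hx Hc HM0 HxM Hxc.
  assert (Ru : forall k, Re (beta k * x)%C = Re (beta k) * x).
  { intro k. unfold Re, Cmult, RtoC; cbn [fst snd]. ring. }
  assert (Pu : forall k, 0 < Re (beta k * x)%C).
  { intro k. rewrite Ru. apply Rmult_lt_0_compat; auto. }
  assert (HM : ex_series (fun k => / (1 + Re (beta k * x)%C))).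
  { apply ex_series_ext with (fun k => / (1 + Re (beta k) * x)).
    - intro k. now rewrite Ru.
    - now apply (ex_series_inv_scaled (fun k => Re (beta k))). }
  apply Clim_Cmod_le with (fun m =>
    2 * Cseries (fun k => (/ (1 + beta k * x / INR m)) ^ S m)
     - model_coef a (N + 2) (INR m / x) m)%C 2%nat.
  - apply Clim_minus.
    + apply Clim_scal.
      apply (tannery (fun m k => (/ (1 + beta k * x / INR m)) ^ S m)%C
        (fun k => Cexp (- beta k * x)%C) _ _ (fun k => / (1 + Re (beta k * x)%C)) 1 HM).
      * intros m k Hm. apply euler_product_bound; [exact Hm|apply Rlt_le, Pu].
      * intro k. replace (- beta k * x)%C with (- (beta k * x))%C by ring.
        apply Cexp_euler_limit, Rlt_le, Pu.
      * intros m Hm. apply (Cseries_correct _ (fun k => / (1 + Re (beta k * x)%C))); [|exact HM].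
        intro k. apply euler_product_bound; [exact Hm|apply Rlt_le, Pu].
      * apply (Cseries_correct _ (fun k => / (1 + Re (beta k * x)%C))); [|exact HM].
        intro k. replace (- beta k * x)%C with (- (beta k * x))%C by ring.
        apply Cmod_Cexp_opp_le, Rlt_le, Pu.
    + apply Clim_RtoC. replace (N + 2)%nat with (S (N + 1)) by lia. now apply model_coef_lim.
  - intros m Hm. now apply coef_bound with f c M0.
Qed.

(** * Consequences of the Riemann sequence conditions, and the theorem *)

Lemma Carg_lt_PI4 (z : C) : 0 < Re z -> Rabs (Carg z) < PI / 4 -> Im z ^ 2 < Re z ^ 2.
Proof.
  intros Hr Hc. assert (HP := PI_RGT_0).
  assert (Hm : 0 < Cmod z) by (apply Cmod_gt_0, Re_pos_neq_0, Hr).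
  assert (Ha : Rabs (acos (Re z / Cmod z)) < PI / 4).
  { unfold Carg in Hc. destruct (Rle_dec 0 (Im z)); [exact Hc|]. now rewrite Rabs_Ropp in Hc. }
  assert (B : -1 <= Re z / Cmod z <= 1).
  { generalize (re_le_Cmod z). intro K. apply Rabs_le_between in K. split.
    - apply Rmult_le_reg_r with (Cmod z); auto. unfold Rdiv. rewrite Rmult_assoc, Rinv_l; lra.
    - apply Rmult_le_reg_r with (Cmod z); auto. unfold Rdiv. rewrite Rmult_assoc, Rinv_l; lra. }
  assert (C1 := cos_acos _ B). assert (A := acos_bound (Re z / Cmod z)).
  rewrite Rabs_pos_eq in Ha by lra.
  (* The cosine decreases on [[0, PI]]; squaring then gives [2 (Re z) ^ 2 > |z| ^ 2]. *)
  assert (D : cos (PI / 4) < Re z / Cmod z).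
  { rewrite <- C1. apply cos_decreasing_1; lra. }
  assert (E : cos (PI / 4) ^ 2 = / 2).
  { rewrite cos_PI4. unfold Rdiv. rewrite Rpow_mult_distr, pow_inv, pow2_sqrt by lra. field. }
  assert (P0 : 0 < cos (PI / 4)) by (apply cos_gt_0; lra).
  assert (F : / 2 * Cmod z ^ 2 < Re z ^ 2).
  { rewrite <- E. replace (Re z) with (Re z / Cmod z * Cmod z) by (field; lra).
    rewrite !Rpow_mult_distr. apply Rmult_lt_compat_r; [apply pow_lt; lra|]. nra. }
  rewrite Cmod2_alt in F. lra.
Qed.

(** Positivity is the angle condition. For summability, take real parts in the series of clause (e)
    at one real point [t0]: they are [2 t0 T / (T ^ 2 + s ^ 2)] with [T = t0 ^ 2 + rho] and
    [rho + i s = alpha_k ^ 2]. In a strip [s ^ 2] is [O (T)], so these positive terms are bounded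
    below by a multiple of [1 / T], hence of [1 / (1 + rho)]. *)
Lemma riemann_sequence_summable (a : nat -> R) (alpha : nat -> C) :
  riemann_sequence a alpha ->
  (forall k, 0 < Re (alpha k ^ 2)%C) /\ ex_series (fun k => / (1 + Re (alpha k ^ 2)%C)).
Proof.
  intros [H1 Hmono _ _ [K HK] Harg [c [f [Hf _]]]].
  assert (Hre : forall k, 1 < Re (alpha k)).
  { induction k; [exact H1|]. generalize (Hmono k). lra. }
  assert (ReE : forall k, Re (alpha k ^ 2)%C = Re (alpha k) ^ 2 - Im (alpha k) ^ 2).
  { intro k. destruct (alpha k) as [p r]. unfold Re, Im; cbn. ring. }
  assert (ImE : forall k, Im (alpha k ^ 2)%C = 2 * Re (alpha k) * Im (alpha k)).
  { intro k. destruct (alpha k) as [p r]. unfold Re, Im; cbn. ring. }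
  assert (Hpos : forall k, 0 < Re (alpha k ^ 2)%C).
  { intro k. rewrite ReE. generalize (Carg_lt_PI4 (alpha k) ltac:(generalize (Hre k); lra) (Harg k)). lra. }
  split; [exact Hpos|].
  (* A real point of the half-plane of convergence; [t0 >= 1] gives [T >= 1] and
     [T <= t0 ^ 2 (1 + rho)]. *)
  set (t0 := Rmax (Rabs c + 1) 1).
  assert (T1 : 1 <= t0) by apply Rmax_r.
  assert (Tc : c < t0).
  { apply Rlt_le_trans with (Rabs c + 1); [generalize (Rle_abs c); lra|apply Rmax_l]. }
  destruct (Hf (RtoC t0) Tc) as [_ HS]. apply is_Cseries_Re in HS.
  (* Chosen so that [T ^ 2 + s ^ 2 <= Q T ^ 2], given [s ^ 2 = 4 (Re alpha_k) ^ 2 (Im alpha_k) ^ 2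
     <= 4 K ^ 2 (rho + K ^ 2)]. *)
  set (Q := 1 + 4 * K ^ 2 * (1 + K ^ 2)).
  apply (ex_series_le (V := R_CompleteNormedModule) _
    (fun k => Q * t0 / 2 * Re (2 * t0 / (t0 ^ 2 + alpha k ^ 2))%C)).
  2:{ apply (ex_series_scal_l (V := R_NormedModule)). eexists. exact HS. }
  intro k. change (norm ?y) with (Rabs y).
  specialize (Hpos k). assert (RI := ReE k). assert (II := ImE k).
  specialize (HK k).
  set (w := (alpha k ^ 2)%C) in *. set (rho := Re w) in *. set (s := Im w) in *.
  rewrite Rabs_pos_eq by (apply Rlt_le, Rinv_0_lt_compat; lra).
  assert (Ib : Im (alpha k) ^ 2 <= K ^ 2).
  { apply Rabs_lt_between in HK. nra. }
  assert (K2 : 0 <= K ^ 2) by apply pow2_ge_0.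
  assert (T2 : 1 <= t0 ^ 2) by nra.
  assert (Sb : s ^ 2 <= 4 * K ^ 2 * (rho + K ^ 2)).
  { rewrite II. replace ((2 * Re (alpha k) * Im (alpha k)) ^ 2) with
      (4 * (Im (alpha k) ^ 2 * Re (alpha k) ^ 2)) by ring.
    assert (Re (alpha k) ^ 2 <= rho + K ^ 2) by lra.
    assert (0 <= Re (alpha k) ^ 2) by apply pow2_ge_0.
    assert (0 <= Im (alpha k) ^ 2) by apply pow2_ge_0. nra. }
  set (T := t0 ^ 2 + rho). assert (HT : 1 <= T) by (unfold T; lra).
  assert (Sb' : T ^ 2 + s ^ 2 <= Q * T ^ 2).
  { assert (rho + K ^ 2 <= (1 + K ^ 2) * T) by (unfold T; nra).
    assert ((1 + K ^ 2) * T <= (1 + K ^ 2) * T ^ 2) by (apply Rmult_le_compat_l; nra).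
    assert (4 * K ^ 2 * (rho + K ^ 2) <= 4 * K ^ 2 * ((1 + K ^ 2) * T ^ 2)) by (apply Rmult_le_compat_l; lra).
    unfold Q. nra. }
  assert (RE : Re (2 * t0 / (t0 ^ 2 + w))%C = 2 * t0 * T / (T ^ 2 + s ^ 2)).
  { rewrite <- RtoC_pow. unfold T, rho, s. destruct w as [p r].
    unfold Re, Im, Cdiv, Cmult, Cinv, Cplus, RtoC; cbn [fst snd].
    assert (0 < (t0 ^ 2 + p) ^ 2 + r ^ 2).
    { unfold T, rho, Re in HT; cbn [fst] in HT. generalize (pow2_ge_0 r). nra. }
    field. nra. }
  rewrite RE.
  assert (D : 0 < T ^ 2 + s ^ 2) by (generalize (pow2_ge_0 s); nra).
  assert (HQ : 1 <= Q) by (unfold Q; nra).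
  apply Rmult_le_reg_r with ((1 + rho) * (T ^ 2 + s ^ 2)); [apply Rmult_lt_0_compat; lra|].
  replace (/ (1 + rho) * ((1 + rho) * (T ^ 2 + s ^ 2))) with (T ^ 2 + s ^ 2) by (field; lra).
  replace (Q * t0 / 2 * (2 * t0 * T / (T ^ 2 + s ^ 2)) * ((1 + rho) * (T ^ 2 + s ^ 2)))
    with (Q * (T * (t0 ^ 2 * (1 + rho)))) by (field; lra).
  eapply Rle_trans; [exact Sb'|]. apply Rmult_le_compat_l; [lra|].
  replace (T ^ 2) with (T * T) by ring. apply Rmult_le_compat_l; [lra|]. unfold T. nra.
Qed.

(** The limit 0 is weakened to a bound, for which 2 is an arbitrary positive choice. A nonnegative
    [M0] allows [M0 < |z|] to be checked on squares. *)
Lemma sector_expansion_bound (f : C -> C) (b : nat -> R) (N : nat) (eps : R) :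
  sector_expansion f b -> 0 < eps < PI / 2 ->
  exists M0, 0 <= M0 /\ forall z, M0 < Cmod z -> Rabs (Carg z) <= PI / 2 - eps ->
    Cmod (f z - sum_n (fun n => b n / z ^ n) N)%C <= 2 / Cmod z ^ N.
Proof.
  intros H Heps.
  assert (HP : locally (RtoC 0) (fun w => Cmod w < 2)).
  { apply (locally_le_locally_norm (V := C_NormedModule)).
    exists (mkposreal 2 Rlt_0_2). intros y Hy. unfold ball_norm in Hy.
    replace y with (y - RtoC 0)%C by ring. exact Hy. }
  destruct (H N eps Heps _ HP) as [M HM].
  exists (Rmax M 0). split; [apply Rmax_r|]. intros z Hz Hc.
  assert (M < Cmod z) by (eapply Rle_lt_trans; [apply Rmax_l|exact Hz]).
  assert (0 < Cmod z) by (eapply Rle_lt_trans; [apply Rmax_r|exact Hz]).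
  assert (K := HM z H0 Hc). cbv beta in K. rewrite Cmod_mult, Cmod_pow in K.
  assert (P : 0 < Cmod z ^ N) by now apply pow_lt.
  apply Rmult_le_reg_r with (Cmod z ^ N); [exact P|].
  replace (2 / Cmod z ^ N * Cmod z ^ N) with 2 by (field; lra). now apply Rlt_le.
Qed.

Lemma sqrt_pow_Rpower (x : R) (n : nat) : 0 < x -> sqrt x ^ n = Rpower x (INR n / 2).
Proof.
  intro Hx. rewrite <- Rpower_pow by now apply sqrt_lt_R0.
  rewrite <- Rpower_sqrt, Rpower_mult by auto. f_equal. field.
Qed.

Lemma Rpower_le_exponent (x u v : R) : 0 < x <= 1 -> u <= v -> Rpower x v <= Rpower x u.
Proof.
  intros Hx Huv. unfold Rpower. apply exp_le_compat.
  assert (ln x <= 0) by (rewrite <- ln_1; apply ln_le; lra). nra.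
Qed.

Theorem theorem25 :
  forall (E B : nat -> R) (alpha : nat -> C),
    is_euler_numbers E ->
    is_bernoulli_numbers B ->
    riemann_sequence (acoef E B) alpha ->
    exists theta : R -> C,
      (forall x : R, 0 < x ->
         is_series (fun n => Cexp (- (alpha n) ^ 2 * x)%C) (theta x)) /\
      (forall N : nat, (1 <= N)%nat ->
         exists K delta : R, 0 < delta /\
           forall x : R, 0 < x < delta ->
             Cmod (2 * theta x
                   - RtoC (1 / (4 * sqrt (PI * x))
                             * ln (exp (- euler_const) / (16 * PI ^ 2 * x))
                           + sum_n_m (fun n => acoef E B (n + 1)
                                                 / Gamma (1 + INR n / 2)
                                                 * Rpower x (INR n / 2))
                               0 (N - 1))%R)%C
             <= K * Rpower x (INR N / 2)).
Proof.
  intros E B alpha _ _ HR.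
  destruct (riemann_sequence_summable _ _ HR) as [Hpos Hsum].
  set (beta := fun k => (alpha k ^ 2)%C).
  exists (fun x => Cseries (fun k => Cexp (- beta k * x)%C)). split.
  - intros x Hx.
    assert (Ru : forall k, Re (beta k * x)%C = Re (beta k) * x).
    { intro k. unfold Re, Cmult, RtoC; cbn [fst snd]. ring. }
    apply (Cseries_correct _ (fun k => / (1 + Re (beta k) * x))).
    + intro k. replace (- alpha k ^ 2 * x)%C with (- (beta k * x))%C by (unfold beta; ring).
      rewrite <- Ru. apply Cmod_Cexp_opp_le. rewrite Ru.
      apply Rlt_le, Rmult_lt_0_compat; [apply Hpos|exact Hx].
    + now apply (ex_series_inv_scaled (fun k => Re (beta k))).
  - intros N HN. set (a := acoef E B).
    destruct HR as [_ _ _ _ _ _ [c0 [f [Hf Hsec]]]].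
    assert (HP := PI_RGT_0).
    destruct (sector_expansion_bound _ _ (N + 2) (PI / 4) Hsec ltac:(lra)) as [M0 [HM0 Hbd]].
    (* Raising the abscissa keeps the half-plane valid, and a nonnegative one lets [c < Re z] be
       checked on squares. *)
    set (c := Rmax c0 0). assert (Hc : 0 <= c) by apply Rmax_r.
    set (A := fun n => Rabs (a (n + 1)%nat / Gamma (1 + INR n / 2))).
    (* [delta] ensures [1 / x > M0 ^ 2], [1 / x > 2 c ^ 2] and [x <= 1] at once. In the constant, 12
       is for the remainder, [A N] and [A (S N)] for the two terms that the expansion used has
       beyond index [N - 1]. *)
    exists (12 + A N + A (S N)), (/ (1 + M0 ^ 2 + 2 * c ^ 2)).
    assert (HD : 1 <= 1 + M0 ^ 2 + 2 * c ^ 2).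
    { generalize (pow2_ge_0 M0) (pow2_ge_0 c). lra. }
    split; [apply Rinv_0_lt_compat; lra|]. intros x [Hx Hxd].
    assert (Hxi : 1 + M0 ^ 2 + 2 * c ^ 2 < / x).
    { rewrite <- (Rinv_inv (1 + M0 ^ 2 + 2 * c ^ 2)). apply Rinv_lt_contravar; [|exact Hxd].
      apply Rmult_lt_0_compat; [exact Hx|apply Rinv_0_lt_compat; lra]. }
    assert (Hx1 : x <= 1).
    { apply Rlt_le, Rlt_le_trans with (1 := Hxd). now apply Rinv_le_1. }
    assert (T := theta_expansion a beta f c M0 x N Hpos Hsum).
    assert (T' : Cmod (2 * Cseries (fun k => Cexp (- beta k * x))
      - RtoC (leading_term x + sum_n (expansion_term a x) (N + 1)))%C <= 12 * sqrt x ^ (N + 1)).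
    { apply T; auto; try (generalize (pow2_ge_0 M0) (pow2_ge_0 c); lra).
      - intros z Hz. apply Hf. eapply Rle_lt_trans; [apply Rmax_l|exact Hz].
      - intros z Hz Hz'. specialize (Hbd z Hz Hz'). rewrite RtoC_div by lra. exact Hbd. }
    clear T. set (th := Cseries _) in *.
    (* Prepares to detach the terms of index [N] and [N + 1]; as [N >= 1], the truncated subtraction
       is exact. *)
    replace (N + 1)%nat with (S (S (N - 1))) in T' at 1 by lia.
    rewrite !sum_Sn in T'. replace (S (N - 1)) with N in T' by lia.
    change (sum_n_m _ 0 (N - 1)) with (sum_n (expansion_term a x) (N - 1)).
    fold (leading_term x).
    set (S1 := sum_n _ _) in *. set (TN := expansion_term a x N) in *.
    set (TN1 := expansion_term a x (S N)) in *.
    change (@plus R_AbelianMonoid) with Rplus in T'.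
    replace (2 * th - RtoC (leading_term x + S1))%C with
      ((2 * th - RtoC (leading_term x + (S1 + TN + TN1))) + (RtoC TN + RtoC TN1))%C
      by (rewrite !RtoC_plus; ring).
    eapply Rle_trans; [apply Cmod_triangle|].
    assert (L : Rpower x (INR (S N) / 2) <= Rpower x (INR N / 2)).
    { apply Rpower_le_exponent; [lra|]. rewrite S_INR. lra. }
    assert (P : 0 < Rpower x (INR N / 2)) by apply exp_pos.
    assert (P' : 0 < Rpower x (INR (S N) / 2)) by apply exp_pos.
    assert (B0 : Cmod (RtoC TN + RtoC TN1)%C <= (A N + A (S N)) * Rpower x (INR N / 2)).
    { eapply Rle_trans; [apply Cmod_triangle|]. rewrite !Cmod_R.
      unfold TN, TN1, expansion_term. rewrite !Rabs_mult.
      rewrite (Rabs_pos_eq (Rpower x (INR N / 2))), (Rabs_pos_eq (Rpower x (INR (S N) / 2))) by lra.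
      fold (A N) (A (S N)). assert (0 <= A (S N)) by apply Rabs_pos. nra. }
    rewrite Nat.add_1_r, sqrt_pow_Rpower in T' by exact Hx. lra.
Qed.
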